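(* Let $H$ be a finite dimensional semisimple and cosemisimple Hopf algebra over a field $k$, let $A/B$ be an $H$-Galois extension, and let $M$ be a right $(A,H)$-Hopf module. Then there is an isomorphism of graded algebras $$\operatorname{Ext}^*_B(M,M)\cong\operatorname{Ext}^*_A(M,M)\#H^*.$$
   Context: All algebras and modules are over a fixed field $k$, $\otimes=\otimes_k$. If $A$ is a right $H$-comodule algebra with coaction $a\mapsto \sum a_{(0)}\otimes a_{(1)}$ and coinvariant subalgebra $B=A^{coH}=\{a : \sum a_{(0)}\otimes a_{(1)}=a\otimes 1\}$, then $A/B$ is called an $H$-Galois extension if the canonical map $A\otimes_B A\to A\otimes H$, $a\otimes a'\mapsto \sum aa'_{(0)}\otimes a'_{(1)}$, is bijective. A right $(A,H)$-Hopf module is a right $A$-module $M$ that is also a right $H$-comodule with $\rho(ma)=\sum m_{(0)}a_{(0)}\otimes m_{(1)}a_{(1)}$; morphisms are $A$-linear and $H$-colinear. It becomes a left $H^*$-module by $\alpha m=\sum m_{(0)}\alpha(m_{(1)})$. $\operatorname{Ext}_A^*(M,M)=\bigoplus_{i\in\mathbb Z}\operatorname{Hom}_{D(A)}(M,M[i])$ is a graded algebra under the Yoneda product, where $D(A)$ is the derived category of right $A$-modules; similarly for $\operatorname{Ext}_B^*(M,M)$, with $M$ viewed as a $B$-module by restriction. For a complex $M^\cdot$ of $(A,H)$-Hopf modules, $H^*$ acts on the left on $\operatorname{Hom}_A(M^\cdot,M^\cdot)$ by $(\alpha\cdot f)(m)=\sum\alpha_{(1)}f(S(\alpha_{(2)})m)$,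 making it a differential graded left $H^*$-module algebra. This induces a graded left $H^*$-module algebra structure on $\operatorname{Ext}^*_A(M,M)$ (computed with a resolution of $M$ by $(A,H)$-Hopf modules that are projective over $A$). The smash product $R\#H^*$ of a left $H^*$-module algebra $R$ is $R\otimes H^*$ with product $(x\#\alpha)(y\#\gamma)=\sum x(\alpha_{(1)}\cdot y)\#\alpha_{(2)}\gamma$, graded by the degree of $R$. *)

(* Defs.v *)
From HB Require Import structures.
From mathcomp Require Import all_boot all_order all_algebra all_field.
From mathcomp Require Import boolp.

Set Implicit Arguments.
Unset Strict Implicit.
Unset Printing Implicit Defensive.

Import Order.TTheory GRing.Theory Num.Theory.
Local Open Scope ring_scope.
Local Open Scope quotient_scope.

(* Tensor products V ⊗ W over the base field, for W finite dimensional. *)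
(* If (b_i) is the chosen basis of W, each element of V ⊗ W is uniquely *)
(* Σ_i x_i ⊗ b_i, and it is encoded as the function i |-> x_i. *)

Notation tens V W := {ffun 'I_(\dim (fullv : {vspace W})) -> V}.

Definition bas (k : fieldType) (W : vectType k)
  (i : 'I_(\dim (fullv : {vspace W}))) : W := (vbasis (fullv : {vspace W}))`_i.

Definition pure (k : fieldType) (V : lmodType k) (W : vectType k)
    (v : V) (w : W) : tens V W :=
  [ffun i => coord (vbasis (fullv : {vspace W})) i w *: v].

(* Sweedler sums: for x = Σ x_(0) ⊗ x_(1) and F bilinear, *)
(* sw x F = Σ F x_(0) x_(1). *)
Definition sw (k : fieldType) (V : lmodType k) (W : vectType k)
    (U : nmodType) (x : tens V W) (F : V -> W -> U) : U :=
  \sum_i F (x i) (bas i).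

Section TensLemmas.
Variables (k : fieldType) (V : lmodType k) (W : vectType k).

Lemma pure_coordE (w : W) :
  w = \sum_i coord (vbasis (fullv : {vspace W})) i w *: bas i.
Proof. by rewrite {1}(coord_vbasis (memvf w)). Qed.

Lemma sw_pure (U : lmodType k) (v : V) (w : W) (F : V -> W -> U) :
    (forall w, linear (F ^~ w)) -> (forall v, linear (F v)) ->
  sw (pure v w) F = F v w.
Proof.
move=> Fl Fr; rewrite /sw [in RHS](pure_coordE w).
have FrD : {morph F v : x y / x + y}.
  by move=> x y; have := Fr v 1 x y; rewrite !scale1r.
have FlZ a u x : F (a *: u) x = a *: F u x.
  have F0 : F 0 x = 0.
    have := Fl x 1 0 0; rewrite !scale1r addr0 => /eqP.
    by rewrite -subr_eq subrr => /eqP.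
  by have := Fl x a u 0; rewrite !addr0 F0 addr0.
have F0r : F v 0 = 0.
  have := FrD 0 0; rewrite addr0 => /eqP.
  by rewrite -subr_eq subrr => /eqP.
have FrZ a x : F v (a *: x) = a *: F v x.
  by have := Fr v a x 0; rewrite !addr0 F0r addr0.
rewrite (big_morph (F v) FrD F0r); apply: eq_bigr => i _.
by rewrite ffunE FlZ FrZ.
Qed.

Lemma pure_linearl (w : W) : linear (fun v : V => pure v w).
Proof.
by move=> a u v; apply/ffunP => i; rewrite !ffunE scalerDr !scalerA mulrC.
Qed.

Lemma pure_linearr (v : V) : linear (fun w : W => pure v w).
Proof.
move=> a u w; apply/ffunP => i.
by rewrite !ffunE linearP scalerDl scalerA.
Qed.

End TensLemmas.

Record hopf_algebra (k : fieldType) := HopfAlgebra {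
  hopf_alg :> falgType k;
  comul : {linear hopf_alg -> tens hopf_alg hopf_alg};
  counit : {linear hopf_alg -> k^o};
  antipode : {linear hopf_alg -> hopf_alg};
  comulA : forall h,
    sw (comul h) (fun h1 h2 => pure (comul h1) h2) =
    sw (comul h) (fun h1 h2 =>
      sw (comul h2) (fun h2' h2'' => pure (pure h1 h2') h2''));
  counitl : forall h, sw (comul h) (fun h1 h2 => counit h1 *: h2) = h;
  counitr : forall h, sw (comul h) (fun h1 h2 => counit h2 *: h1) = h;
  comul1 : comul 1 = pure 1 1;
  comulM : forall g h, comul (g * h) =
    sw (comul g) (fun g1 g2 =>
      sw (comul h) (fun h1 h2 => pure (g1 * h1) (g2 * h2)));
  counit1 : counit 1 = 1;
  counitM : forall g h, counit (g * h) = counit g * counit h;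
  antipodel : forall h,
    sw (comul h) (fun h1 h2 => antipode h1 * h2) = counit h *: 1;
  antipoder : forall h,
    sw (comul h) (fun h1 h2 => h1 * antipode h2) = counit h *: 1
}.

(* The regular left module is semisimple: each left ideal has a complement *)
(* which is a left ideal. *)
Definition left_ideal (k : fieldType) (H : falgType k) (I : {vspace H}) :=
  (fullv * I <= I)%VS.

Definition semisimple (k : fieldType) (H : falgType k) :=
  forall I : {vspace H}, left_ideal I ->
  exists J : {vspace H},
    [/\ left_ideal J, (I :&: J = 0)%VS & (I + J = fullv)%VS].

Definition subcoalgebra (k : fieldType) (H : hopf_algebra k)
    (C : {vspace H}) : Prop :=
  forall c, c \in C ->
  comul H c \in <<[seq pure u v | u <- vbasis C, v <- vbasis C]>>%VS.

Definition simple_subcoalgebra (k : fieldType) (H : hopf_algebra k)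
    (C : {vspace H}) : Prop :=
  [/\ subcoalgebra C, C != 0%VS &
      forall D : {vspace H}, subcoalgebra D -> (D <= C)%VS ->
        D = 0%VS \/ D = C].

Definition cosemisimple (k : fieldType) (H : hopf_algebra k) : Prop :=
  exists s : seq {vspace H},
    (forall C, C \in s -> simple_subcoalgebra C) /\
    (\sum_(C <- s) C = fullv)%VS.

Section Dual.
Variables (k : fieldType) (H : hopf_algebra k).
Local Notation D := 'Hom(H, k^o).

Definition dual_mul (a b : D) : D :=
  linfun (fun h => sw (comul H h) (fun h1 h2 => a h1 * b h2) : k^o).

Definition dual_one : D := linfun (counit H).

(* Σ a_(1) ⊗ a_(2) = Σ_j a(- b_j) ⊗ b'_j, where (b_j) is the basis of H and *)
(* (b'_j) the dual basis: indeed a(g h) = Σ_j a(g b_j) b'_j(h). *)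
Definition dual_comul (a : D) : tens D D :=
  \sum_(j < \dim (fullv : {vspace H}))
    pure (linfun (fun g : H => a (g * bas j)) : D)
         (linfun (fun h : H => coord (vbasis fullv) j h : k^o)).

Definition dual_antipode (a : D) : D := linfun (fun h => a (antipode H h)).

End Dual.

Record comodule_algebra (k : fieldType) (H : hopf_algebra k) := ComoduleAlgebra {
  coma_alg :> algType k;
  coact : {linear coma_alg -> tens coma_alg H};
  coactA : forall a,
    sw (coact a) (fun a0 a1 => pure (coact a0) a1) =
    sw (coact a) (fun a0 a1 =>
      sw (comul H a1) (fun h1 h2 => pure (pure a0 h1) h2));
  coact_counit : forall a, sw (coact a) (fun a0 a1 => counit H a1 *: a0) = a;
  coact1 : coact 1 = pure 1 1;
  coactM : forall a b, coact (a * b) =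
    sw (coact a) (fun a0 a1 =>
      sw (coact b) (fun b0 b1 => pure (a0 * b0) (a1 * b1)))
}.

Section Coinvariants.
Variables (k : fieldType) (H : hopf_algebra k) (A : comodule_algebra H).

Definition coinvariant : {pred A} := fun a => coact A a == pure a 1.

Lemma sw_coact_mul (x : A) (y : A) : coinvariant x ->
  coact A (x * y) = sw (coact A y) (fun y0 y1 => pure (x * y0) y1).
Proof.
move=> /eqP xP; rewrite coactM xP sw_pure.
- by apply: eq_bigr => i _; rewrite mul1r.
- move=> w a u v; rewrite /sw scaler_sumr -big_split; apply: eq_bigr => i _ /=.
  by rewrite mulrDl -scalerAl pure_linearl.
- move=> v a u w; rewrite /sw scaler_sumr -big_split; apply: eq_bigr => i _ /=.
  by rewrite mulrDl -scalerAl pure_linearr.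
Qed.

Lemma coinvariant_closed : GRing.subsemialg_closed coinvariant.
Proof.
split; [|split|move=> a x|move=> x y].
- by apply/eqP; exact: coact1.
- by apply/eqP/ffunP => i; rewrite linear0 !ffunE scaler0.
- move=> x y /eqP xP /eqP yP; apply/eqP.
  by rewrite linearD xP yP; apply/ffunP => i; rewrite !ffunE scalerDr.
- move=> /eqP xP; apply/eqP; rewrite linearZ /= xP.
  by apply/ffunP => i; rewrite !ffunE !scalerA mulrC.
- move=> xP /eqP yP; apply/eqP; rewrite sw_coact_mul // yP sw_pure //.
  + by move=> w a u v; rewrite mulrDr -scalerAr pure_linearl.
  + by move=> v; exact: pure_linearr.
Qed.

Record coinv := Coinv { coinv_val : A; _ : coinvariant coinv_val }.
HB.instance Definition _ := [isSub for coinv_val].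
HB.instance Definition _ := [Choice of coinv by <:].
HB.instance Definition _ :=
  GRing.SubChoice_isSubAlgebra.Build k A coinvariant coinv coinvariant_closed.

End Coinvariants.

(* The tensor product A ⊗_S A over a subalgebra S: formal sums of pairs *)
(* modulo the congruence generated by biadditivity and S-balancedness. *)

Section BalancedTensor.
Variables (A : nzRingType) (S : {pred A}).

Inductive bal_rel : seq (A * A) -> seq (A * A) -> Prop :=
| bal_refl s : bal_rel s s
| bal_sym s t : bal_rel s t -> bal_rel t s
| bal_trans s t u : bal_rel s t -> bal_rel t u -> bal_rel s u
| bal_cat s s' t t' : bal_rel s s' -> bal_rel t t' -> bal_rel (s ++ t) (s' ++ t')
| bal_comm s t : bal_rel (s ++ t) (t ++ s)
| bal_zero y : bal_rel [:: (0, y)] [::]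
| bal_addl x x' y : bal_rel [:: (x + x', y)] [:: (x, y); (x', y)]
| bal_addr x y y' : bal_rel [:: (x, y + y')] [:: (x, y); (x, y')]
| bal_mid x b y : b \in S -> bal_rel [:: (x * b, y)] [:: (x, b * y)].

Definition bal_relb (s t : seq (A * A)) : bool := `[< bal_rel s t >].

Lemma bal_relb_equiv : equiv_class_of bal_relb.
Proof.
split=> [s|s t|t s u].
- exact/asboolP/bal_refl.
- by apply/asboolP/asboolP; exact: bal_sym.
- by move=> /asboolP st /asboolP tu; apply/asboolP; apply: bal_trans st tu.
Qed.

Canonical bal_equiv := EquivRelPack bal_relb_equiv.

Definition bal_tens := {eq_quot bal_equiv}.

End BalancedTensor.

Section Galois.
Variables (k : fieldType) (H : hopf_algebra k) (A : comodule_algebra H).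

Definition formal_can (s : seq (A * A)) : tens A H :=
  \sum_(p <- s) sw (coact A p.2) (fun a0 a1 => pure (p.1 * a0) a1).

(* A ⊗_B A -> A ⊗ H, a ⊗ a' |-> Σ a a'_(0) ⊗ a'_(1) *)
Definition can_map (q : bal_tens (@coinvariant k H A)) : tens A H :=
  formal_can (repr q).

Lemma formal_can_bal s t :
  bal_rel (@coinvariant k H A) s t -> formal_can s = formal_can t.
Proof.
rewrite /formal_can; elim=> {s t}.
- by [].
- by move=> s t _ ->.
- by move=> s t u _ -> _ ->.
- by move=> s s' t t' _ IHs _ IHt; rewrite !big_cat /= IHs IHt.
- by move=> s t; rewrite !big_cat /= addrC.
- move=> y; rewrite big_seq1 big_nil; apply: big1 => i _ /=.
  by apply/ffunP => j; rewrite !ffunE mul0r scaler0.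
- move=> x x' y; rewrite !big_cons !big_nil !addr0 -big_split.
  apply: eq_bigr => i _ /=.
  by apply/ffunP => j; rewrite !ffunE mulrDl scalerDr.
- move=> x y y'; rewrite !big_cons !big_nil !addr0 -big_split.
  apply: eq_bigr => i _ /=; rewrite linearD /=.
  by apply/ffunP => j; rewrite !ffunE mulrDr scalerDr.
- move=> x b y bS; rewrite !big_seq1 /= sw_coact_mul //.
  rewrite /sw; set z := coact A y.
  under [RHS]eq_bigr => i _ do rewrite sum_ffunE.
  apply/esym; transitivity
    (\sum_i \sum_j pure (x * pure (b * z j) (bas j) i) (bas i : H)).
    apply: eq_bigr => i _; apply/ffunP => l.
    rewrite sum_ffunE ffunE mulr_sumr scaler_sumr.
    by apply: eq_bigr => j _; rewrite !ffunE.
  rewrite exchange_big; apply: eq_bigr => j _ /=.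
  rewrite -/(sw (pure (b * z j) (bas j)) (fun a h => pure (x * a) h)).
  rewrite sw_pure ?mulrA // => [w a u v|v]; last exact: pure_linearr.
  by rewrite mulrDr -scalerAr pure_linearl.
Qed.

Lemma can_mapE (s : seq (A * A)) :
  can_map (\pi_(bal_tens (@coinvariant k H A)) s)%qT = formal_can s.
Proof.
apply: formal_can_bal; apply/asboolP.
by have /eqquotP := reprK (\pi_(bal_tens (@coinvariant k H A)) s)%qT.
Qed.

Definition is_galois : Prop := bijective can_map.

End Galois.

Record rmodule (k : fieldType) (A : algType k) := RModule {
  rmod_car :> lmodType k;
  ract : rmod_car -> A -> rmod_car;
  ract_linearl : forall a, linear (ract ^~ a);
  ract_linearr : forall m, linear (ract m);
  ract1 : forall m, ract m 1 = m;
  ractM : forall m a b, ract (ract m a) b = ract m (a * b)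
}.

Definition rlinear (k : fieldType) (A : algType k) (M N : rmodule A)
    (f : M -> N) : Prop :=
  linear f /\ forall m a, f (ract m a) = ract (f m) a.

Definition rprojective (k : fieldType) (A : algType k) (P : rmodule A) : Prop :=
  forall (M N : rmodule A) (g : M -> N) (f : P -> N),
    rlinear g -> (forall y, exists x, g x = y) -> rlinear f ->
  exists2 h : P -> M, rlinear h & forall x, g (h x) = f x.

Section ZeroModule.
Variables (k : fieldType) (A : algType k).
Let zact (m : 'rV[k]_0) (a : A) : 'rV[k]_0 := 0.
Lemma zact_linearl a : linear (zact ^~ a).
Proof. by move=> c u v; rewrite /zact scaler0 addr0. Qed.
Lemma zact_linearr m : linear (zact m).
Proof. by move=> c u v; rewrite /zact scaler0 addr0. Qed.
Lemma zact1 m : zact m 1 = m. Proof. by rewrite [m]thinmx0. Qed.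
Lemma zactM m a b : zact (zact m a) b = zact m (a * b). Proof. by []. Qed.
Definition rzero : rmodule A := RModule zact_linearl zact_linearr zact1 zactM.
End ZeroModule.

Section Restriction.
Variables (k : fieldType) (H : hopf_algebra k) (A : comodule_algebra H).
Variable M : rmodule A.
Let bact (m : M) (b : coinv A) : M := ract m (val b).
Lemma bact_linearl b : linear (bact ^~ b). Proof. exact: ract_linearl. Qed.
Lemma bact_linearr m : linear (bact m).
Proof.
by move=> c u v; rewrite /bact -(ract_linearr m c (val u)) linearP.
Qed.
Lemma bact1 m : bact m 1 = m. Proof. exact: ract1. Qed.
Lemma bactM m a b : bact (bact m a) b = bact m (a * b).
Proof. exact: ractM. Qed.
Definition restr : rmodule (coinv A : algType k) :=
  @RModule k (coinv A) M bact bact_linearl bact_linearr bact1 bactM.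
End Restriction.

(* Complexes (cohomological grading).  A homogeneous map X -> Y of degree n *)
(* is a family of A-linear maps f i j : X i -> Y j that vanish unless *)
(* j = i + n; indexing by both degrees avoids transports between Y (i + n) *)
(* and Y j. *)

Section Complexes.
Variables (k : fieldType) (A : algType k).

Definition fam (X Y : int -> rmodule A) := forall i j : int, X i -> Y j.

Definition homogeneous (X Y : int -> rmodule A) (n : int) (f : fam X Y) : Prop :=
  (forall i j, rlinear (f i j)) /\
  (forall i j, j != i + n -> forall x, f i j x = 0).

Record complex := Complex {
  cobj :> int -> rmodule A;
  cdiff : fam cobj cobj;
  cdiff_homogeneous : homogeneous 1 cdiff;
  cdiffK : forall i j l x, @cdiff j l (@cdiff i j x) = 0
}.
Arguments cdiff : clear implicits.

Definition add_fam (X Y : int -> rmodule A) (f g : fam X Y) : fam X Y :=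
  fun i j x => f i j x + g i j x.

Definition scale_fam (X Y : int -> rmodule A) (c : k) (f : fam X Y) : fam X Y :=
  fun i j x => c *: f i j x.

Definition zero_fam (X Y : int -> rmodule A) : fam X Y := fun i j x => 0.

Definition id_fam (X : int -> rmodule A) : fam X X :=
  fun i j x => if @eqP _ i j is ReflectT e then eq_rect i X x j e else 0.

(* n is the degree of f. *)
Definition comp_fam (X Y Z : int -> rmodule A) (n : int)
    (g : fam Y Z) (f : fam X Y) : fam X Z :=
  fun i l x => g (i + n) l (f i (i + n) x).

(* Cocycles of degree n of the complex Hom_A(X, Y), that is, chain maps *)
(* X -> Y[n], where Y[n]^i = Y^(i+n) with differential (-1)^n d. *)
Definition cocycle (X Y : complex) (n : int) (f : fam X Y) : Prop :=
  homogeneous n f /\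
  forall i j x, cdiff Y j (j + 1) (f i j x) =
    (-1) ^+ `|n|%N *: f (i + 1) (j + 1) (cdiff X i (i + 1) x).

(* f - g = d \o h - (-1)^(n-1) h \o d *)
Definition homotopic (X Y : complex) (n : int) (f g : fam X Y) : Prop :=
  exists2 h : fam X Y, homogeneous (n - 1) h &
  forall i j x, f i j x - g i j x =
    cdiff Y (j - 1) j (h i (j - 1) x) +
    (-1) ^+ `|n|%N *: h (i + 1) j (cdiff X i (i + 1) x).

Definition quasi_iso (X Y : complex) (s : fam X Y) : Prop :=
  (forall i (x : X i), cdiff X i (i + 1) x = 0 ->
     (exists y, s i i x = cdiff Y (i - 1) i y) ->
     exists x', x = cdiff X (i - 1) i x') /\
  (forall i (y : Y i), cdiff Y i (i + 1) y = 0 ->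
     exists2 x : X i, cdiff X i (i + 1) x = 0 &
     exists y', s i i x - y = cdiff Y (i - 1) i y').

Definition stalk_obj (M : rmodule A) (i : int) : rmodule A :=
  if i is Posz 0 then M else rzero A.

Lemma rlinear0 (M N : rmodule A) : rlinear (fun _ : M => 0 : N).
Proof.
split=> [c u v|m a]; first by rewrite scaler0 addr0.
have := ract_linearl a 1 (0 : N) 0; rewrite !scale1r addr0 => /eqP.
by rewrite -subr_eq subrr => /eqP.
Qed.

Lemma zero_fam_homogeneous X Y n : homogeneous n (@zero_fam X Y).
Proof. by split=> // i j; exact: rlinear0. Qed.

Definition stalk (M : rmodule A) : complex :=
  Complex (@zero_fam_homogeneous (stalk_obj M) (stalk_obj M) 1)
    (fun _ _ _ _ => erefl).

End Complexes.

Arguments cdiff {k A} X i j x : rename.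
Arguments add_fam {k A X Y} f g i j x : rename.
Arguments scale_fam {k A X Y} c f i j x : rename.
Arguments zero_fam {k A} X Y i j x : rename.
Arguments id_fam {k A} X i j x : rename.
Arguments comp_fam {k A X Y Z} n g f i l x : rename.

(* Morphisms of the derived category D(A): an element of *)
(* Hom_{D(A)}(X, Y[n]) is an equivalence class of roofs X <-s- Z -f-> Y[n], *)
(* with s a quasi-isomorphism. *)

Section Derived.
Variables (k : fieldType) (A : algType k).
Implicit Types X Y Z : complex A.

Record roof X Y (n : int) := Roof {
  apex : complex A;
  roof_s : fam apex X;
  roof_f : fam apex Y;
  roof_sP : cocycle 0 roof_s;
  roof_sQ : quasi_iso roof_s;
  roof_fP : cocycle n roof_f
}.
Arguments roof_s {X Y n} r i j x : rename.
Arguments roof_f {X Y n} r i j x : rename.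

Definition roof_eq X Y n (r r' : roof X Y n) : Prop :=
  exists (W : complex A) (u : fam W (apex r)) (u' : fam W (apex r')),
  [/\ cocycle 0 u, cocycle 0 u',
      quasi_iso (comp_fam 0 (roof_s r) u),
      homotopic 0 (comp_fam 0 (roof_s r) u) (comp_fam 0 (roof_s r') u') &
      homotopic n (comp_fam 0 (roof_f r) u) (comp_fam 0 (roof_f r') u')].

Definition dhom X Y n :=
  {c : roof X Y n -> Prop | exists r, c = roof_eq r}.

Definition dclass X Y n (r : roof X Y n) : dhom X Y n :=
  exist _ (roof_eq r) (ex_intro _ r erefl).

(* The class c is represented by the roof X <-s- Z -f-> Y[n]. *)
Definition represents X Y n (c : dhom X Y n) Z (s : fam Z X) (f : fam Z Y) :
    Prop :=
  exists (sP : cocycle 0 s) (sQ : quasi_iso s) (fP : cocycle n f),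
    c = dclass (Roof sP sQ fP).

Lemma id_famE (X : int -> rmodule A) i (x : X i) : id_fam X i i x = x.
Proof.
rewrite /id_fam; case: eqP => // e.
by rewrite (eq_irrelevance e erefl).
Qed.

Lemma id_fam_neq (X : int -> rmodule A) i j (x : X i) :
  i != j -> id_fam X i j x = 0 :> X j.
Proof. by rewrite /id_fam; case: eqP. Qed.

Lemma id_fam_homogeneous (X : int -> rmodule A) : homogeneous 0 (id_fam X).
Proof.
split=> [i j|i j]; last first.
  by rewrite addr0 eq_sym => ij x; rewrite id_fam_neq.
have [<-|ij] := eqVneq i j.
  by split=> [c u v|m a]; rewrite !id_famE.
have [R1 R2] := rlinear0 (X i) (X j).
by split=> [c u v|m a]; rewrite !id_fam_neq //; [exact: R1|exact: R2].
Qed.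

Lemma cdiff0 X i j : cdiff X i j 0 = 0.
Proof.
have [/(_ i j)[/(_ 1 0 0)] + _ _] := cdiff_homogeneous X.
by rewrite !scale1r addr0 => /eqP; rewrite -subr_eq subrr => /eqP.
Qed.

Lemma id_fam_cocycle X : cocycle 0 (id_fam X).
Proof.
split; first exact: id_fam_homogeneous.
move=> i j x; rewrite /= expr0 scale1r; have [<-|ij] := eqVneq i j.
  by rewrite !id_famE.
by rewrite !id_fam_neq ?(inj_eq (addIr 1)) // cdiff0.
Qed.

Lemma id_fam_quasi_iso X : quasi_iso (id_fam X).
Proof.
split=> i x dx; first by case=> y; rewrite id_famE => ->; exists y.
by exists x => //; exists 0; rewrite id_famE subrr cdiff0.
Qed.

Lemma zero_fam_cocycle X Y n : cocycle n (zero_fam X Y).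
Proof.
split; first exact: zero_fam_homogeneous.
by move=> i j x; rewrite /zero_fam scaler0 cdiff0.
Qed.

Definition dzero X Y n : dhom X Y n :=
  dclass (Roof (id_fam_cocycle X) (id_fam_quasi_iso X)
               (zero_fam_cocycle X Y n)).

Definition did X : dhom X X 0 :=
  dclass (Roof (id_fam_cocycle X) (id_fam_quasi_iso X) (id_fam_cocycle X)).

(* Definite description: by the calculus of fractions, the classes *)
(* described below exist and are unique. *)
Definition the_class X Y n (P : dhom X Y n -> Prop) : dhom X Y n :=
  if pselect (exists c, P c) is left h then projT1 (cid h) else dzero X Y n.

Definition dadd X Y n (c1 c2 : dhom X Y n) : dhom X Y n :=
  the_class (fun c => exists Z (s : fam Z X) (f1 f2 : fam Z Y),
    [/\ represents c1 s f1, represents c2 s f2 &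
        represents c s (add_fam f1 f2)]).

Definition dscale X Y n (a : k) (c1 : dhom X Y n) : dhom X Y n :=
  the_class (fun c => exists Z (s : fam Z X) (f : fam Z Y),
    represents c1 s f /\ represents c s (scale_fam a f)).

(* c2[n] \o c1 : X -> Y[n] -> Z[m + n].  If c1 and c2 are the roofs *)
(* X <-s- U -f-> Y[n] and Y <-t- V -g-> Z[m], the composite is the roof *)
(* X <-s u- W -g v-> Z[m + n], where u : W -> U and v : W -> V[n] are such *)
(* that f u and t v are homotopic. *)
Definition dcomp X Y Z (m n : int) (c2 : dhom Y Z m) (c1 : dhom X Y n) :
    dhom X Z (m + n) :=
  the_class (fun c => exists (U V W : complex A)
      (s : fam U X) (f : fam U Y) (t : fam V Y) (g : fam V Z)
      (u : fam W U) (v : fam W V),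
    [/\ represents c1 s f, represents c2 t g,
        [/\ cocycle 0 u, cocycle n v &
            homotopic n (comp_fam 0 f u) (comp_fam n t v)] &
        represents c (comp_fam 0 s u) (comp_fam n g v)]).

End Derived.

(* Graded algebras, given by their homogeneous components.  Only the *)
(* operations are recorded: the components of an Ext algebra live in a *)
(* universe that is too large for lmodType. *)

Record graded_algebra (k : fieldType) := GradedAlgebra {
  gr :> int -> Type;
  gzero : forall n, gr n;
  gadd : forall n, gr n -> gr n -> gr n;
  gscale : forall n, k -> gr n -> gr n;
  gone : gr 0;
  gmul : forall m n, gr m -> gr n -> gr (m + n)
}.

Definition graded_algebra_iso (k : fieldType) (E F : graded_algebra k) : Prop :=
  exists phi : forall n, E n -> F n,
  [/\ forall n, bijective (phi n),
      forall n (x y : E n), phi n (gadd x y) = gadd (phi n x) (phi n y),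
      forall n a (x : E n), phi n (gscale a x) = gscale a (phi n x),
      phi 0 (gone E) = gone F &
      forall m n (x : E m) (y : E n),
        phi (m + n) (gmul x y) = gmul (phi m x) (phi n y)].

Definition Ext (k : fieldType) (A : algType k) (M : rmodule A) :
    graded_algebra k :=
  {| gr := dhom (stalk M) (stalk M);
     gzero := @dzero k A (stalk M) (stalk M);
     gadd := @dadd k A (stalk M) (stalk M);
     gscale := @dscale k A (stalk M) (stalk M);
     gone := did (stalk M);
     gmul := @dcomp k A (stalk M) (stalk M) (stalk M) |}.

(* The smash product E # H^*, for an action act of H^* on E.  As above, *)
(* Σ_a x_a # e_a is encoded as a |-> x_a, where (e_a) is the basis of H^*. *)
Section Smash.
Variables (k : fieldType) (H : hopf_algebra k) (E : graded_algebra k).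
Local Notation D := 'Hom(H, k^o).
Variable act : forall n, D -> E n -> E n.
Local Notation I := 'I_(\dim (fullv : {vspace D})).
Local Notation sum n F := (\big[@gadd k E n/gzero E n]_(a : I) F a).

(* Coefficient of e_c in *)
(* Σ_(a, b) Σ x_a (e_a(1) . y_b) # e_a(2) e_b, with *)
(* Σ e_a(1) ⊗ e_a(2) = Σ_j (dual_comul e_a)_j ⊗ e_j. *)
Definition smash_mul m n (x : I -> E m) (y : I -> E n) : I -> E (m + n) :=
  fun c => sum (m + n) (fun a => sum (m + n) (fun b => sum (m + n) (fun j =>
    gscale (coord (vbasis fullv) c (dual_mul (bas j) (bas b)))
      (gmul (x a) (act (dual_comul (bas a : D) j) (y b)))))).

Definition smash : graded_algebra k :=
  {| gr := fun n => I -> E n;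
     gzero := fun n _ => gzero E n;
     gadd := fun n x y a => gadd (x a) (y a);
     gscale := fun n c x a => gscale c (x a);
     gone := fun a => gscale (coord (vbasis fullv) a (dual_one H)) (gone E);
     gmul := smash_mul |}.

End Smash.

Record hopf_module (k : fieldType) (H : hopf_algebra k)
    (A : comodule_algebra H) := HopfModule {
  hopf_rmod :> rmodule A;
  hcoact : {linear hopf_rmod -> tens hopf_rmod H};
  hcoactA : forall m,
    sw (hcoact m) (fun m0 m1 => pure (hcoact m0) m1) =
    sw (hcoact m) (fun m0 m1 =>
      sw (comul H m1) (fun h1 h2 => pure (pure m0 h1) h2));
  hcoact_counit : forall m, sw (hcoact m) (fun m0 m1 => counit H m1 *: m0) = m;
  hcoact_ract : forall m a, hcoact (ract m a) =
    sw (hcoact m) (fun m0 m1 =>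
      sw (coact A a) (fun a0 a1 => pure (ract m0 a0) (m1 * a1)))
}.

Section HopfComplexes.
Variables (k : fieldType) (H : hopf_algebra k) (A : comodule_algebra H).
Local Notation D := 'Hom(H, k^o).

Definition colinear (M N : hopf_module A) (f : M -> N) : Prop :=
  forall m, hcoact N (f m) = sw (hcoact M m) (fun m0 m1 => pure (f m0) m1).

Record hopf_complex := HopfComplex {
  hobj : int -> hopf_module A;
  hcomplex_diff : fam hobj hobj;
  hdiff_homogeneous : homogeneous 1 hcomplex_diff;
  hdiff_colinear : forall i j,
    @colinear (hobj i) (hobj j) (@hcomplex_diff i j);
  hdiffK : forall i j l x, @hcomplex_diff j l (@hcomplex_diff i j x) = 0
}.

Definition hopf_underlying (P : hopf_complex) : complex A :=
  Complex (hdiff_homogeneous P) (@hdiffK P).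

Coercion hopf_underlying : hopf_complex >-> complex.

(* e : P -> M is a resolution of M by Hopf modules projective over A. *)
Definition hopf_resolution (M : hopf_module A) (P : hopf_complex)
    (e : fam P (stalk M)) : Prop :=
  [/\ cocycle 0 e,
      @colinear (hobj P 0) M (e 0 0),
      quasi_iso e,
      forall i, 0 < i -> forall x : P i, x = 0 &
      forall i, rprojective (P i)].

(* a m = Σ m_(0) a(m_(1)) *)
Definition dual_act (M : hopf_module A) (a : D) (m : M) : M :=
  sw (hcoact M m) (fun m0 m1 => a m1 *: m0).

(* (a . f)(m) = Σ a_(1) f(S(a_(2)) m) *)
Definition fam_act (P : hopf_complex) (a : D) (f : fam P P) : fam P P :=
  fun i j x => sw (dual_comul a) (fun a1 a2 =>
    @dual_act (hobj P j) a1
      (f i j (@dual_act (hobj P i) (dual_antipode a2) x))).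

(* The action of H^* on Ext_A^*(M, M) induced by the action on Hom_A(P, P): *)
(* a cocycle f in Hom_A(P, P) corresponds to the class of the roof *)
(* M <-e- P -e f-> M[n]. *)
Definition ext_act (M : hopf_module A) (P : hopf_complex)
    (e : fam P (stalk M)) (n : int) (a : D) (c : Ext M n) : Ext M n :=
  the_class (fun c' : dhom (stalk M) (stalk M) n => exists f : fam P P,
    [/\ cocycle n f, represents c e (comp_fam n e f) &
        represents c' e (comp_fam n e (fam_act a f))]).

End HopfComplexes.

(* Main.v *)
(* Let B = A^coH.  For Hopf modules, f # a |-> (x |-> f(a x)) is a bijection      *)
(* Hom_A(P, P) # H^* -> Hom_B(P, P): injectivity and surjectivity come from the  *)
(* bijectivity of can and of the antipode.  Since the differential of P is       *)
(* colinear, it commutes with the action of H^*, so this is an isomorphism of    *)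
(* differential graded algebras, and taking cohomology commutes with - # H^*.    *)
(* A normalized integral t on H, which exists because H is cosemisimple, is a    *)
(* nondegenerate form on H; this makes the antipode bijective and gives a dual   *)
(* basis of A over B.  Hence P consists of projective B-modules as well, and     *)
(* Ext_A(M, M) and Ext_B(M, M) are the cohomology of Hom_A(P, P) and Hom_B(P, P).*)

Require Import Defs.
From HB Require Import structures.
From mathcomp Require Import all_boot all_order all_algebra all_field.
From mathcomp Require Import boolp functions zify.

Set Implicit Arguments.
Unset Strict Implicit.
Unset Printing Implicit Defensive.

Import GRing.Theory.
Local Open Scope ring_scope.

Arguments cdiff {k A} X i j x : rename.
Arguments add_fam {k A X Y} f g i j x : rename.
Arguments scale_fam {k A X Y} c f i j x : rename.
Arguments zero_fam {k A} X Y i j x : rename.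
Arguments id_fam {k A} X i j x : rename.
Arguments comp_fam {k A X Y Z} n g f i l x : rename.

(** * Chain maps and homotopies *)

(** Both Ext algebras are computed on one complex. As [P] is bounded above with projective terms, it
    is K-projective, so a roof out of M pulls back along a lift of [e] to an endomorphism of [P],
    unique up to homotopy ([lift_cocycle], [lift_homotopic], [roof_eq_lift]). The relation
    [classifies] records this, and its lemmas match sums, scalars, units and Yoneda products with
    operations on chain maps. Hence Ext_A(M, M) is the cohomology of Hom_A(P, P).

    The same applies over B once the restriction of [P] has projective terms. Cosemisimplicity gives
    an integral t with t(1) = 1; as a nondegenerate form it yields h with t(h -) = eps, and a
    preimage of 1 ⊗ h under can gives a dual basis of A over B ([trace_dual_basis],
    [restr_rprojective]).

    The algebraic core is descent: a B-linear map F from a Hopf module to an A-module is, in exactly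
    one way, m |-> sum f_a(e_a m) with f_a A-linear and (e_a) the basis of H^* ([smash_map_inj],
    [smash_map_surj]). Injectivity of can makes F(m l) r depend only on can(l ⊗ r); surjectivity of
    can and bijectivity of the antipode do the rest. In each pair of degrees this identifies
    Hom_B(P, P) with Hom_A(P, P) # H^*. Differentials are colinear, so they commute with the e_a,
    and cocycles and homotopies can be tested on the components f_a. The identity a f = sum (a_(1) .
    f) a_(2), which is [conj_act_dual_act], turns composition into the smash product
    ([comp_smash_fam]). *)

Section RLinear.
Variables (k : fieldType) (A : algType k).
Implicit Types M N P : rmodule A.

Lemma rlin0 M N (f : M -> N) : rlinear f -> f 0 = 0.
Proof.
by case=> /(_ 1 0 0) + _; rewrite !scale1r addr0 => /eqP; rewrite -subr_eq subrr => /eqP.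
Qed.

Lemma rlinD M N (f : M -> N) : rlinear f -> {morph f : x y / x + y}.
Proof. by case=> fl _ x y; have := fl 1 x y; rewrite !scale1r. Qed.

Lemma rlinZ M N (f : M -> N) : rlinear f -> forall a x, f (a *: x) = a *: f x.
Proof. by move=> fl a x; have := fl.1 a x 0; rewrite !addr0 (rlin0 fl) addr0. Qed.

Lemma rlinN M N (f : M -> N) : rlinear f -> {morph f : x / - x}.
Proof. by move=> fl x; rewrite -scaleN1r (rlinZ fl) scaleN1r. Qed.

Lemma rlinB M N (f : M -> N) : rlinear f -> {morph f : x y / x - y}.
Proof. by move=> fl x y; rewrite (rlinD fl) (rlinN fl). Qed.

Lemma ract0 M a : ract (0 : M) a = 0.
Proof. by have [_ /(_ 0 a)] := rlinear0 M M. Qed.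

Lemma ractD M (x y : M) a : ract (x + y) a = ract x a + ract y a.
Proof. by have := ract_linearl a 1 x y; rewrite !scale1r. Qed.

Lemma ractZ M (c : k) (x : M) a : ract (c *: x) a = c *: ract x a.
Proof. by have := ract_linearl a c x 0; rewrite !addr0 ract0 addr0. Qed.

Lemma ractN M (x : M) a : ract (- x) a = - ract x a.
Proof. by rewrite -scaleN1r ractZ scaleN1r. Qed.

Lemma rlinear_comp M N P (g : N -> P) (f : M -> N) :
  rlinear g -> rlinear f -> rlinear (fun x => g (f x)).
Proof.
move=> [g1 g2] [f1 f2]; split=> [c u v|m a]; first by rewrite f1 g1.
by rewrite f2 g2.
Qed.

Lemma rlinear_add M N (f g : M -> N) :
  rlinear f -> rlinear g -> rlinear (fun x => f x + g x).
Proof.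
move=> fl gl; split=> [c u v|m a].
  by rewrite fl.1 gl.1 scalerDr addrACA.
by rewrite fl.2 gl.2 ractD.
Qed.

Lemma rlinear_scale M N (c : k) (f : M -> N) :
  rlinear f -> rlinear (fun x => c *: f x).
Proof.
move=> fl; split=> [b u v|m a].
  by rewrite fl.1 scalerDr !scalerA mulrC.
by rewrite fl.2 ractZ.
Qed.

Lemma rlinear_opp M N (f : M -> N) : rlinear f -> rlinear (fun x => - f x).
Proof.
by move=> fl; split=> [c u v|m a]; rewrite ?fl.1 ?fl.2 ?ractN // opprD scalerN.
Qed.

Lemma rlinear_sub M N (f g : M -> N) :
  rlinear f -> rlinear g -> rlinear (fun x => f x - g x).
Proof. by move=> fl /rlinear_opp; exact: rlinear_add. Qed.

End RLinear.

Section Fam.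
Variables (k : fieldType) (A : algType k).
Implicit Types X Y Z : complex A.

(** The sign of an integer degree depends only on parity, so the absolute value is harmless and
    [sgM] holds for degrees of either sign. *)
Definition sg (n : int) : k := (-1) ^+ `|n|%N.

Lemma sgM m n : sg (m + n) = sg m * sg n.
Proof.
rewrite /sg -exprD -signr_odd -[in RHS]signr_odd; congr (_ ^+ (nat_of_bool _)).
lia.
Qed.

Lemma sgK n : sg n * sg n = 1.
Proof. by rewrite /sg -expr2 sqrr_sign. Qed.

Lemma sgP n : sg (n - 1) = - sg n.
Proof. by rewrite sgM /sg /= expr1 mulrN1. Qed.

Lemma sg0 : sg 0 = 1. Proof. by []. Qed.

Lemma cdiff_rlinear X i j : rlinear (cdiff X i j).
Proof. exact: (cdiff_homogeneous X).1. Qed.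

Lemma cdiff_out X i j x : j != i + 1 -> cdiff X i j x = 0.
Proof. by move=> ij; exact: (cdiff_homogeneous X).2. Qed.

Lemma fam_ext (X Y : int -> rmodule A) (f g : fam X Y) :
  (forall i j x, f i j x = g i j x) -> f = g.
Proof.
move=> fg; apply/functional_extensionality_dep => i.
by apply/functional_extensionality_dep => j; apply/funext => x; exact: fg.
Qed.

(** The middle index of a composite may be any integer provably equal to i + n; this replaces
    transports between terms of a complex. *)
Lemma comp_famE (X Y Z : int -> rmodule A) n (g : fam Y Z) (f : fam X Y) i j l x :
  j = i + n -> g j l (f i j x) = comp_fam n g f i l x.
Proof. by move=> ->. Qed.

Section Homogeneous.
Variables X Y Z : int -> rmodule A.

Lemma homogeneous_add n (f g : fam X Y) :
  homogeneous n f -> homogeneous n g -> homogeneous n (add_fam f g).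
Proof.
move=> [f1 f2] [g1 g2]; split=> [i j|i j ij x]; first exact: rlinear_add.
by rewrite /add_fam f2 // g2 // addr0.
Qed.

Lemma homogeneous_scale n c (f : fam X Y) :
  homogeneous n f -> homogeneous n (scale_fam c f).
Proof.
move=> [f1 f2]; split=> [i j|i j ij x]; first exact: rlinear_scale.
by rewrite /scale_fam f2 // scaler0.
Qed.

Lemma homogeneous_comp m n d (g : fam Y Z) (f : fam X Y) :
  homogeneous m g -> homogeneous n f -> d = m + n -> homogeneous d (comp_fam n g f).
Proof.
move=> [g1 g2] [f1 f2] ->; split=> [i j|i j ij x]; first exact: rlinear_comp.
by rewrite /comp_fam g2 //; apply: contra ij => /eqP ->; apply/eqP; lia.
Qed.

End Homogeneous.

Lemma cocycleE X Y n (f : fam X Y) i i' j j' x : cocycle n f ->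
  i' = i + 1 -> j' = j + 1 ->
  cdiff Y j j' (f i j x) = sg n *: f i' j' (cdiff X i i' x).
Proof. by move=> [_ fc] -> ->; exact: fc. Qed.

Lemma cocycle_add X Y n (f g : fam X Y) :
  cocycle n f -> cocycle n g -> cocycle n (add_fam f g).
Proof.
move=> [f1 f2] [g1 g2]; split=> [|i j x]; first exact: homogeneous_add.
by rewrite /add_fam (rlinD (cdiff_rlinear Y _ _)) f2 g2 scalerDr.
Qed.

Lemma cocycle_scale X Y n c (f : fam X Y) :
  cocycle n f -> cocycle n (scale_fam c f).
Proof.
move=> [f1 f2]; split=> [|i j x]; first exact: homogeneous_scale.
by rewrite /scale_fam (rlinZ (cdiff_rlinear Y _ _)) f2 !scalerA mulrC.
Qed.

Lemma cocycle_comp X Y Z m n d (g : fam Y Z) (f : fam X Y) :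
  cocycle m g -> cocycle n f -> d = m + n -> cocycle d (comp_fam n g f).
Proof.
move=> gc fc e; split; first exact: homogeneous_comp gc.1 fc.1 e.
move=> i l x; rewrite {1}/comp_fam (@cocycleE _ _ _ _ _ (i + 1 + n) _ _ _ gc) //; last lia.
rewrite (cocycleE _ fc erefl) ?(rlinZ (gc.1.1 _ _)) 1?scalerA -?sgM -?e //; lia.
Qed.

Lemma homotopic_refl X Y n (f : fam X Y) : homotopic n f f.
Proof.
exists (zero_fam X Y); first exact: zero_fam_homogeneous.
by move=> i j x; rewrite /zero_fam subrr scaler0 addr0 cdiff0.
Qed.

Lemma homotopic_sym X Y n (f g : fam X Y) : homotopic n f g -> homotopic n g f.
Proof.
case=> h hh hE; exists (scale_fam (-1) h); first exact: homogeneous_scale.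
move=> i j x; rewrite -opprB hE /scale_fam (rlinZ (cdiff_rlinear _ _ _)) !scaleN1r.
by rewrite scalerN opprD.
Qed.

Lemma homotopic_add X Y n (f g f' g' : fam X Y) :
  homotopic n f g -> homotopic n f' g' -> homotopic n (add_fam f f') (add_fam g g').
Proof.
case=> h hh hE [h' hh' hE']; exists (add_fam h h'); first exact: homogeneous_add.
move=> i j x; rewrite /add_fam opprD addrACA hE hE' (rlinD (cdiff_rlinear _ _ _)).
by rewrite scalerDr addrACA.
Qed.

Lemma homotopic_scale X Y n c (f g : fam X Y) :
  homotopic n f g -> homotopic n (scale_fam c f) (scale_fam c g).
Proof.
case=> h hh hE; exists (scale_fam c h); first exact: homogeneous_scale.
move=> i j x; rewrite /scale_fam -scalerBr hE scalerDr (rlinZ (cdiff_rlinear _ _ _)).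
by rewrite !scalerA mulrC.
Qed.

Lemma homotopic_trans X Y n (g f h : fam X Y) :
  homotopic n f g -> homotopic n g h -> homotopic n f h.
Proof.
case=> u hu uE [v hv vE]; exists (add_fam u v); first exact: homogeneous_add.
move=> i j x; rewrite -(subrKA (g i j x)) uE vE /add_fam (rlinD (cdiff_rlinear _ _ _)).
by rewrite scalerDr addrACA.
Qed.

Lemma homotopic_eqr X Y n (f g h : fam X Y) :
  (forall i j x, g i j x = h i j x) -> homotopic n f g -> homotopic n f h.
Proof. by move=> gh [u hu uE]; exists u => // i j x; rewrite -gh. Qed.

Lemma homotopic_eql X Y n (f g h : fam X Y) :
  (forall i j x, g i j x = h i j x) -> homotopic n g f -> homotopic n h f.
Proof. by move=> gh [u hu uE]; exists u => // i j x; rewrite -gh. Qed.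

Lemma homotopic_ext X Y n (f g : fam X Y) :
  (forall i j x, f i j x = g i j x) -> homotopic n f g.
Proof. by move=> fg; apply: homotopic_eqr fg _; exact: homotopic_refl. Qed.

(** A cocycle g of degree m commutes with differentials up to (-1)^m, so the homotopy g h must carry
    that sign; composition on the right, below, needs none. *)
Lemma homotopic_compl X Y Z m n d (g : fam Y Z) (f f' : fam X Y) :
  cocycle m g -> homotopic n f f' -> d = m + n ->
  homotopic d (comp_fam n g f) (comp_fam n g f').
Proof.
move=> gc [h hh hE] e; exists (scale_fam (sg m) (comp_fam (n - 1) g h)).
  by apply/homogeneous_scale/(homogeneous_comp gc.1 hh); lia.
move=> i l x; rewrite {1 2}/comp_fam -(rlinB (gc.1.1 _ _)) hE (rlinD (gc.1.1 _ _)).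
rewrite (rlinZ (gc.1.1 _ _)) /scale_fam; congr (_ + _); last first.
  rewrite -/(sg d) e scalerA sgM mulrAC sgK mul1r; congr (_ *: _).
  by apply: comp_famE; lia.
rewrite (rlinZ (cdiff_rlinear _ _ _)) -(@comp_famE _ _ _ _ _ _ _ (i + n - 1)) ?addrA //.
rewrite (@cocycleE _ _ _ _ _ (i + n) _ _ _ gc) ?scalerA ?sgK ?scale1r //; lia.
Qed.

Lemma homotopic_compr X Y Z m n d (g : fam X Y) (f f' : fam Y Z) :
  cocycle m g -> homotopic n f f' -> d = n + m ->
  homotopic d (comp_fam m f g) (comp_fam m f' g).
Proof.
move=> gc [h hh hE] e; exists (comp_fam m h g).
  by apply: (homogeneous_comp hh gc.1); lia.
move=> i l x; rewrite {1 2}/comp_fam hE -/(sg n) -/(sg d) /comp_fam; congr (_ + _).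
rewrite (cocycleE _ gc erefl erefl) (rlinZ (hh.1 _ _)) scalerA -sgM e.
congr (_ *: _).
apply: (@comp_famE _ _ _ _ h g); lia.
Qed.

Lemma quasi_iso_homotopic X Y (s s' : fam X Y) :
  homotopic 0 s s' -> quasi_iso s -> quasi_iso s'.
Proof.
case=> h hh hE [s1 s2]; split=> i.
  move=> x dx [y sy]; apply: s1 => //; exists (y + h i (i - 1) x).
  have := hE i i x; rewrite dx (rlin0 (hh.1 _ _)) scaler0 addr0 => /eqP.
  by rewrite subr_eq => /eqP ->; rewrite (rlinD (cdiff_rlinear _ _ _)) sy addrC.
move=> y dy; have [x dx [y' sy]] := s2 i y dy; exists x => //.
exists (y' - h i (i - 1) x); rewrite (rlinB (cdiff_rlinear _ _ _)) -sy.
have := hE i i x; rewrite dx (rlin0 (hh.1 _ _)) scaler0 addr0 => <-.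
by rewrite opprB [RHS]addrC addrA subrK.
Qed.

End Fam.

(** * K-projective complexes *)

Section Subspace.
Variables (k : fieldType) (V : lmodType k) (S : {pred V}).

(** The closure proof is a parameter of the type, so that the module structure can be attached to it
    canonically. It serves kernels and coinduced modules. *)
Record subspace_of (SP : GRing.subsemimod_closed S) :=
  Subspace { subspace_val : V; _ : S subspace_val }.
Variable SP : GRing.subsemimod_closed S.
HB.instance Definition _ := [isSub for @subspace_val SP].
HB.instance Definition _ := [Choice of subspace_of SP by <:].
HB.instance Definition _ :=
  GRing.SubChoice_isSubLmodule.Build k V S (subspace_of SP) SP.
End Subspace.

Section Submodule.
Variables (k : fieldType) (A : algType k) (M : rmodule A) (S : M -> Prop).
Hypothesis S0 : S 0.
Hypothesis SP : forall c x y, S x -> S y -> S (c *: x + y).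
Hypothesis SA : forall x a, S x -> S (ract x a).
Let Sb : {pred M} := fun x => `[< S x >].

Lemma submodule_closed : GRing.subsemimod_closed Sb.
Proof.
split; [split; first exact/asboolP|].
  by move=> x y /asboolP xS /asboolP yS; apply/asboolP; rewrite -[x]scale1r; exact: SP.
by move=> c x /asboolP xS; apply/asboolP; rewrite -[_ *: _]addr0; exact: SP.
Qed.
Let N := subspace_of submodule_closed.
Let nact (x : N) (a : A) : N :=
  Subspace submodule_closed (asboolT (SA a (asboolW (valP x)))).
Let nactE x a : val (nact x a) = ract (val x) a. Proof. by []. Qed.
Lemma nact_linearl a : linear (nact ^~ a).
Proof.
by move=> c u v; apply: val_inj; rewrite nactE !GRing.valD !GRing.valZ !nactE ract_linearl.
Qed.
Lemma nact_linearr x : linear (nact x).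
Proof.
by move=> c u v; apply: val_inj; rewrite !GRing.valD !GRing.valZ !nactE ract_linearr.
Qed.
Lemma nact1 x : nact x 1 = x.
Proof. by apply: val_inj; rewrite nactE ract1. Qed.
Lemma nactM x a b : nact (nact x a) b = nact x (a * b).
Proof. by apply: val_inj; rewrite !nactE ractM. Qed.
Definition submodule : rmodule A := RModule nact_linearl nact_linearr nact1 nactM.

Definition submodule_val (x : submodule) : M := val (x : N).

Lemma submodule_val_rlinear : rlinear submodule_val.
Proof. by split=> // c u v; rewrite /submodule_val GRing.valD GRing.valZ. Qed.

Lemma submodule_valP x : S (submodule_val x).
Proof. exact: asboolW (valP x). Qed.

Lemma submodule_val_inj : injective submodule_val.
Proof. exact: val_inj. Qed.

Definition submodule_sub x (Sx : S x) : submodule :=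
  Subspace submodule_closed (asboolT Sx).

End Submodule.

(** Exactness at N replaces surjectivity: f lands in the submodule ker d, onto which g maps, and
    projectivity is applied there. *)
Lemma rprojective_lift (k : fieldType) (A : algType k) (P M N L : rmodule A)
    (g : M -> N) (d : N -> L) (f : P -> N) :
  rprojective P -> rlinear g -> rlinear d -> rlinear f ->
  (forall x, d (g x) = 0) -> (forall x, d (f x) = 0) ->
  (forall y, d y = 0 -> exists x, g x = y) ->
  exists2 h : P -> M, rlinear h & forall x, g (h x) = f x.
Proof.
move=> Pp gl dl fl dg df dex.
have S0 : d 0 = 0 by exact: rlin0.
have SP c x y : d x = 0 -> d y = 0 -> d (c *: x + y) = 0.
  by move=> dx dy; rewrite dl.1 dx dy scaler0 addr0.
have SA x a : d x = 0 -> d (ract x a) = 0.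
  by move=> dx; rewrite dl.2 dx ract0.
pose K := submodule S0 SP SA.
pose g' x : K := submodule_sub S0 SP SA (dg x).
pose f' x : K := submodule_sub S0 SP SA (df x).
have vl := submodule_val_rlinear S0 SP SA.
have g'E x : submodule_val (g' x) = g x by [].
have f'E x : submodule_val (f' x) = f x by [].
have [||| h hl hE] := Pp M K g' f'.
- split=> [c u v|m a]; apply: submodule_val_inj.
    by rewrite vl.1 !g'E gl.1.
  by rewrite vl.2 !g'E gl.2.
- move=> y; have [x xE] := dex _ (submodule_valP y); exists x.
  exact: submodule_val_inj.
- split=> [c u v|m a]; apply: submodule_val_inj.
    by rewrite vl.1 !f'E fl.1.
  by rewrite vl.2 !f'E fl.2.
- by exists h => // x; have := congr1 (@submodule_val _ _ _ _ S0 SP SA) (hE x).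
Qed.

Section KProjective.
Variables (k : fieldType) (A : algType k).

Definition acyclic (C : complex A) := forall i (c : C i),
  cdiff C i (i + 1) c = 0 -> exists c', cdiff C (i - 1) i c' = c.

(** Hom(P, C) is acyclic for acyclic C. All degrees n are quantified at once, which takes the place
    of shifting C. *)
Definition kprojective (P : complex A) := forall (C : complex A) n (f : fam P C),
  acyclic C -> cocycle n f -> homotopic n f (zero_fam P C).

Section BoundedAbove.
Variables (P C : complex A) (n : int) (f : fam P C).
Arguments f : clear implicits.
Hypothesis P_gt0 : forall i, 0 < i -> forall x : P i, x = 0.
Hypothesis P_proj : forall i, rprojective (P i).
Hypothesis C_acyclic : acyclic C.
Hypothesis f_cocycle : cocycle n f.

Let contracts (h : fam P C) (i : int) := forall j x,
  f i j x = cdiff C (j - 1) j (h i (j - 1) x) +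
            sg k n *: h (i + 1) j (cdiff P i (i + 1) x).

(** Invariant of a descending construction: h contracts f in all degrees above -N. It starts at N =
    0 because P vanishes in positive degrees. *)
Let partial (N : nat) (h : fam P C) :=
  homogeneous (n - 1) h /\ forall i, - N%:Z < i -> contracts h i.

Lemma contraction_start : partial 0 (zero_fam P C).
Proof.
split=> [|i i0 j x]; first exact: zero_fam_homogeneous.
by rewrite (P_gt0 i0 x) (rlin0 (f_cocycle.1.1 _ _)) /zero_fam scaler0 addr0 cdiff0.
Qed.

(** In degree i = -N the defect u = f - (-1)^n h d takes values in cycles, by the homotopy equation
    in degree i + 1. As C is acyclic and P i projective, u lifts through the differential, and the
    lift is the new value of h. *)
Lemma contraction_step N h : partial N h -> exists2 h', partial N.+1 h' &
  forall i j, - N%:Z < i -> h' i j = h i j.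
Proof.
case=> hh hE; pose i : int := - N%:Z; pose j : int := i + n.
pose u x := f i j x - sg k n *: h (i + 1) j (cdiff P i (i + 1) x).
have fh := f_cocycle.1.
have ul : rlinear u.
  apply: rlinear_sub; first exact: fh.1.
  by apply/rlinear_scale/rlinear_comp; [exact: hh.1|exact: cdiff_rlinear].
have du x : cdiff C j (j + 1) (u x) = 0.
  rewrite /u (rlinB (cdiff_rlinear _ _ _)) (rlinZ (cdiff_rlinear _ _ _)).
  rewrite (cocycleE _ f_cocycle erefl erefl) -scalerBr.
  have lt : - N%:Z < i + 1 by rewrite /i; lia.
  rewrite (hE _ lt) cdiffK (rlin0 (hh.1 _ _)) scaler0 addr0.
  by rewrite addrK subrr scaler0.
have [|v vl vE] := @rprojective_lift k A (P i) (C (j - 1)) (C j) (C (j + 1))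
    (cdiff C (j - 1) j) (cdiff C j (j + 1)) u (@P_proj i)
    (cdiff_rlinear _ _ _) (cdiff_rlinear _ _ _) ul _ du (@C_acyclic j).
  by move=> x; rewrite cdiffK.
(* Only the row of index i changes: it becomes v in target degree j - 1 and zero elsewhere. The
   equality tests supply the transports. *)
pose h' : fam P C := fun a b =>
  if @eqP _ i a is ReflectT ea then
    eq_rect i (fun a => P a -> C b)
      (if @eqP _ (j - 1) b is ReflectT eb then
        eq_rect (j - 1) (fun b => P i -> C b) v b eb else fun=> 0) a ea
  else h a b.
have h'E : forall x, h' i (j - 1) x = v x.
  move=> x; rewrite /h'; case: eqP => // ea; rewrite (eq_irrelevance ea erefl) /=.
  by case: eqP => // eb; rewrite (eq_irrelevance eb erefl).
have h'0 b x : b != j - 1 -> h' i b x = 0.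
  move=> nb; rewrite /h'; case: eqP => // ea; rewrite (eq_irrelevance ea erefl) /=.
  by case: eqP => // eb; rewrite eb eqxx in nb.
have h'N a b : i != a -> h' a b = h a b.
  by rewrite /h'; case: eqP.
have h'h : homogeneous (n - 1) h'.
  split=> [a b|a b].
    have [<-|/h'N ->] := eqVneq i a; last exact: hh.1.
    have [->|nb] := eqVneq b (j - 1).
      by rewrite (_ : h' _ _ = v); [|exact/funext].
    rewrite (_ : h' _ _ = (fun=> 0)); first exact: rlinear0.
    by apply/funext => x; exact: h'0.
  have [<- nb x|/h'N ->] := eqVneq i a; last exact: hh.2.
  by apply: h'0; apply: contra nb => /eqP ->; apply/eqP; rewrite /j; lia.
exists h'; last by move=> a b lt; apply: h'N; rewrite /i; lia.
split=> // a lta b x.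
have [e|na] := eqVneq i a; last first.
  rewrite !h'N; [|lia|lia]; apply: hE; lia.
subst a.
have [->|nb] := eqVneq b j; last first.
  rewrite (fh.2 _ _ nb) h'0 1?cdiff0; last by lia.
  rewrite h'N; last lia.
  by rewrite hh.2 ?scaler0 ?addr0 //; move: nb; rewrite /j; lia.
by rewrite h'E vE h'N; [rewrite subrK | lia].
Qed.

Lemma contraction : homotopic n f (zero_fam P C).
Proof.
pose next N h := if pselect (partial N h) is left hP then
  s2val (cid2 (contraction_step hP)) else h.
pose hs := nat_rect (fun=> fam P C) (zero_fam P C) next.
have nextP N h : partial N h -> partial N.+1 (next N h).
  by rewrite /next; case: pselect => // hP _; case: cid2.
have hsP N : partial N (hs N).
  by elim: N => [|N IH]; [exact: contraction_start|exact: nextP].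
have hsS N i j : - N%:Z < i -> hs N.+1 i j = hs N i j.
  rewrite /= /next; case: pselect => // hP lt.
  by rewrite (s2valP' (cid2 (contraction_step hP))).
have hsE N N' i j : - N%:Z < i -> (N <= N')%N -> hs N' i j = hs N i j.
  move=> lt /subnK <-; elim: (_ - _)%N => // m IH.
  by rewrite addSn hsS //; lia.
(* Row i no longer changes from stage |i| + 1 on, since -(|i| + 1) < i; the diagonal is therefore
   the limit of the partial contractions. *)
pose h : fam P C := fun i j => hs `|i|.+1 i j.
exists h.
  by split=> i j; have [hh _] := hsP `|i|.+1; [exact: hh.1|exact: hh.2].
move=> i j x; rewrite /zero_fam subr0 /h.
have [_ /(_ i _ j x)] := hsP `|i|.+1; rewrite -/(sg k n).
rewrite -!(@hsE _ (`|i|.+1 + `|(i + 1)%R|.+1)%N) ?leq_addr ?leq_addl //; try lia.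
by apply; lia.
Qed.

End BoundedAbove.

Lemma bounded_projective_kprojective (P : complex A) :
  (forall i, 0 < i -> forall x : P i, x = 0) -> (forall i, rprojective (P i)) ->
  kprojective P.
Proof. by move=> P0 Pp C n f; exact: contraction. Qed.

End KProjective.

(** * Mapping cones and lifting along quasi-isomorphisms *)

Section DirectSum.
Variables (k : fieldType) (A : algType k) (M N : rmodule A).
Let sact (x : M * N) (a : A) : M * N := (ract x.1 a, ract x.2 a).
Lemma sact_linearl a : linear (sact ^~ a).
Proof. by move=> c u v; congr pair; rewrite /= ract_linearl. Qed.
Lemma sact_linearr x : linear (sact x).
Proof. by move=> c u v; congr pair; rewrite /= ract_linearr. Qed.
Lemma sact1 x : sact x 1 = x.
Proof. by case: x => x y; rewrite /sact !ract1. Qed.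
Lemma sactM x a b : sact (sact x a) b = sact x (a * b).
Proof. by rewrite /sact /= !ractM. Qed.
Definition direct_sum : rmodule A := RModule sact_linearl sact_linearr sact1 sactM.
End DirectSum.

(* F i j is a map into the term of index j + 1, as happens with the first *)
(* component of a map into a cone; g i j needs a transport along j - 1 + 1 = j. *)
Lemma fam_reindex (k : fieldType) (A : algType k) (X Y : int -> rmodule A)
    (F : forall i j, X i -> Y (j + 1)) :
  exists g : fam X Y, forall i j x, g i (j + 1) x = F i j x.
Proof.
exists (fun i j x => eq_rect (j - 1 + 1) Y (F i (j - 1) x) j (subrK 1 j)).
move=> i j x.
suff gen j' (e : j' + 1 = j + 1) : eq_rect (j' + 1) Y (F i j' x) (j + 1) e = F i j x.
  exact: gen.
have ej : j' = j by apply: addIr e.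
by subst j'; rewrite (eq_irrelevance e erefl).
Qed.

Lemma int_succ (j : int) : exists j', j = j' + 1.
Proof. by exists (j - 1); rewrite subrK. Qed.

Lemma comp_fam0E (k : fieldType) (A : algType k) (X Y Z : int -> rmodule A) n
    (s : fam Y Z) (g : fam X Y) : homogeneous 0 s -> homogeneous n g ->
  forall i j x, comp_fam n s g i j x = s j j (g i j x).
Proof.
move=> sh gh i j x; have [->//|ne] := eqVneq j (i + n).
rewrite (gh.2 _ _ ne) (rlin0 (sh.1 _ _)) /comp_fam sh.2 ?addr0 //.
Qed.

Section Cone.
Variables (k : fieldType) (A : algType k) (Y Z : complex A) (s : fam Y Z).
Hypothesis sP : cocycle 0 s.
Arguments s : clear implicits.

Definition cone_obj (i : int) : rmodule A := direct_sum (Y (i + 1)) (Z i).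

Definition cone_diff : fam cone_obj cone_obj := fun i j x =>
  (- cdiff Y (i + 1) (j + 1) x.1, s (i + 1) j x.1 + cdiff Z i j x.2).
Arguments cone_diff : clear implicits.

Lemma cone_diff_homogeneous : homogeneous 1 cone_diff.
Proof.
have dl := cdiff_rlinear.
split=> [i j|i j ij [y z]]; last first.
  rewrite /cone_diff /= !cdiff_out // ?(inj_eq (addIr _)) // oppr0 addr0.
  by rewrite sP.1.2 // addr0.
split=> [c [y z] [y' z']|[y z] a]; rewrite /cone_diff /=.
  congr pair; first by rewrite (dl _ _ _ _ _).1 /= opprD scalerN.
  by rewrite /= (dl _ _ _ _ _).1 (sP.1.1 _ _).1 scalerDr addrACA.
congr pair; rewrite /= (dl _ _ _ _ _).2 ?ractN // ractD.
by rewrite (sP.1.1 _ _).2.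
Qed.

Lemma cone_diffK i j l x : cone_diff j l (cone_diff i j x) = 0.
Proof.
case: x => y z; rewrite /cone_diff /=; congr pair.
  by rewrite (rlinN (cdiff_rlinear _ _ _)) cdiffK !oppr0.
rewrite /= (rlinN (sP.1.1 _ _)) (rlinD (cdiff_rlinear _ _ _)) cdiffK addr0.
have [e|ne] := eqVneq j (i + 1).
  have [e'|ne'] := eqVneq l (j + 1).
    by subst j l; rewrite (cocycleE _ sP erefl erefl) sg0 scale1r addNr.
    by rewrite (@cdiff_out _ _ Z) // (sP.1.2 (j + 1) l) ?oppr0 ?addr0.
rewrite (@cdiff_out _ _ Y) ?(inj_eq (addIr _)) // (sP.1.2 (i + 1) j) ?addr0 //.
by rewrite (rlin0 (sP.1.1 _ _)) cdiff0 oppr0 addr0.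
Qed.

Definition cone : complex A := Complex cone_diff_homogeneous cone_diffK.

(** For a cycle (y, z), y is a cycle with s y = - d z, so y = d y'. Then s y' + z is a cycle of Z
    and equals s x - d z' for a cycle x of Y. The pair (x - y', - z') bounds (y, z). *)
Lemma cone_acyclic : quasi_iso s -> acyclic cone.
Proof.
case=> s1 s2 i [y z] [/eqP]; rewrite oppr_eq0 => /eqP dy.
move=> /eqP; rewrite addr_eq0 => /eqP sy.
have [y' yE] : exists y' : Y (i - 1 + 1), y = cdiff Y (i - 1 + 1) (i + 1) y'.
  have [|y' yE] := s1 (i + 1) y dy.
    have -> : i + 1 - 1 = i by lia.
    by exists (- z); rewrite sy (rlinN (cdiff_rlinear _ _ _)).
  have <- : i + 1 - 1 = i - 1 + 1 by lia.
  by exists y'.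
have zc : cdiff Z i (i + 1) (s (i - 1 + 1) i y' + z) = 0.
  rewrite (rlinD (cdiff_rlinear _ _ _)).
  rewrite (cocycleE _ sP (i' := i + 1)) ?sg0 ?scale1r -?yE ?sy ?addNr //; lia.
have [x dx [z' zE]] := s2 i _ zc.
have [x' [dx' sx']] : exists x' : Y (i - 1 + 1),
    cdiff Y (i - 1 + 1) (i + 1) x' = 0 /\ s (i - 1 + 1) i x' = s i i x.
  have -> : i - 1 + 1 = i by lia.
  by exists x.
exists (x' - y', - z'); rewrite /= /cone_diff /=; congr pair.
  by rewrite (rlinB (cdiff_rlinear _ _ _)) dx' sub0r opprK yE.
rewrite /= (rlinN (cdiff_rlinear _ _ _)) -zE (rlinB (sP.1.1 _ _)) sx'.
by rewrite opprB addrC addrA subrK addrAC subrr add0r.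
Qed.

Variable P : complex A.
Hypothesis Pk : kprojective P.
Hypothesis sQ : quasi_iso s.

(* The cocycle x |-> (0, f x) into the cone is null-homotopic; the two components *)
(* of a homotopy are a lift g and a homotopy from f to s g. *)
Lemma lift_cocycle n (f : fam P Z) : cocycle n f ->
  exists2 g : fam P Y, cocycle n g & homotopic n (comp_fam n s g) f.
Proof.
move=> fP; pose phi : fam P cone := fun i j x => (0, f i j x).
have phiP : cocycle n phi.
  split; [split=> [i j|i j ij x]|move=> i j x]; rewrite /phi.
  - by split=> [c u v|m a]; rewrite ?(fP.1.1 i j).1 ?(fP.1.1 i j).2 /=;
      congr pair; rewrite /= ?scaler0 ?addr0 ?ract0.
  - by rewrite fP.1.2.
  - rewrite /= /cone_diff /= cdiff0 (rlin0 (sP.1.1 _ _)) add0r oppr0.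
    by rewrite (cocycleE _ fP erefl erefl); congr pair; rewrite /= scaler0.
have [h hh hE] := Pk (cone_acyclic sQ) phiP.
have [g gE] := fam_reindex (fun i j x => (h i j x).1).
have h1 i j x : 0 = - cdiff Y (j - 1 + 1) (j + 1) (g i (j - 1 + 1) x) +
    sg k n *: g (i + 1) (j + 1) (cdiff P i (i + 1) x).
  by have := congr1 fst (hE i j x); rewrite /= !gE subr0.
have h2 i j x : f i j x = s (j - 1 + 1) j (g i (j - 1 + 1) x) +
    cdiff Z (j - 1) j (h i (j - 1) x).2 +
    sg k n *: (h (i + 1) j (cdiff P i (i + 1) x)).2.
  by have := congr1 snd (hE i j x); rewrite /= !gE subr0.
have h_lin i j : rlinear (fun x => (h i j x).1) /\ rlinear (fun x => (h i j x).2).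
  by have [H1 H2] := hh.1 i j; split; split=> [c u v|m a]; rewrite ?H1 ?H2.
have h0 i j x : j != i + n - 1 -> h i j x = 0.
  by move=> ne; apply: hh.2; rewrite addrA.
have gP : cocycle n g.
  split; [split=> [i j|i j]|move=> i j x].
  - have [j' ->] := int_succ j.
    rewrite (_ : g _ _ = fun x => (h i j' x).1); first exact: (h_lin _ _).1.
    by apply/funext => x; rewrite gE.
  - have [j' ->] := int_succ j.
    by move=> ij x; rewrite gE h0 //; move: ij; lia.
  - have := h1 i j x; rewrite subrK [X in 0 = X]addrC => /esym/eqP.
    by rewrite subr_eq0 => /eqP <-.
exists g => //.
apply: homotopic_sym; exists (fun i j x => (h i j x).2).
  split=> [i j|i j ij x]; first exact: (h_lin _ _).2.
  by rewrite h0 // -addrA.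
move=> i j x; rewrite h2 -/(sg k n).
have -> : comp_fam n s g i j x = s (j - 1 + 1) j (g i (j - 1 + 1) x).
  by rewrite subrK; exact: comp_fam0E sP.1 gP.1 _ _ _.
by rewrite -[X in X - _]addrA [LHS]addrC addKr.
Qed.

(** A homotopy u from s g to 0 makes (g, - u) a cocycle of degree n - 1 into the cone; minus the
    first component of a null-homotopy of it contracts g. *)
Lemma lift_homotopic0 n (g : fam P Y) : cocycle n g ->
  homotopic n (comp_fam n s g) (zero_fam P Z) -> homotopic n g (zero_fam P Y).
Proof.
move=> gP [u uh uE]; pose phi : fam P cone := fun i j x => (g i (j + 1) x, - u i j x).
have phiP : cocycle (n - 1) phi.
  split; [split=> [i j|i j ij x]|move=> i j x]; rewrite /phi.
  - have [g1 g2] := gP.1.1 i (j + 1); have [u1 u2] := uh.1 i j.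
    by split=> [c v w|m a]; rewrite ?g1 ?u1 ?g2 ?u2 /=; congr pair;
      rewrite /= ?ractN // opprD scalerN.
  - rewrite uh.2 ?gP.1.2 ?oppr0 //; lia.
  - rewrite /= /cone_diff /= -/(sg k (n - 1)) sgP; congr pair => /=.
      by rewrite (cocycleE _ gP erefl erefl) scaleNr.
    have := uE i (j + 1) x; rewrite /zero_fam subr0 (comp_fam0E sP.1 gP.1) -/(sg k n).
    have -> : j + 1 - 1 = j by lia.
    by move=> ->; rewrite (rlinN (cdiff_rlinear _ _ _)) addrAC subrr add0r scaleNr scalerN opprK.
have [h hh hE] := Pk (cone_acyclic sQ) phiP.
have [v vE] := fam_reindex (fun i j x => - (h i j x).1).
exists v.
  split=> i j; have [j' ->] := int_succ j.
    rewrite (_ : v _ _ = fun x => - (h i j' x).1); last by apply/funext => x; rewrite vE.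
    apply: rlinear_opp; have [H1 H2] := hh.1 i j'.
    by split=> [c y z|m a]; rewrite ?H1 ?H2.
  move=> ij x; rewrite vE hh.2 ?oppr0 //; move: ij; lia.
move=> i j x; have [j' ->] := int_succ j.
have := congr1 fst (hE i j' x); rewrite /= subr0 => ->.
have -> : j' + 1 - 1 = j' - 1 + 1 by lia.
rewrite !vE (rlinN (cdiff_rlinear _ _ _)) -/(sg k n) -/(sg k _) sgP.
by rewrite scalerN scaleNr.
Qed.
End Cone.

(** * Morphisms in the derived category out of a resolved complex *)

Arguments roof_s {k A X Y n} r i j x : rename.
Arguments roof_f {k A X Y n} r i j x : rename.

Lemma comp_famA (k : fieldType) (A : algType k) (X Y Z W : int -> rmodule A) m n d
    (h : fam Z W) (g : fam Y Z) (f : fam X Y) i l x : d = n + m ->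
  comp_fam m (comp_fam n h g) f i l x = comp_fam d h (comp_fam m g f) i l x.
Proof.
move=> ->; rewrite /comp_fam.
by have -> : i + (n + m) = i + m + n by lia.
Qed.

Lemma homotopic_sub0 (k : fieldType) (A : algType k) (X Y : complex A) n (f g : fam X Y) :
  homotopic n (add_fam f (scale_fam (-1) g)) (zero_fam X Y) <-> homotopic n f g.
Proof.
by split=> -[h hh hE]; exists h => // i j x; rewrite -hE /add_fam /scale_fam /zero_fam scaleN1r subr0.
Qed.

Lemma lift_homotopic (k : fieldType) (A : algType k) (P Y Z : complex A) n
    (s : fam Y Z) (g g' : fam P Y) :
  kprojective P -> cocycle 0 s -> quasi_iso s -> cocycle n g -> cocycle n g' ->
  homotopic n (comp_fam n s g) (comp_fam n s g') -> homotopic n g g'.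
Proof.
move=> Pk sP sQ gP gP' H; apply/homotopic_sub0.
apply: (lift_homotopic0 sP Pk sQ); first exact/cocycle_add/cocycle_scale.
move/homotopic_sub0: H; apply: homotopic_eql => i j x.
by rewrite /comp_fam /add_fam /scale_fam (rlinD (sP.1.1 _ _)) (rlinZ (sP.1.1 _ _)).
Qed.

Section Resolution.
Variables (k : fieldType) (A : algType k) (X P : complex A) (e : fam P X).
Arguments e : clear implicits.
Hypothesis Pk : kprojective P.
Hypothesis eP : cocycle 0 e.
Hypothesis eQ : quasi_iso e.

Lemma comp_id (Y : complex A) (f : fam P Y) i j x :
  comp_fam 0 f (id_fam P) i j x = f i j x.
Proof.
rewrite /comp_fam.
have -> : i + 0 = i by rewrite addr0.
by rewrite id_famE.
Qed.

Section Target.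
Variables (Y : complex A) (n : int).

(** A common refinement W of two roofs admits a lift p of [e]; uniqueness of lifts makes u and u'
    homotopic to the two composites through p. Conversely P itself is a common refinement. *)
Lemma roof_eq_lift (r r' : roof X Y n) (u : fam P (apex r)) (u' : fam P (apex r')) :
  cocycle 0 u -> homotopic 0 (comp_fam 0 (roof_s r) u) e ->
  cocycle 0 u' -> homotopic 0 (comp_fam 0 (roof_s r') u') e ->
  roof_eq r r' <-> homotopic n (comp_fam 0 (roof_f r) u) (comp_fam 0 (roof_f r') u').
Proof.
move=> uP uE uP' uE'; split; last first.
  move=> H; exists P, u, u'; split=> //; last first.
    exact: homotopic_trans uE (homotopic_sym uE').
  exact: quasi_iso_homotopic (homotopic_sym uE) eQ.
case=> W [w [w' [wP wP' wQ wE wF]]].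
have swP : cocycle 0 (comp_fam 0 (roof_s r) w) by apply: cocycle_comp (roof_sP r) wP _.
have [p pP pE] := lift_cocycle swP Pk wQ eP.
have uw : homotopic 0 u (comp_fam 0 w p).
  apply: (lift_homotopic Pk (roof_sP r) (roof_sQ r)) => //.
    by apply: cocycle_comp wP pP _.
  apply: homotopic_trans uE (homotopic_sym _); apply: homotopic_eql pE.
  by move=> i j x; apply: comp_famA.
have uw' : homotopic 0 u' (comp_fam 0 w' p).
  apply: (lift_homotopic Pk (roof_sP r') (roof_sQ r')) => //.
    by apply: cocycle_comp wP' pP _.
  apply: homotopic_trans uE' (homotopic_sym _); apply: homotopic_trans pE.
  apply: homotopic_eql (homotopic_compr pP (homotopic_sym wE) erefl).
  by move=> i j x; apply: comp_famA.
have fw := homotopic_compl (roof_fP r) uw (esym (addr0 n)).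
have fw' := homotopic_compl (roof_fP r') uw' (esym (addr0 n)).
apply: homotopic_trans fw _; apply: homotopic_trans (homotopic_sym fw').
have := homotopic_compr pP wF (esym (addr0 n)) => H.
apply: homotopic_eql (homotopic_eqr _ H); move=> i j x; exact: comp_famA.
Qed.

Lemma roof_lift (r : roof X Y n) : exists2 u : fam P (apex r),
  cocycle 0 u & homotopic 0 (comp_fam 0 (roof_s r) u) e.
Proof. exact (lift_cocycle (roof_sP r) Pk (roof_sQ r) eP). Qed.

(** A class is a predicate on roofs, so this amounts to [roof_eq] being an equivalence; after
    lifting to P it becomes homotopy, which is one. *)
Lemma dclass_eq (r r' : roof X Y n) : dclass r = dclass r' <-> roof_eq r r'.
Proof.
split=> [[/(congr1 (fun p => p r'))]|E].
  have [u uP uE] := roof_lift r'; move=> ->.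
  by apply/(roof_eq_lift uP uE uP uE); exact: homotopic_refl.
have ee : roof_eq r = roof_eq r'.
  have [u uP uE] := roof_lift r; have [u' uP' uE'] := roof_lift r'.
  move/(roof_eq_lift uP uE uP' uE') in E.
  apply/funext => t; apply/propext.
  have [v vP vE] := roof_lift t.
  rewrite (roof_eq_lift uP uE vP vE) (roof_eq_lift uP' uE' vP vE).
  by split; apply: homotopic_trans; [exact: homotopic_sym|].
rewrite /dclass; move: (ex_intro _ r _) (ex_intro _ r' _); rewrite ee => p q.
by congr exist; exact: Prop_irrelevance.
Qed.

Lemma represents_lift (c : dhom X Y n) (Z : complex A) (s : fam Z X) (f : fam Z Y) (u : fam P Z) :
  represents c s f -> cocycle 0 u -> homotopic 0 (comp_fam 0 s u) e ->
  represents c e (comp_fam 0 f u).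
Proof.
case=> sP [sQ [fP ->]] uP uE.
have fuP : cocycle n (comp_fam 0 f u) by apply: cocycle_comp fP uP _; rewrite addr0.
exists eP, eQ, fuP; apply/dclass_eq.
apply/(@roof_eq_lift (Roof sP sQ fP) (Roof eP eQ fuP) u (id_fam P)) => //=.
- exact: id_fam_cocycle.
- by apply: homotopic_ext => i j x; rewrite comp_id.
- by apply: homotopic_ext => i j x; rewrite comp_id.
Qed.

Lemma represents_homotopic (c : dhom X Y n) (f f' : fam P Y) : represents c e f ->
  cocycle n f' -> homotopic n f f' -> represents c e f'.
Proof.
case=> sP [sQ [fP ->]] fP' ff'; exists sP, sQ, fP'; apply/dclass_eq.
have eE : homotopic 0 (comp_fam 0 e (id_fam P)) e.
  by apply: homotopic_ext => i j x; rewrite comp_id.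
apply/(@roof_eq_lift (Roof sP sQ fP) (Roof sP sQ fP') (id_fam P) (id_fam P)) => //=;
  try exact: id_fam_cocycle.
by apply: homotopic_compr (id_fam_cocycle P) ff' _; rewrite addr0.
Qed.

Lemma represents_eq (c c' : dhom X Y n) (f f' : fam P Y) :
  represents c e f -> represents c' e f' -> c = c' <-> homotopic n f f'.
Proof.
move=> [sP [sQ [fP ->]]] [sP' [sQ' [fP' ->]]]; rewrite dclass_eq.
have eE : homotopic 0 (comp_fam 0 e (id_fam P)) e.
  by apply: homotopic_ext => i j x; rewrite comp_id.
rewrite (@roof_eq_lift (Roof sP sQ fP) (Roof sP' sQ' fP') (id_fam P) (id_fam P)) //=;
  try exact: id_fam_cocycle.
by split=> H; apply: homotopic_eql (homotopic_eqr _ H) => i j x; rewrite comp_id.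
Qed.

Lemma represents_ex (c : dhom X Y n) : exists2 f : fam P Y, cocycle n f & represents c e f.
Proof.
case: c => c [r rE]; subst c; have [u uP uE] := roof_lift r; exists (comp_fam 0 (roof_f r) u).
  by apply: cocycle_comp (roof_fP r) uP _; rewrite addr0.
apply: represents_lift uP uE.
by exists (roof_sP r), (roof_sQ r), (roof_fP r); case: (r).
Qed.

Lemma represents_class (f : fam P Y) : cocycle n f -> exists c : dhom X Y n, represents c e f.
Proof. by move=> fP; exists (dclass (Roof eP eQ fP)), eP, eQ, fP. Qed.

End Target.
End Resolution.

(** * Operations on derived morphisms, computed on chain maps out of the resolution *)

Section ClassOperations.
Variables (k : fieldType) (A : algType k) (X P : complex A) (e : fam P X).
Hypothesis Pk : kprojective P.
Hypothesis eP : cocycle 0 e.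
Hypothesis eQ : quasi_iso e.

(** Discharges the definite descriptions: given a unique witness, the default value [dzero] is never
    reached. *)
Lemma the_classP (Y : complex A) n (Q : dhom X Y n -> Prop) c :
  Q c -> (forall c', Q c' -> c' = c) -> the_class Q = c.
Proof.
move=> Qc uniq; rewrite /the_class; case: pselect => [h|[]]; last by exists c.
by case: cid => c' Qc' /=; exact: uniq.
Qed.

Lemma cocycle_represents (Y : complex A) n (c : dhom X Y n) (Z : complex A)
   (s : fam Z X) (f : fam Z Y) :
  represents c s f -> cocycle 0 s /\ quasi_iso s /\ cocycle n f.
Proof. by case=> sP [sQ [fP _]]. Qed.

Lemma represents_dzero (Y : complex A) n : represents (dzero X Y n) e (zero_fam P Y).
Proof.
have r : represents (dzero X Y n) (id_fam X) (zero_fam X Y).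
  by exists (id_fam_cocycle X), (id_fam_quasi_iso X), (zero_fam_cocycle X Y n).
have := represents_lift Pk eP eQ r eP; apply.
by apply: homotopic_ext => i j x; rewrite (comp_fam0E (id_fam_homogeneous X) eP.1) id_famE.
Qed.

Lemma represents_did : represents (did X) e e.
Proof.
have r : represents (did X) (id_fam X) (id_fam X).
  by exists (id_fam_cocycle X), (id_fam_quasi_iso X), (id_fam_cocycle X).
have ee : homotopic 0 (comp_fam 0 (id_fam X) e) e.
  by apply: homotopic_ext => i j x; rewrite (comp_fam0E (id_fam_homogeneous X) eP.1) id_famE.
have re := represents_lift Pk eP eQ r eP ee.
exact: represents_homotopic re eP ee.
Qed.

(** P serves as a common denominator. Any other common denominator Z receives a lift of [e], along
    which both numerators and their sum pull back to P. *)
Lemma represents_dadd (Y : complex A) n (c c' : dhom X Y n) (f f' : fam P Y) :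
  represents c e f -> represents c' e f' -> represents (dadd c c') e (add_fam f f').
Proof.
move=> cf cf'; have [_ [_ fP]] := cocycle_represents cf.
have [_ [_ fP']] := cocycle_represents cf'.
have [d df] := represents_class eP eQ (cocycle_add fP fP').
suff -> : dadd c c' = d by [].
apply: the_classP; first by exists P, e, f, f'.
move=> d' [Z [s [g [g' [cg cg' dg]]]]].
have [sP [sQ gP]] := cocycle_represents cg.
have [u uP uE] := lift_cocycle sP Pk sQ eP.
have fg := (represents_eq Pk eP eQ cf (represents_lift Pk eP eQ cg uP uE)).1 erefl.
have fg' := (represents_eq Pk eP eQ cf' (represents_lift Pk eP eQ cg' uP uE)).1 erefl.
apply/(represents_eq Pk eP eQ (represents_lift Pk eP eQ dg uP uE) df).
apply: homotopic_sym; apply: homotopic_eqr (homotopic_add fg fg') => i j x.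
by rewrite /add_fam /comp_fam.
Qed.

Lemma represents_dscale (Y : complex A) n a (c : dhom X Y n) (f : fam P Y) :
  represents c e f -> represents (dscale a c) e (scale_fam a f).
Proof.
move=> cf; have [_ [_ fP]] := cocycle_represents cf.
have [d df] := represents_class eP eQ (cocycle_scale a fP).
suff -> : dscale a c = d by [].
apply: the_classP; first by exists P, e, f.
move=> d' [Z [s [g [cg dg]]]].
have [sP [sQ gP]] := cocycle_represents cg.
have [u uP uE] := lift_cocycle sP Pk sQ eP.
have fg := (represents_eq Pk eP eQ cf (represents_lift Pk eP eQ cg uP uE)).1 erefl.
apply/(represents_eq Pk eP eQ (represents_lift Pk eP eQ dg uP uE) df).
apply: homotopic_sym; apply: homotopic_eqr (homotopic_scale a fg) => i j x.
by rewrite /scale_fam /comp_fam.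
Qed.

(** With all apexes equal to P, the square of the composite is filled by u = id and v = f. For
    another filling, with p and q lifting e to W and V, the maps t v p, f' u p, e f and t q f are
    homotopic, hence so are v p and q f because t is a quasi-isomorphism. *)
Lemma represents_dcomp m n (c' : dhom X X m) (c : dhom X X n) (g f : fam P P) :
  cocycle m g -> cocycle n f ->
  represents c' e (comp_fam m e g) -> represents c e (comp_fam n e f) ->
  represents (dcomp c' c) e (comp_fam (m + n) e (comp_fam n g f)).
Proof.
move=> gP fP cg cf.
have egP : cocycle m (comp_fam m e g) by apply: cocycle_comp eP gP _; rewrite add0r.
have efP : cocycle n (comp_fam n e f) by apply: cocycle_comp eP fP _; rewrite add0r.
have gfP : cocycle (m + n) (comp_fam n g f) by apply: cocycle_comp gP fP _.
have egfP : cocycle (m + n) (comp_fam (m + n) e (comp_fam n g f)).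
  by apply: cocycle_comp eP gfP _; rewrite add0r.
have [d dgf] := represents_class eP eQ egfP.
suff -> : dcomp c' c = d by [].
apply: the_classP.
  exists P, P, P, e, (comp_fam n e f), e, (comp_fam m e g), (id_fam P), f.
  split=> //.
    split=> //; first exact: id_fam_cocycle.
    by apply: homotopic_ext => i j x; rewrite comp_id.
  have ee : homotopic 0 e (comp_fam 0 e (id_fam P)).
    by apply: homotopic_ext => i j x; rewrite comp_id.
  have -> : comp_fam 0 e (id_fam P) = e.
    by apply: fam_ext => i j x; rewrite comp_id.
  refine (represents_homotopic Pk eP eQ dgf _ _) => //.
    by apply: cocycle_comp egP fP _.
  by apply: homotopic_sym; apply: homotopic_ext => i j x; apply: comp_famA.
move=> d' [U [V [W [s [f' [t [g' [u [v [cf' cg' [uP vP uv] dw]]]]]]]]]].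
have [sP [sQ f'P]] := cocycle_represents cf'.
have [tP [tQ g'P]] := cocycle_represents cg'.
have [suP [suQ _]] := cocycle_represents dw.
have [p pP pE] := lift_cocycle suP Pk suQ eP.
have [q qP qE] := lift_cocycle tP Pk tQ eP.
have upP : cocycle 0 (comp_fam 0 u p) by apply: cocycle_comp uP pP _.
have upE : homotopic 0 (comp_fam 0 s (comp_fam 0 u p)) e.
  by apply: homotopic_eql pE => i j x; exact: comp_famA.
have fE := (represents_eq Pk eP eQ (represents_lift Pk eP eQ cf' upP upE) cf).1 erefl.
have gE := (represents_eq Pk eP eQ (represents_lift Pk eP eQ cg' qP qE) cg).1 erefl.
have vpP : cocycle n (comp_fam 0 v p) by apply: cocycle_comp vP pP _; rewrite addr0.
have qfP : cocycle n (comp_fam n q f) by apply: cocycle_comp qP fP _; rewrite add0r.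
have vq : homotopic n (comp_fam 0 v p) (comp_fam n q f).
  apply: (lift_homotopic Pk tP tQ) => //.
  have h1 := homotopic_compr pP (homotopic_sym uv) (esym (addr0 n)).
  have h2 := homotopic_compr fP (homotopic_sym qE) (esym (add0r n)).
  apply: (@homotopic_trans _ _ _ _ _ (comp_fam 0 (comp_fam n t v) p)).
    by apply: homotopic_ext => i j x; apply/esym/comp_famA; rewrite addr0.
  apply: (homotopic_trans h1).
  apply: (@homotopic_trans _ _ _ _ _ (comp_fam 0 f' (comp_fam 0 u p))).
    by apply: homotopic_ext => i j x; apply: comp_famA; rewrite addr0.
  apply: (homotopic_trans fE); apply: (homotopic_trans h2).
  by apply: homotopic_ext => i j x; apply: comp_famA; rewrite add0r.
have g'qP : cocycle m (comp_fam 0 g' q) by apply: cocycle_comp g'P qP _; rewrite addr0.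
have h3 := homotopic_compl g'P vq (erefl (m + n)).
have h4 := homotopic_compr fP gE (erefl (m + n)).
apply/(represents_eq Pk eP eQ (represents_lift Pk eP eQ dw pP pE) dgf).
apply: (@homotopic_trans _ _ _ _ _ (comp_fam n g' (comp_fam 0 v p))).
  by apply: homotopic_ext => i j x; apply: comp_famA; rewrite addr0.
apply: (homotopic_trans h3).
apply: (@homotopic_trans _ _ _ _ _ (comp_fam n (comp_fam 0 g' q) f)).
  by apply: homotopic_ext => i j x; apply/esym/comp_famA; rewrite add0r.
apply: (homotopic_trans h4).
by apply: homotopic_ext => i j x; apply: comp_famA.
Qed.

(** The correspondence between Ext and the cohomology of Hom(P, P), kept as a relation; the lemmas
    below show that it is bijective up to homotopy and compatible with all operations. *)
Definition classifies n (c : dhom X X n) (f : fam P P) : Prop :=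
  cocycle n f /\ represents c e (comp_fam n e f).

Lemma classifies_ex n (c : dhom X X n) : exists f, classifies c f.
Proof.
have [f fP cf] := represents_ex Pk eP eQ c.
have [g gP gE] := lift_cocycle eP Pk eQ fP.
exists g; split=> //; refine (represents_homotopic Pk eP eQ cf _ (homotopic_sym gE)).
by apply: cocycle_comp eP gP _; rewrite add0r.
Qed.

Lemma classifies_class n (f : fam P P) : cocycle n f -> exists c, @classifies n c f.
Proof.
move=> fP; have [|c cf] := @represents_class _ _ _ _ _ eP eQ X n (comp_fam n e f).
  by apply: cocycle_comp eP fP _; rewrite add0r.
by exists c.
Qed.

Lemma classifies_eq n (c c' : dhom X X n) (f f' : fam P P) :
  classifies c f -> classifies c' f' -> c = c' <-> homotopic n f f'.
Proof.
move=> [fP cf] [fP' cf']; rewrite (represents_eq Pk eP eQ cf cf').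
split; first exact: (lift_homotopic Pk eP eQ).
by move=> H; apply: homotopic_compl eP H _; rewrite add0r.
Qed.

Lemma classifies_homotopic n (c : dhom X X n) (f f' : fam P P) :
  classifies c f -> cocycle n f' -> homotopic n f f' -> classifies c f'.
Proof.
move=> cf fP' ff'; have [c' cf'] := classifies_class fP'.
by rewrite ((classifies_eq cf cf').2 ff').
Qed.

Lemma classifies_dzero n : classifies (dzero X X n) (zero_fam P P).
Proof.
split; first exact: zero_fam_cocycle.
refine (represents_homotopic Pk eP eQ (represents_dzero _ _) _ _) => //.
  by apply: cocycle_comp eP (zero_fam_cocycle P P n) _; rewrite add0r.
by apply: homotopic_ext => i j x; rewrite /comp_fam /zero_fam (rlin0 (eP.1.1 _ _)).
Qed.

Lemma classifies_did : classifies (did X) (id_fam P).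
Proof.
split; first exact: id_fam_cocycle.
refine (represents_homotopic Pk eP eQ represents_did _ _) => //.
  by apply: cocycle_comp eP (id_fam_cocycle P) _.
by apply: homotopic_ext => i j x; rewrite comp_id.
Qed.

Lemma classifies_dadd n (c c' : dhom X X n) (f f' : fam P P) :
  classifies c f -> classifies c' f' -> classifies (dadd c c') (add_fam f f').
Proof.
move=> [fP cf] [fP' cf']; split; first exact: cocycle_add.
refine (represents_homotopic Pk eP eQ (represents_dadd cf cf') _ _).
  by apply: cocycle_comp eP (cocycle_add fP fP') _; rewrite add0r.
by apply: homotopic_ext => i j x; rewrite /comp_fam /add_fam (rlinD (eP.1.1 _ _)).
Qed.

Lemma classifies_dscale n a (c : dhom X X n) (f : fam P P) :
  classifies c f -> classifies (dscale a c) (scale_fam a f).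
Proof.
move=> [fP cf]; split; first exact: cocycle_scale.
refine (represents_homotopic Pk eP eQ (represents_dscale a cf) _ _).
  by apply: cocycle_comp eP (cocycle_scale a fP) _; rewrite add0r.
by apply: homotopic_ext => i j x; rewrite /comp_fam /scale_fam (rlinZ (eP.1.1 _ _)).
Qed.

Lemma classifies_dcomp m n (c' : dhom X X m) (c : dhom X X n) (g f : fam P P) :
  classifies c' g -> classifies c f -> classifies (dcomp c' c) (comp_fam n g f).
Proof.
move=> [gP cg] [fP cf]; split; first exact: cocycle_comp gP fP erefl.
exact: represents_dcomp.
Qed.

End ClassOperations.

(** * Sweedler sums *)

(* The same as linear, but with both spaces recoverable by matching on the goal. *)
Definition lin (k : fieldType) (V U : lmodType k) (f : V -> U) :=
  forall a u v, f (a *: u + v) = a *: f u + f v.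

Section Lin.
Variables (k : fieldType).
Implicit Types V W U : lmodType k.

Lemma lin_id V : lin (fun v : V => v). Proof. by []. Qed.

Lemma lin_comp V W U (f : W -> U) (g : V -> W) :
  lin f -> lin g -> lin (fun v => f (g v)).
Proof. by move=> fl gl a u v; rewrite gl fl. Qed.

Lemma lin_linear V U (f : {linear V -> U}) : lin f.
Proof. by move=> a u v; rewrite linearP. Qed.

Lemma lin0 V U (f : V -> U) : lin f -> f 0 = 0.
Proof. by move/(_ (-1) 0 0); rewrite scaler0 addr0 scaleN1r addNr. Qed.

Lemma linD V U (f : V -> U) : lin f -> {morph f : x y / x + y}.
Proof. by move=> fl x y; have := fl 1 x y; rewrite !scale1r. Qed.

Lemma linZ V U (f : V -> U) : lin f -> forall a x, f (a *: x) = a *: f x.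
Proof. by move=> fl a x; have := fl a x 0; rewrite !addr0 (lin0 fl) addr0. Qed.

Lemma lin_sum V U (f : V -> U) I r (P : pred I) (F : I -> V) : lin f ->
  f (\sum_(i <- r | P i) F i) = \sum_(i <- r | P i) f (F i).
Proof. by move=> fl; apply: (big_morph f (linD fl) (lin0 fl)). Qed.

Lemma lin_bigsum V U (I : finType) (F : V -> I -> U) :
  (forall i, lin (fun v => F v i)) -> lin (fun v => \sum_i F v i).
Proof.
move=> Fl a u v; rewrite scaler_sumr -big_split; apply: eq_bigr => i _; exact: Fl.
Qed.

Lemma lin_scale1 V U (f : V -> k^o) (x : U) : lin f -> lin (fun v => f v *: x).
Proof. by move=> fl a u v; rewrite fl scalerDl scalerA. Qed.

Lemma lin_scale2 V U c (f : V -> U) : lin f -> lin (fun v => c *: f v).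
Proof. by move=> fl a u v; rewrite fl scalerDr !scalerA mulrC. Qed.

Lemma lin_mul1 V (B : algType k) (f : V -> B) b : lin f -> lin (fun v => f v * b).
Proof. by move=> fl a u v; rewrite fl mulrDl scalerAl. Qed.

Lemma lin_mul2 V (B : algType k) (f : V -> B) b : lin f -> lin (fun v => b * f v).
Proof. by move=> fl a u v; rewrite fl mulrDr scalerAr. Qed.

Lemma lin_ract1 V (B : algType k) (M : rmodule B) (f : V -> M) b :
  lin f -> lin (fun v => ract (f v) b).
Proof. by move=> fl a u v; rewrite fl ract_linearl. Qed.

Lemma lin_ract2 V (B : algType k) (M : rmodule B) (f : V -> B) (m : M) :
  lin f -> lin (fun v => ract m (f v)).
Proof. by move=> fl a u v; rewrite fl ract_linearr. Qed.

Section Sweedler.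
Variables (V : lmodType k) (W : vectType k).

Lemma lin_pure1 U (f : U -> V) (w : W) : lin f -> lin (fun u => pure (f u) w).
Proof. by move=> fl a u v; rewrite fl pure_linearl. Qed.

Lemma lin_pure2 U (f : U -> W) (v : V) : lin f -> lin (fun u => pure v (f u)).
Proof. by move=> fl a u u'; rewrite fl pure_linearr. Qed.

Lemma lin_sw1 U U' (X : U' -> tens V W) (F : V -> W -> U) :
  lin X -> (forall w, lin (F ^~ w)) -> lin (fun u => sw (X u) F).
Proof.
move=> Xl Fl a u v; rewrite /sw scaler_sumr -big_split; apply: eq_bigr => i _ /=.
by rewrite Xl !ffunE Fl.
Qed.

Lemma lin_sw2 U U' (x : tens V W) (F : U' -> V -> W -> U) :
  (forall v w, lin (fun u => F u v w)) -> lin (fun u => sw x (F u)).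
Proof.
move=> Fl a u v; rewrite /sw scaler_sumr -big_split; apply: eq_bigr => i _ /=.
exact: Fl.
Qed.

Lemma sw_ext (U : nmodType) (x : tens V W) (F G : V -> W -> U) :
  (forall v w, F v w = G v w) -> sw x F = sw x G.
Proof. by move=> FG; apply: eq_bigr => i _; exact: FG. Qed.

Lemma sw_lin U U' (f : U -> U') (x : tens V W) (F : V -> W -> U) :
  lin f -> f (sw x F) = sw x (fun v w => f (F v w)).
Proof. by move=> fl; rewrite /sw lin_sum. Qed.

Lemma sw_mull (B : algType k) (x : tens V W) (F : V -> W -> B) b :
  sw x F * b = sw x (fun v w => F v w * b).
Proof. by rewrite /sw mulr_suml. Qed.

Lemma sw_mulr (B : algType k) (x : tens V W) (F : V -> W -> B) b :
  b * sw x F = sw x (fun v w => b * F v w).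
Proof. by rewrite /sw mulr_sumr. Qed.

Lemma sw_scale U (x : tens V W) (F : V -> W -> U) a :
  a *: sw x F = sw x (fun v w => a *: F v w).
Proof. by rewrite /sw scaler_sumr. Qed.

Lemma sw_pureE U (v : V) (w : W) (F : V -> W -> U) :
  (forall w, lin (F ^~ w)) -> (forall v, lin (F v)) -> sw (pure v w) F = F v w.
Proof. exact: sw_pure. Qed.

Lemma pureZl c (v : V) (w : W) : pure (c *: v) w = c *: pure v w.
Proof. by apply/ffunP => i; rewrite !ffunE !scalerA mulrC. Qed.

Lemma pureZr c (v : V) (w : W) : pure v (c *: w) = c *: pure v w.
Proof. by apply/ffunP => i; rewrite !ffunE linearZ scalerA. Qed.

Lemma tens_sw (x : tens V W) : x = sw x (@pure k V W).
Proof.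
apply/ffunP => i; rewrite sum_ffunE (bigD1 i) //= big1 => [|j ji].
  rewrite addr0 ffunE /bas (coord_free i i) ?eqxx ?scale1r //.
  exact: basis_free (vbasisP _).
rewrite ffunE /bas (coord_free j i) ?(basis_free (vbasisP _)) //.
by rewrite (negPf ji) scale0r.
Qed.

Lemma coord_bas (c : 'I_(\dim (fullv : {vspace W})) -> k) j :
  coord (vbasis fullv) j (\sum_i c i *: (bas i : W)) = c j.
Proof. by apply: coord_sum_free; exact: basis_free (vbasisP _). Qed.

Lemma lin_coord U n (X : n.-tuple W) i (f : U -> W) :
  lin f -> lin (fun u => coord X i (f u) : k^o).
Proof. by move=> fl a u v; rewrite fl linearP. Qed.

End Sweedler.

Lemma sw_sw (V V' : lmodType k) (W W' : vectType k) U (x : tens V W)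
    (F : V -> W -> tens V' W') (G : V' -> W' -> U) :
  (forall w, lin (G ^~ w)) -> sw (sw x F) G = sw x (fun v w => sw (F v w) G).
Proof. by move=> Gl; apply: (sw_lin x F (f := fun t => sw t G)); apply: lin_sw1. Qed.

Lemma sw_exchange (V V' : lmodType k) (W W' : vectType k) (U : nmodType)
    (x : tens V W) (y : tens V' W') (F : V -> W -> V' -> W' -> U) :
  sw x (fun a b => sw y (fun c d => F a b c d)) =
  sw y (fun c d => sw x (fun a b => F a b c d)).
Proof. by rewrite /sw exchange_big. Qed.

End Lin.

(** Linearity is proved by descending through the syntax of the term. Sweedler sums and concrete
    operations are tried before hypotheses and before composition with a bundled linear map. *)
Ltac lin1 :=
  match goal with
  | |- forall _, _ => intro
  | |- lin (fun v => v) => exact: lin_id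
  | |- lin (fun v => sw (@?X v) ?F) => apply: (@lin_sw1 _ _ _ _ _ X F)
  | |- lin (fun v => sw ?x (@?F v)) => apply: (@lin_sw2 _ _ _ _ _ x F)
  | |- lin (fun v => coord ?X ?i (@?f v)) => apply: (@lin_coord _ _ _ _ X i f)
  | |- lin (pure ?x) => apply: (@lin_pure2 _ _ _ _ (fun v => v) x)
  | |- lin (fun v => pure (@?f v) ?w) => apply: (@lin_pure1 _ _ _ _ f w)
  | |- lin (fun v => pure ?x (@?f v)) => apply: (@lin_pure2 _ _ _ _ f x)
  | |- lin (fun v => ract (@?f v) ?b) => apply: (@lin_ract1 _ _ _ _ f b)
  | |- lin (fun v => ract ?m (@?f v)) => apply: (@lin_ract2 _ _ _ _ f m)
  | |- lin (fun v => @?f v * ?b) => apply: (@lin_mul1 _ _ _ f b)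
  | |- lin (fun v => ?b * @?f v) => apply: (@lin_mul2 _ _ _ f b)
  | |- lin (fun v => @?f v *: ?b) => apply: (@lin_scale1 _ _ _ f b)
  | |- lin (fun v => ?b *: @?f v) => apply: (@lin_scale2 _ _ _ b f)
  | |- lin (fun v => \sum_i (@?F v i)) => apply: (@lin_bigsum _ _ _ _ F)
  | H : lin ?f |- lin ?f => exact: H
  | H : forall _, lin _ |- lin _ => exact: H
  | H : forall _ _, lin _ |- lin _ => exact: H
  | H : forall _ _ _, lin _ |- lin _ => exact: H
  | |- lin _ => exact: lin_linear
  | H : lin ?f |- lin (fun v => ?f (@?g v)) => apply: (@lin_comp _ _ _ _ f g H)
  | H : forall _, lin _ |- lin (fun v => ?f (@?g v)) => apply: (@lin_comp _ _ _ _ f g (H _))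
  | |- lin (fun v => ?f (@?g v)) => apply: (@lin_comp _ _ _ _ f g); [exact: lin_linear|]
  end.
Ltac solve_lin := try solve [repeat lin1].

(** * Hopf algebra identities under Sweedler sums *)

Section HopfLemmas.
Variables (k : fieldType) (H : hopf_algebra k).
Implicit Types (g h : H) (U V : lmodType k).
Local Notation S := (antipode H).
Local Notation eps h := (counit H h : k).
Local Notation D := (comul H).

(** Coassociativity as seen by a trilinear T. Keeping V and [rho] general covers the
    comultiplication and the coactions on A and on Hopf modules. *)
Lemma coassoc_sw V U (rho : {linear V -> tens V H}) (m : V) (T : V -> H -> H -> U) :
  sw (rho m) (fun m0 m1 => pure (rho m0) m1) =
  sw (rho m) (fun m0 m1 => sw (D m1) (fun h1 h2 => pure (pure m0 h1) h2)) ->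
  (forall h g, lin (fun x => T x h g)) -> (forall x g, lin (fun h => T x h g)) ->
  (forall x h, lin (fun g => T x h g)) ->
  sw (rho m) (fun m0 m1 => sw (rho m0) (fun x h => T x h m1)) =
  sw (rho m) (fun m0 m1 => sw (D m1) (fun h1 h2 => T m0 h1 h2)).
Proof.
move=> rhoA T1 T2 T3; pose F (u : tens V H) (g : H) := sw u (fun x h => T x h g).
have F1 g : lin (F ^~ g) by rewrite /F; solve_lin.
have F2 u : lin (F u) by rewrite /F; solve_lin.
have := congr1 (fun t => sw t F) rhoA; rewrite !sw_sw // => E.
transitivity (sw (rho m) (fun m0 m1 => sw (pure (rho m0) m1) F)).
  by apply: sw_ext => m0 m1; rewrite sw_pureE.
rewrite [LHS]E; apply: sw_ext => m0 m1; rewrite sw_sw //; apply: sw_ext => h1 h2.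
by rewrite sw_pureE // /F sw_pureE; solve_lin.
Qed.

Lemma comul_sw U h (T : H -> H -> H -> U) :
  (forall b c, lin (fun a => T a b c)) -> (forall a c, lin (fun b => T a b c)) ->
  (forall a b, lin (fun c => T a b c)) ->
  sw (D h) (fun h1 h2 => sw (D h1) (fun x y => T x y h2)) =
  sw (D h) (fun h1 h2 => sw (D h2) (fun x y => T h1 x y)).
Proof. exact: coassoc_sw (comulA h). Qed.

Lemma counitl_sw U h (f : H -> U) : lin f ->
  sw (D h) (fun h1 h2 => eps h1 *: f h2) = f h.
Proof.
move=> fl; rewrite -[in RHS](counitl h) (sw_lin _ _ fl).
by apply: sw_ext => a b; rewrite (linZ fl).
Qed.

Lemma counitr_sw U h (f : H -> U) : lin f ->
  sw (D h) (fun h1 h2 => eps h2 *: f h1) = f h.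
Proof.
move=> fl; rewrite -[in RHS](counitr h) (sw_lin _ _ fl).
by apply: sw_ext => a b; rewrite (linZ fl).
Qed.

Lemma antipodel_sw U h (f : H -> U) : lin f ->
  sw (D h) (fun h1 h2 => f (S h1 * h2)) = eps h *: f 1.
Proof. by move=> fl; rewrite -(linZ fl) -antipodel (sw_lin _ _ fl). Qed.

Lemma antipoder_sw U h (f : H -> U) : lin f ->
  sw (D h) (fun h1 h2 => f (h1 * S h2)) = eps h *: f 1.
Proof. by move=> fl; rewrite -(linZ fl) -antipoder (sw_lin _ _ fl). Qed.

Lemma comulM_sw U g h (F : H -> H -> U) :
  (forall b, lin (fun a => F a b)) -> (forall a, lin (F a)) ->
  sw (D (g * h)) F =
  sw (D g) (fun g1 g2 => sw (D h) (fun h1 h2 => F (g1 * h1) (g2 * h2))).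
Proof.
move=> F1 F2; rewrite comulM sw_sw //; apply: sw_ext => a b.
rewrite sw_sw //; apply: sw_ext => c d; exact: sw_pure.
Qed.

Lemma counit_scaleC U g h (x : U) : eps g *: (eps h *: x) = eps h *: (eps g *: x).
Proof. by rewrite !scalerA mulrC. Qed.

Lemma counitM_scale U g h (x : U) : eps (g * h) *: x = eps g *: (eps h *: x).
Proof. by rewrite scalerA counitM. Qed.

(* Both sides are convolution inverses of the multiplication in Hom(H ⊗ H, H). *)
Lemma antipodeM g h : S (g * h) = S h * S g.
Proof.
pose T (g1 x y h1 z w : H) := S (g1 * h1) * (x * z) * (S w * S y).
have inv g2 h2 : sw (D g2) (fun x y => sw (D h2) (fun z w => x * z * (S w * S y))) =
    eps g2 *: (eps h2 *: 1).
  rewrite counit_scaleC -[X in _ *: X]antipoder sw_scale; apply: sw_ext => x y.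
  have -> : eps h2 *: (x * S y) = x * (eps h2 *: 1) * S y.
    by rewrite -scalerAr mulr1 scalerAl.
  by rewrite -antipoder sw_mulr sw_mull; apply: sw_ext => z w; rewrite !mulrA.
transitivity (sw (D g) (fun g1 g2 => sw (D h) (fun h1 h2 =>
    sw (D g2) (fun x y => sw (D h2) (fun z w => T g1 x y h1 z w))))).
  rewrite -[in LHS](counitr_sw g (f := fun g => S (g * h))); solve_lin.
  apply: sw_ext => g1 g2.
  rewrite -(counitr_sw h (f := fun h => S (g1 * h))); solve_lin.
  rewrite sw_scale; apply: sw_ext => h1 h2.
  rewrite -[S _]mulr1 !scalerAr -inv sw_mulr; apply: sw_ext => x y.
  by rewrite sw_mulr; apply: sw_ext => z w; rewrite /T !mulrA.
transitivity (sw (D g) (fun g1 g2 => sw (D g1) (fun x y => sw (D h) (fun h1 h2 =>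
    sw (D h1) (fun z w => T x y g2 z w h2))))).
  rewrite (comul_sw g (T := fun a b c => sw (D h) (fun h1 h2 => sw (D h1) (fun z w => T a b c z w h2))));
    rewrite /T; solve_lin.
  apply: sw_ext => g1 g2; rewrite sw_exchange; apply: sw_ext => x y.
  by rewrite (comul_sw h (T := fun a b c => S (g1 * a) * (x * b) * (S c * S y))); solve_lin.
rewrite -[in RHS](counitl_sw g (f := fun g => S h * S g)); solve_lin.
apply: sw_ext => g1 g2.
rewrite -(counitl_sw h (f := fun h => S h * S g2)); solve_lin.
rewrite sw_scale sw_exchange; apply: sw_ext => h1 h2.
rewrite -counitM_scale -[S h2 * S g2]mul1r scalerAl -antipodel.
rewrite comulM_sw; solve_lin.
rewrite sw_mull; apply: sw_ext => x y; rewrite sw_mull; apply: sw_ext => z w.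
by rewrite /T.
Qed.

End HopfLemmas.

(** * Integrals *)

Section LinfunE.
Variables (k : fieldType) (V U : vectType k) (f : V -> U) (fl : lin f).
HB.instance Definition _ := GRing.isLinear.Build k V U *:%R f fl.
Lemma linfunE : linfun f =1 f. Proof. exact: lfunE. Qed.
End LinfunE.

Section Integral.
Variables (k : fieldType) (H : hopf_algebra k).
Implicit Types (g h : H) (C E : {vspace H}).
Local Notation S := (antipode H).
Local Notation eps h := (counit H h : k).
Local Notation D := (comul H).
Local Notation dual := 'Hom(H, k^o).

Lemma functional_separation C v : v \notin C ->
  exists t : dual, t v = 1 /\ forall c, c \in C -> t c = 0.
Proof.
move=> vC; have dir : (<[v]> :&: C = 0)%VS.
  apply/eqP; rewrite -subv0; apply/subvP => x; rewrite memv_cap memv0.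
  case/andP=> /vlineP[a ->] avC; rewrite scaler_eq0.
  case: eqP => //= /eqP a0; case/negP: vC.
  by rewrite -[v]scale1r -(mulVf a0) -scalerA memvZ.
have fr : free [:: v].
  by rewrite seq1_free; apply: contra vC => /eqP ->; exact: mem0v.
exists (linfun (fun h => coord [tuple v] ord0 (daddv_pi <[v]> C h) : k^o)).
have cl : lin (fun h => coord [tuple v] ord0 (daddv_pi <[v]> C h) : k^o).
  by move=> a x y; rewrite !linearP.
split=> [|c cC]; rewrite linfunE //.
  by rewrite daddv_pi_id ?memv_line // -[X in coord _ _ X]/([tuple v]`_0) (coord_free ord0 ord0).
rewrite (_ : daddv_pi _ _ c = 0) ?linear0 //.
have cVC : c \in (<[v]> + C)%VS by apply: (subvP (addvSr _ _)).
apply: (addIr c); rewrite add0r.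
by have := daddv_pi_add dir cVC; rewrite (daddv_pi_id (U := C)) // 1?capvC.
Qed.

Lemma memv_pure_span C u v : u \in C -> v \in C ->
  pure u v \in <<[seq pure u v | u <- vbasis C, v <- vbasis C]>>%VS.
Proof.
move=> uC vC; rewrite (coord_vbasis uC) (coord_vbasis vC).
rewrite (lin_sum _ _ _ (f := fun u => pure u _)); solve_lin.
apply: memv_suml => i _.
rewrite (linZ (f := fun u => pure u _)); solve_lin; apply: memvZ.
rewrite (lin_sum _ _ _ (f := fun v => pure _ v)); solve_lin.
apply: memv_suml => j _.
rewrite (linZ (f := fun v => pure _ v)); solve_lin; apply: memvZ.
by apply/memv_span/allpairsP; exists ((vbasis C)`_i, (vbasis C)`_j);
  split=> //; apply: mem_nth; rewrite size_tuple.
Qed.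

(** Because comul h lies in C ⊗ C, a linear property of a bilinear Sweedler sum need only be checked
    on C × C. *)
Lemma subcoalgebra_ind C (U : lmodType k) (Q : U -> Prop) (G : H -> H -> U) h :
  subcoalgebra C -> h \in C ->
  (forall v, lin (G ^~ v)) -> (forall u, lin (G u)) ->
  Q 0 -> (forall a x y, Q x -> Q y -> Q (a *: x + y)) ->
  (forall u v, u \in C -> v \in C -> Q (G u v)) -> Q (sw (D h) G).
Proof.
move=> CP hC G1 G2 Q0 QP QG; have := CP h hC.
set X := [seq _ | _ <- _, _ <- _] => /(coord_span (X := in_tuple X)) ->.
elim/big_rec: _ => [|i y _ Qy].
  by rewrite /sw big1 // => j _; rewrite ffunE (lin0 (G1 _)).
rewrite (lin_sw1 (@lin_id _ _) G1); apply: QP => //.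
have /allpairsP[[u v] /= [uC vC ->]] : (in_tuple X)`_i \in X by exact: mem_nth.
by rewrite sw_pureE //; apply: QG; exact: vbasis_mem.
Qed.

Lemma subcoalgebra_add C E : subcoalgebra C -> subcoalgebra E -> subcoalgebra (C + E).
Proof.
move=> CP EP _ /memv_addP[c cC [e eE ->]]; rewrite linearD /= (tens_sw (D c)) (tens_sw (D e)).
apply: memvD.
  apply: (subcoalgebra_ind (Q := fun x => x \in _) CP cC); solve_lin.
  - exact: mem0v.
  - by move=> a x y xX yX; apply: memvD => //; apply: memvZ.
  - by move=> u v uC vC; apply: memv_pure_span; apply: (subvP (addvSl C E)).
apply: (subcoalgebra_ind (Q := fun x => x \in _) EP eE); solve_lin.
- exact: mem0v.
- by move=> a x y xX yX; apply: memvD => //; apply: memvZ.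
- by move=> u v uC vC; apply: memv_pure_span; apply: (subvP (addvSr C E)).
Qed.

Lemma subcoalgebra0 : subcoalgebra (0 : {vspace H})%VS.
Proof. by move=> c; rewrite memv0 => /eqP ->; rewrite linear0 mem0v. Qed.

Lemma subcoalgebra1 : subcoalgebra (<[1 : H]>)%VS.
Proof.
move=> c /vlineP[a ->]; rewrite linearZ /= comul1; apply: memvZ.
by apply: memv_pure_span; exact: memv_line.
Qed.

Lemma subcoalgebra_sum (s : seq {vspace H}) (P : pred {vspace H}) :
  (forall C, C \in s -> subcoalgebra C) -> subcoalgebra (\sum_(C <- s | P C) C)%VS.
Proof.
elim: s => [|C s IH] sP; first by rewrite big_nil; exact: subcoalgebra0.
have Es : subcoalgebra (\sum_(C <- s | P C) C)%VS.
  by apply: IH => E Es; apply: sP; rewrite inE Es orbT.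
rewrite big_cons; case: (P C) => //; apply: subcoalgebra_add => //.
by apply: sP; rewrite inE eqxx.
Qed.

(** Write 1 = c + e with c in C and e in the sum E of the others. If 1 is not in E, choose t with
    t(1) = 1 and t(E) = 0. Then (t ⊗ id) comul fixes 1, kills E and maps C into C, so 1 lies in
    C. *)
Lemma mem1_sum_simple (s : seq {vspace H}) :
  (forall C, C \in s -> subcoalgebra C) ->
  1 \in (\sum_(C <- s) C)%VS -> exists2 C, C \in s & 1 \in C.
Proof.
elim: s => [|C s IH] sP; first by rewrite big_nil memv0 oner_eq0.
have sP' E : E \in s -> subcoalgebra E by move=> Es; apply: sP; rewrite inE Es orbT.
rewrite big_cons; set E := (\sum_(C <- s) C)%VS => oneCE.
have [oneE|nE] := boolP (1 \in E).
  by have [B Bs B1] := IH sP' oneE; exists B => //; rewrite inE Bs orbT.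
have [t [t1 tE]] := functional_separation nE.
exists C; first by rewrite inE eqxx.
have CP : subcoalgebra C by apply: sP; rewrite inE eqxx.
have EP : subcoalgebra E by exact: subcoalgebra_sum.
have tl : lin (t : H -> k^o) by move=> a x y; rewrite linearP.
have := sw_pureE (1 : H) (1 : H) (F := fun u v => (t u : k) *: v).
rewrite -comul1 t1 scale1r => oneP.
suff : sw (D 1) (fun u v => (t u : k) *: v) \in C by rewrite oneP; solve_lin.
case/memv_addP: oneCE => c cC [e eE ->]; rewrite linearD /=.
rewrite (linD (f := fun x => sw x _)); solve_lin.
have -> : sw (D e) (fun u v => (t u : k) *: v) = 0.
  apply: (subcoalgebra_ind (Q := fun x => x = 0) EP eE); solve_lin; first by [].
    by move=> a x y -> ->; rewrite scaler0 addr0.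
  by move=> u v uE vE; rewrite tE // scale0r.
rewrite addr0; apply: (subcoalgebra_ind (Q := fun x => x \in C) CP cC); solve_lin.
- exact: mem0v.
- by move=> a x y xX yX; apply: memvD => //; apply: memvZ.
- by move=> u v uC vC; apply: memvZ.
Qed.

Lemma simple_subcoalgebra1 C : simple_subcoalgebra C -> 1 \in C -> C = <[1]>%VS.
Proof.
case=> CP Cn Cs C1; case: (Cs _ subcoalgebra1); first by rewrite -memvE.
  by move=> E; have := memv_line (1 : H); rewrite E memv0 oner_eq0.
by [].
Qed.

(** Applying a functional a to both equations gives t a = a(1) t = a t in the dual algebra: t is a
    two-sided integral of H^*. *)
Definition integral (t : dual) :=
  (forall h, sw (D h) (fun h1 h2 => (t h1 : k) *: h2) = (t h : k) *: 1) /\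
  (forall h, sw (D h) (fun h1 h2 => (t h2 : k) *: h1) = (t h : k) *: 1).

(* The projection onto the component k 1 of H along the sum of the other *)
(* simple subcoalgebras. *)
Lemma cosemisimple_integral : cosemisimple H -> exists2 t : dual, t 1 = 1 & integral t.
Proof.
case=> s [sP sE].
pose E := (\sum_(C <- s | C != <[1]>%VS) C)%VS.
have sP' C : C \in s -> subcoalgebra C by case/sP.
have EP : subcoalgebra E by exact: subcoalgebra_sum.
have nE : 1 \notin E.
  apply/negP; rewrite /E -big_filter => /mem1_sum_simple[C|C].
    by rewrite mem_filter => /andP[_ /sP'].
  rewrite mem_filter => /andP[/eqP C1 /sP Cs] /(simple_subcoalgebra1 Cs).
  exact: C1.
have EH : (E + <[1]>)%VS = fullv.
  apply/eqP; rewrite eqEsubv subvf -sE (bigID (fun C => C != <[1]>%VS)) /=.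
  apply: addvS => //; elim/big_ind: _ => [|U V UP VP|C]; first exact: sub0v.
    by rewrite subv_add UP.
  by rewrite negbK => /eqP ->.
have [t [t1 tE]] := functional_separation nE.
have tl : lin (t : H -> k^o) by move=> a x y; rewrite linearP.
(* Both integral identities are instances of this. Since H = E + k 1 and E is a subcoalgebra, a
   bilinear G vanishing on E × E sees only the component along 1. *)
suff key (G : H -> H -> H) h : (forall v, lin (G ^~ v)) -> (forall u, lin (G u)) ->
    G 1 1 = 1 -> (forall u v, u \in E -> v \in E -> G u v = 0) ->
    sw (D h) G = (t h : k) *: 1.
  exists t => //; split=> h; apply: key; solve_lin.
  - by rewrite t1 scale1r.
  - by move=> u v uE vE; rewrite tE // scale0r.
  - by rewrite t1 scale1r.
  - by move=> u v uE vE; rewrite tE // scale0r.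
move=> G1 G2 G11 GE; have : h \in (E + <[1]>)%VS by rewrite EH memvf.
case/memv_addP=> x xE [_ /vlineP[a ->] ->].
have -> : t (x + a *: 1) = a.
  by rewrite (linD tl) (linZ tl) tE // t1 add0r; exact: mulr1.
rewrite linearD (linD (f := fun x => sw x _)); solve_lin.
rewrite linearZ /= comul1 (linZ (f := fun x => sw x _)) /=; solve_lin.
rewrite sw_pureE; solve_lin; rewrite G11.
have -> : sw (D x) G = 0 by apply: (subcoalgebra_ind (Q := fun x => x = 0) EP xE) => // b y z -> ->;
  rewrite scaler0 addr0.
by rewrite add0r.
Qed.

Section Nondegenerate.
Variable t : dual.
Hypothesis t1 : t 1 = 1.
Hypothesis tI : integral t.
Local Notation "''t' x" := (t x : k) (at level 10, x at level 8).

(* Both sides equal sum t(h_1 g_1) h_2 g_2 S(g_3). *)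
Lemma integral_antipodel g h :
  sw (D h) (fun h1 h2 => 't (h1 * g) *: h2) = sw (D g) (fun g1 g2 => 't (h * g1) *: S g2).
Proof.
transitivity (sw (D g) (fun g1 g2 => sw (D g1) (fun x y => sw (D h) (fun h1 h2 =>
    't (h1 * x) *: (h2 * y * S g2))))); last first.
  apply: sw_ext => g1 g2; rewrite -[S g2 in RHS]mul1r scalerAl -tI.1 comulM_sw; solve_lin.
  rewrite sw_mull sw_exchange; apply: sw_ext => h1 h2; rewrite sw_mull.
  by apply: sw_ext => x y; rewrite scalerAl.
rewrite (comul_sw g (T := fun a b c => sw (D h) (fun h1 h2 => 't (h1 * a) *: (h2 * b * S c))));
  solve_lin.
rewrite -[in LHS](counitr_sw g (f := fun g => sw (D h) (fun h1 h2 => 't (h1 * g) *: h2)));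
  solve_lin.
apply: sw_ext => g1 g2; rewrite sw_exchange sw_scale; apply: sw_ext => h1 h2.
rewrite scalerA mulrC -scalerA -[X in eps g2 *: X]mulr1 scalerAr -antipoder sw_mulr sw_scale.
by apply: sw_ext => x y; rewrite mulrA.
Qed.

(** Mirror image of the previous identity: both sides equal sum t(h_3 g_2) S(h_1) h_2 g_1. *)
Lemma integral_antipoder g h :
  sw (D g) (fun g1 g2 => 't (h * g2) *: g1) = sw (D h) (fun h1 h2 => 't (h2 * g) *: S h1).
Proof.
transitivity (sw (D h) (fun h1 h2 => sw (D h2) (fun x y => sw (D g) (fun g1 g2 =>
    't (y * g2) *: (S h1 * x * g1))))); last first.
  apply: sw_ext => h1 h2; rewrite -[S h1 in RHS]mulr1 scalerAr -tI.2 comulM_sw; solve_lin.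
  rewrite sw_mulr; apply: sw_ext => x y; rewrite sw_mulr.
  by apply: sw_ext => g1 g2; rewrite -scalerAr !mulrA.
rewrite -(comul_sw h (T := fun a b c => sw (D g) (fun g1 g2 => 't (c * g2) *: (S a * b * g1))));
  solve_lin.
rewrite -[in LHS](counitl_sw h (f := fun h => sw (D g) (fun g1 g2 => 't (h * g2) *: g1)));
  solve_lin.
apply: sw_ext => h1 h2; rewrite sw_exchange.
rewrite sw_scale; apply: sw_ext => g1 g2.
rewrite scalerA mulrC -scalerA -[X in eps h1 *: X]mul1r scalerAl -antipodel sw_mull sw_scale.
by [].
Qed.

(** By [integral_antipodel] the hypothesis kills X(g) = sum t(h_1 g) h_2 for every g. On the other
    hand t(1) = 1 gives h = sum t(h_1 S(h_2)) h_3, and expanding S(h_2) in the basis expresses this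
    through the comultiplications of the X(b_j). *)
Lemma integral_nondegenerate h : (forall g, t (h * g) = 0) -> h = 0.
Proof.
move=> th; pose X g := sw (D h) (fun h1 h2 => 't (h1 * g) *: h2).
have X0 g : X g = 0.
  by rewrite /X integral_antipodel /sw big1 // => i _; rewrite th scale0r.
rewrite -[LHS](counitl_sw h (f := id)); solve_lin.
transitivity (\sum_j sw (D (X (bas j))) (fun y z => coord (vbasis fullv) j (S y) *: z)); last first.
  by apply: big1 => j _; rewrite X0 linear0 /sw big1 // => i _; rewrite ffunE !linear0 scale0r.
transitivity (sw (D h) (fun h1 h2 => sw (D h1) (fun x y => 't (x * S y) *: h2))).
  apply: sw_ext => h1 h2.
  by rewrite (antipoder_sw h1 (f := fun x => 't x *: h2)) ?t1 ?scale1r; solve_lin.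
rewrite (comul_sw h (T := fun a b c => 't (a * S b) *: c)); solve_lin.
transitivity (sw (D h) (fun h1 h2 => \sum_j sw (D h2) (fun y z =>
    't (h1 * bas j) *: (coord (vbasis fullv) j (S y) *: z)))).
  apply: sw_ext => h1 h2; rewrite /sw exchange_big; apply: eq_bigr => i _ /=.
  rewrite [S _ in LHS](pure_coordE (W := H)) mulr_sumr linear_sum scaler_suml.
  apply: eq_bigr => j _; rewrite -scalerAr linearZ /= scalerA mulrC.
  by [].
rewrite {1}/sw exchange_big; apply: eq_bigr => j _.
have cl : lin (fun x => sw (D x) (fun y z => coord (vbasis fullv) j (S y) *: z)).
  solve_lin.
rewrite /X (sw_lin _ _ cl); apply: eq_bigr => i _.
by rewrite (linZ cl) sw_scale.
Qed.

(** The map h |-> t(h -) is injective, hence onto the dual by dimension. [F] records the functional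
    t(h -) as the vector of its values on the basis, so that it is an endomorphism of H. *)
Lemma integral_surjective (f : dual) : exists h, forall g, t (h * g) = f g.
Proof.
pose F h : H := \sum_j 't (h * bas j) *: bas j.
have Fl : lin F by rewrite /F; solve_lin.
have [h] : exists h, F h = \sum_j (f (bas j) : k) *: bas j.
  have : (\sum_j (f (bas j) : k) *: bas j) \in limg (linfun F).
    rewrite lker0_limgf ?memvf //; apply/lker0P => x y; rewrite !(linfunE Fl) => Fxy.
    apply/eqP; rewrite -subr_eq0; apply/eqP/integral_nondegenerate => g.
    rewrite [g](pure_coordE (W := H)) mulr_sumr linear_sum big1 //= => j _.
    have /(congr1 (coord (vbasis fullv) j)) := Fxy; rewrite !coord_bas => tE.
    by rewrite -scalerAr linearZ /= mulrBl linearB /= tE subrr scaler0.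
  by case/memv_imgP=> h _ ->; exists h; rewrite (linfunE Fl).
move=> Fh; exists h => g; rewrite [g](pure_coordE (W := H)) mulr_sumr !linear_sum /=.
apply: eq_bigr => j _; rewrite -scalerAr !linearZ; congr (_ *: _).
by have /(congr1 (coord (vbasis fullv) j)) := Fh; rewrite !coord_bas.
Qed.

(** With t(h -) = eps, [integral_antipoder] gives S(sum t(h_2 g) h_1) = sum t(h g_2) g_1 = g. *)
Lemma antipode_surjective g : exists h, S h = g.
Proof.
have [h hE] := integral_surjective (linfun (counit H)).
exists (sw (D h) (fun h1 h2 => 't (h2 * g) *: h1)).
rewrite (sw_lin _ _ (@lin_linear _ _ _ S)).
have := integral_antipoder g h => /esym E.
transitivity (sw (D h) (fun h1 h2 => 't (h2 * g) *: S h1)).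
  by apply: sw_ext => x y; rewrite linearZ.
rewrite E -[RHS](counitr_sw g (f := id)); solve_lin.
by apply: sw_ext => x y; rewrite hE lfunE.
Qed.

End Nondegenerate.
End Integral.

(** * Projectivity over the coinvariants *)

Section ComoduleAlgebra.
Variables (k : fieldType) (H : hopf_algebra k) (A : comodule_algebra H).
Implicit Type U : lmodType k.
Local Notation S := (antipode H).
Local Notation eps h := (counit H h : k).
Local Notation D := (comul H).

Lemma coact_sw U a (T : A -> H -> H -> U) :
  (forall h g, lin (fun b => T b h g)) -> (forall b g, lin (fun h => T b h g)) ->
  (forall b h, lin (fun g => T b h g)) ->
  sw (coact A a) (fun a0 a1 => sw (coact A a0) (fun x y => T x y a1)) =
  sw (coact A a) (fun a0 a1 => sw (D a1) (fun x y => T a0 x y)).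
Proof. exact: coassoc_sw (coactA a). Qed.

Lemma coact_counit_sw U a (f : A -> U) : lin f ->
  sw (coact A a) (fun a0 a1 => eps a1 *: f a0) = f a.
Proof.
move=> fl; rewrite -[in RHS](coact_counit a) (sw_lin _ _ fl).
by apply: sw_ext => x y; rewrite (linZ fl).
Qed.

Lemma coactM_sw U a b (F : A -> H -> U) :
  (forall h, lin (F ^~ h)) -> (forall x, lin (F x)) ->
  sw (coact A (a * b)) F =
  sw (coact A a) (fun a0 a1 => sw (coact A b) (fun b0 b1 => F (a0 * b0) (a1 * b1))).
Proof.
move=> F1 F2; rewrite coactM sw_sw //; apply: sw_ext => x y.
rewrite sw_sw //; apply: sw_ext => c d; exact: sw_pure.
Qed.

Section Trace.
Variable t : 'Hom(H, k^o).
Hypothesis tI : integral t.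

Definition trace a : A := sw (coact A a) (fun a0 a1 => (t a1 : k) *: a0).

Lemma trace_lin : lin trace.
Proof. by rewrite /trace; solve_lin. Qed.

(** Coassociativity gives sum a_0 ⊗ t(a_2) a_1 for the coaction, and the second integral identity
    turns this into trace(a) ⊗ 1. *)
Lemma trace_coinvariant a : coinvariant (trace a).
Proof.
apply/eqP; rewrite /trace (sw_lin _ _ (@lin_linear _ _ _ (coact A))).
transitivity (sw (coact A a) (fun a0 a1 => sw (coact A a0) (fun x y => (t a1 : k) *: pure x y))).
  by apply: sw_ext => x y; rewrite linearZ /= {1}[coact A x]tens_sw sw_scale.
rewrite (coact_sw a (T := fun x y z => (t z : k) *: pure x y)); solve_lin.
rewrite (sw_lin _ _ (f := fun a => pure a 1)); solve_lin.
apply: sw_ext => x y; rewrite pureZl -pureZr -tI.2.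
rewrite (sw_lin _ _ (f := fun v => pure x v)); solve_lin.
by apply: sw_ext => u v; rewrite pureZr.
Qed.

Lemma traceM a (b : coinv A) : trace (a * val b) = trace a * val b.
Proof.
rewrite /trace coactM_sw; solve_lin; rewrite sw_mull; apply: sw_ext => x y.
have /eqP -> : coinvariant (val b) by exact: (valP b).
by rewrite sw_pureE; solve_lin; rewrite mulr1 scalerAl.
Qed.

(* The pairs (x, t(y -)), for can(sum x ⊗ y) = 1 ⊗ h, form a dual basis of A *)
(* as a right B-module. *)
Lemma trace_dual_basis (h : H) (s : seq (A * A)) :
  (forall g, t (h * g) = counit H g) -> formal_can s = pure 1 h ->
  forall a, \sum_(p <- s) p.1 * trace (p.2 * a) = a.
Proof.
move=> th sh a.
pose F (u : A) (h : H) := sw (coact A a) (fun a0 a1 => (t (h * a1) : k) *: (u * a0)).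
have F1 v : lin (F ^~ v) by rewrite /F; solve_lin.
have F2 v : lin (F v) by rewrite /F; solve_lin.
have := congr1 (fun z => sw z F) sh.
rewrite sw_pureE // {2}/F => E; rewrite -[RHS]coact_counit.
transitivity (sw (formal_can s) F); last first.
  by rewrite E; apply: sw_ext => x y; rewrite th mul1r.
rewrite /formal_can (lin_sum _ _ _ (f := fun z => sw z F)); solve_lin.
apply: eq_bigr => p _; rewrite sw_sw //.
rewrite /trace coactM_sw; solve_lin.
rewrite sw_mulr; apply: sw_ext => x y; rewrite sw_pureE // /F sw_mulr.
by apply: sw_ext => u v; rewrite -scalerAr mulrA.
Qed.

End Trace.

Lemma formal_can_surjective (z : tens A H) : is_galois A -> exists s, formal_can s = z.
Proof. by case=> f _ cK; exists (repr (f z)); rewrite -[RHS]cK. Qed.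

Lemma formal_can_injective (s s' : seq (A * A)) : is_galois A ->
  formal_can s = formal_can s' -> bal_rel (@coinvariant k H A) s s'.
Proof.
case=> f fK _; rewrite -!can_mapE => /(can_inj fK) /eqP.
by rewrite eqmodE => /asboolP.
Qed.

End ComoduleAlgebra.

(** * Coinduction Hom_B(A, N) *)

Section Coinduction.
Variables (k : fieldType) (H : hopf_algebra k) (A : comodule_algebra H).
Variable N : rmodule (coinv A : algType k).

(** The right B-linear maps A -> N. They form a right A-module through left multiplication on the
    argument, the right adjoint of restriction. *)
Definition coind_pred : {pred A -> N} := fun f =>
  `[< lin f /\ forall x (b : coinv A), f (x * val b) = ract (f x) b >].

Lemma coind_closed : GRing.subsemimod_closed coind_pred.
Proof.
split; [split|].
- apply/asboolP; split=> [a x y|x b]; first by rewrite scaler0 addr0.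
  by rewrite ract0.
- move=> f g /asboolP[fl fb] /asboolP[gl gb]; apply/asboolP; split=> [a x y|x b].
    by rewrite addrfctE /= fl gl scalerDr addrACA.
  by rewrite addrfctE /= fb gb ractD.
- move=> c f /asboolP[fl fb]; apply/asboolP; split=> [a x y|x b].
    by rewrite scalrfctE /= fl scalerDr !scalerA mulrC.
  by rewrite scalrfctE /= fb ractZ.
Qed.

Let C := subspace_of coind_closed.
Lemma coind_actP (f : C) a : (fun x => val f (a * x)) \in coind_pred.
Proof.
have /asboolP[fl fb] := valP f; apply/asboolP; split=> [c x y|x b].
  by rewrite mulrDr -scalerAr fl.
by rewrite mulrA fb.
Qed.
Let cact (f : C) a : C := Subspace coind_closed (coind_actP f a).
Let cactE f a x : val (cact f a) x = val f (a * x). Proof. by []. Qed.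
Lemma cact_linearl a : linear (cact ^~ a).
Proof.
move=> c u v; apply: val_inj; apply/funext => x.
by rewrite cactE !GRing.valD !GRing.valZ.
Qed.
Lemma cact_linearr f : linear (cact f).
Proof.
move=> c u v; apply: val_inj; apply/funext => x.
rewrite !GRing.valD !GRing.valZ cactE; have /asboolP[fl _] := valP f.
by rewrite mulrDl -scalerAl fl.
Qed.
Lemma cact1 f : cact f 1 = f.
Proof. by apply: val_inj; apply/funext => x; rewrite cactE mul1r. Qed.
Lemma cactM f a b : cact (cact f a) b = cact f (a * b).
Proof. by apply: val_inj; apply/funext => x; rewrite !cactE mulrA. Qed.
Definition coind : rmodule A := RModule cact_linearl cact_linearr cact1 cactM.

Definition coind_val (f : coind) : A -> N := val (f : C).

Definition coind_fun (f : A -> N) (fP : lin f /\ forall x b, f (x * val b) = ract (f x) b) :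
  coind := Subspace coind_closed (asboolT fP).

Lemma coind_valP (f : coind) :
  lin (coind_val f) /\ forall x b, coind_val f (x * val b) = ract (coind_val f x) b.
Proof. exact: asboolW (valP (f : C)). Qed.

Lemma coind_val_inj (f g : coind) : (forall x, coind_val f x = coind_val g x) -> f = g.
Proof. by move=> fg; apply: val_inj; apply/funext. Qed.

Lemma coind_val_linear c (f g : coind) x :
  coind_val (c *: f + g) x = c *: coind_val f x + coind_val g x.
Proof. by rewrite /coind_val GRing.valD GRing.valZ. Qed.

Lemma coind_val_act (f : coind) a x : coind_val (ract f a) x = coind_val f (a * x).
Proof. by []. Qed.

End Coinduction.

Section RestrictionProjective.
Variables (k : fieldType) (H : hopf_algebra k) (A : comodule_algebra H).

(** Right exactness of Hom_B(A, -) from the dual basis of pairs (x, tr(y -)): arbitrary preimages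
    m(x) of the values f(x) define the B-linear lift z |-> sum m(x) tr(y z). *)
Lemma coind_surjective (t : 'Hom(H, k^o)) (h : H) (s : seq (A * A))
    (M N : rmodule (coinv A : algType k)) (g : M -> N) :
  integral t -> (forall g, t (h * g) = counit H g) -> formal_can s = pure 1 h ->
  rlinear g -> (forall y, exists x, g x = y) ->
  forall f : coind N, exists f' : coind M, forall x, g (coind_val f' x) = coind_val f x.
Proof.
move=> tI th sh gl gs f.
pose m a := projT1 (cid (gs (coind_val f a))).
have mE a : g (m a) = coind_val f a by rewrite /m; case: cid.
pose tr a : coinv A := Coinv (trace_coinvariant tI a).
have trl : lin tr.
  by move=> a x y; apply: val_inj; rewrite GRing.valD GRing.valZ /= trace_lin.
have trM x b : tr (x * val b) = tr x * b.
  by apply: val_inj; rewrite GRing.valM /= traceM.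
have [fl fb] := coind_valP f.
pose f' a := \sum_(p <- s) ract (m p.1) (tr (p.2 * a)).
have f'P : lin f' /\ forall x b, f' (x * val b) = ract (f' x) b.
  split=> [c x y|x b].
    rewrite /f' scaler_sumr -big_split; apply: eq_bigr => p _ /=.
    by rewrite mulrDr -scalerAr trl ract_linearr.
  have rl : lin (fun x : M => ract x b) by solve_lin.
  rewrite /f' (lin_sum _ _ _ rl); apply: eq_bigr => p _.
  by rewrite mulrA trM ractM.
exists (coind_fun f'P) => x; rewrite /coind_val /= /f' (lin_sum _ _ _ gl.1).
rewrite -[in RHS](trace_dual_basis th sh x) -/(coind_val f) (lin_sum _ _ _ fl).
by apply: eq_bigr => p _; rewrite gl.2 mE -fb.
Qed.

(* Hom_B(P, -) = Hom_A(P, Hom_B(A, -)), and Hom_B(A, -) is right exact. *)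
Lemma restr_rprojective (P : rmodule A) :
  cosemisimple H -> is_galois A -> rprojective P -> rprojective (restr P).
Proof.
move=> /cosemisimple_integral[t t1 tI] Ag Pp M N g f gl gs fl.
have [h hE] := integral_surjective t1 tI (linfun (counit H)).
have th x : t (h * x) = counit H x by rewrite hE lfunE.
have [s sh] := formal_can_surjective (pure 1 h) Ag.
pose G (u : coind M) : coind N := coind_fun (conj
  (lin_comp gl.1 (coind_valP u).1)
  (fun x b => etrans (congr1 g ((coind_valP u).2 x b)) (gl.2 _ _))).
have GE u x : coind_val (G u) x = g (coind_val u x) by [].
have FP (p : P) : lin (fun x => f (ract p x)) /\
    forall x (b : coinv A), f (ract p (x * val b)) = ract (f (ract p x)) b.
  split; last by move=> x b; rewrite -ractM (fl.2 (ract p x) b).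
  exact: lin_comp fl.1 (@ract_linearr _ _ P p).
pose F p : coind N := coind_fun (FP p).
have FE p x : coind_val (F p) x = f (ract p x) by [].
have [||| L Ll LE] := Pp (coind M) (coind N) G F.
- split=> [c u v|u a]; apply: coind_val_inj => x.
    by rewrite GE !coind_val_linear !GE gl.1.
  by rewrite GE !coind_val_act GE.
- move=> u; have [u' uE] := coind_surjective tI th sh gl gs u.
  by exists u'; apply: coind_val_inj.
- split=> [c u v|u a]; apply: coind_val_inj => x.
    by rewrite coind_val_linear !FE ract_linearl fl.1.
  by rewrite coind_val_act !FE ractM.
(* The adjunction turns the lift L into the B-linear map x |-> L(x)(1). *)
exists (fun x => coind_val (L x) 1).
  split=> [c u v|u b]; first by rewrite Ll.1 coind_val_linear.
  have /= -> := Ll.2 u (val b).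
  by rewrite coind_val_act mulr1 -(coind_valP _).2 mul1r.
by move=> x; rewrite -GE LE FE ract1.
Qed.

End RestrictionProjective.

(** * Hopf modules *)

Section HopfModule.
Variables (k : fieldType) (H : hopf_algebra k) (A : comodule_algebra H).
Implicit Type U : lmodType k.
Local Notation S := (antipode H).
Local Notation eps h := (counit H h : k).
Local Notation D := (comul H).
Local Notation dual := 'Hom(H, k^o).

Section Coaction.
Variable M : hopf_module A.
Local Notation rho := (hcoact M).

Lemma hcoact_sw U m (T : M -> H -> H -> U) :
  (forall h g, lin (fun b => T b h g)) -> (forall b g, lin (fun h => T b h g)) ->
  (forall b h, lin (fun g => T b h g)) ->
  sw (rho m) (fun m0 m1 => sw (rho m0) (fun x y => T x y m1)) =
  sw (rho m) (fun m0 m1 => sw (D m1) (fun x y => T m0 x y)).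
Proof. exact: coassoc_sw (hcoactA m). Qed.

Lemma hcoact_counit_sw U m (f : M -> U) : lin f ->
  sw (rho m) (fun a0 a1 => eps a1 *: f a0) = f m.
Proof.
move=> fl; rewrite -[in RHS](hcoact_counit m) (sw_lin _ _ fl).
by apply: sw_ext => x y; rewrite (linZ fl).
Qed.

Lemma hcoact_ract_sw U m a (F : M -> H -> U) :
  (forall h, lin (F ^~ h)) -> (forall x, lin (F x)) ->
  sw (rho (ract m a)) F =
  sw (rho m) (fun m0 m1 => sw (coact A a) (fun a0 a1 => F (ract m0 a0) (m1 * a1))).
Proof.
move=> F1 F2; rewrite hcoact_ract sw_sw //; apply: sw_ext => x y.
rewrite sw_sw //; apply: sw_ext => c d; exact: sw_pure.
Qed.

Lemma dual_act_linr (a : dual) : lin (@dual_act _ _ _ M a).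
Proof. by rewrite /dual_act; solve_lin. Qed.

Lemma dual_act_linl (m : M) : lin (fun a : dual => dual_act a m).
Proof.
rewrite /dual_act => c a b; rewrite sw_scale /sw -big_split; apply: eq_bigr => i _ /=.
by rewrite add_lfunE scale_lfunE scalerDl scalerA.
Qed.

Lemma dual_mulE (a b : dual) h :
  dual_mul a b h = sw (D h) (fun h1 h2 => (a h1 : k) * (b h2 : k)).
Proof.
rewrite /dual_mul linfunE //; solve_lin.
Qed.

Lemma dual_act_mul (a b : dual) (m : M) :
  dual_act (dual_mul a b) m = dual_act a (dual_act b m).
Proof.
rewrite /dual_act (sw_lin _ _ (f := fun x => sw (rho x) (fun m0 m1 => (a m1 : k) *: m0)));
  solve_lin.
transitivity (sw (rho m) (fun m0 m1 => sw (rho m0) (fun x y =>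
   (b m1 : k) *: ((a y : k) *: x)))); last first.
  apply: sw_ext => x y.
  by rewrite (linZ (f := fun x => sw (rho x) (fun m0 m1 => (a m1 : k) *: m0))) ?sw_scale;
    solve_lin.
rewrite (hcoact_sw m (T := fun x y z => (b z : k) *: ((a y : k) *: x))); solve_lin.
apply: sw_ext => x y; rewrite dual_mulE /sw scaler_suml; apply: eq_bigr => i _.
by rewrite scalerA mulrC.
Qed.

Lemma dual_act_one (m : M) : dual_act (dual_one H) m = m.
Proof.
rewrite /dual_act -[RHS](hcoact_counit m); apply: sw_ext => x y.
by rewrite /dual_one lfunE.
Qed.

Lemma dual_act_coinv (a : dual) (m : M) (b : coinv A) :
  dual_act a (ract m (val b)) = ract (dual_act a m) (val b).
Proof.
rewrite /dual_act hcoact_ract_sw; solve_lin.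
rewrite (sw_lin _ _ (f := fun x : M => ract x (val b))); solve_lin.
apply: sw_ext => x y; have /eqP -> : coinvariant (val b) by exact: (valP b).
rewrite sw_pureE; solve_lin; rewrite mulr1.
by rewrite (linZ (f := fun x : M => ract x (val b))); solve_lin.
Qed.

End Coaction.

Lemma colinear_sw (M N : hopf_module A) U (f : M -> N) m (F : N -> H -> U) :
  colinear f -> (forall h, lin (F ^~ h)) -> (forall x, lin (F x)) ->
  sw (hcoact N (f m)) F = sw (hcoact M m) (fun m0 m1 => F (f m0) m1).
Proof. by move=> fc F1 F2; rewrite fc sw_sw //; apply: sw_ext => x y; rewrite sw_pureE. Qed.

Lemma dual_act_colinear (M N : hopf_module A) (f : M -> N) (a : dual) m :
  colinear f -> lin f -> dual_act a (f m) = f (dual_act a m).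
Proof.
move=> fc fl; rewrite /dual_act colinear_sw //; solve_lin.
by rewrite (sw_lin _ _ fl); apply: sw_ext => x y; rewrite (linZ fl).
Qed.

Definition dual_bas (j : 'I_(\dim (fullv : {vspace H}))) : dual :=
  linfun (fun h : H => coord (vbasis fullv) j h : k^o).

Lemma dual_basE j h : dual_bas j h = coord (vbasis fullv) j h.
Proof. by rewrite /dual_bas linfunE; solve_lin. Qed.

Lemma dual_expansion (a : dual) : a = \sum_j (a (bas j) : k) *: dual_bas j.
Proof.
apply/lfunP => h; rewrite sum_lfunE [in LHS](pure_coordE (W := H) h) linear_sum.
apply: eq_bigr => j _; rewrite linearZ scale_lfunE dual_basE; exact: mulrC.
Qed.

Lemma dual_comul_sw U (a : dual) (F : dual -> dual -> U) :
  (forall b, lin (F ^~ b)) -> (forall b, lin (F b)) ->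
  sw (dual_comul a) F = \sum_j F (linfun (fun g : H => a (g * bas j))) (dual_bas j).
Proof.
move=> F1 F2; rewrite /dual_comul (lin_sum _ _ _ (f := fun x => sw x F)); solve_lin.
by apply: eq_bigr => j _; rewrite sw_pureE.
Qed.

Section Conjugation.
Variables M N : hopf_module A.

(** The action of [fam_act] on a single component, for Hopf modules outside any complex. *)
Definition conj_act (a : dual) (f : M -> N) (x : M) : N :=
  sw (dual_comul a) (fun a1 a2 => dual_act a1 (f (dual_act (dual_antipode a2) x))).

Variable f : M -> N.
Hypothesis fl : rlinear f.
Let fl1 : lin f. Proof. exact: fl.1. Qed.

(** Removes the basis hidden in [dual_comul]: summing over it reassembles S(x_1). Linearity in each
    argument and A-linearity are read off this form. *)
Lemma conj_actE a x : conj_act a f x =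
  sw (hcoact M x) (fun x0 x1 => sw (hcoact N (f x0)) (fun y0 y1 =>
    (a (y1 * S x1) : k) *: y0)).
Proof.
have dl := @dual_act_linl.
rewrite /conj_act dual_comul_sw.
- rewrite [RHS]/sw; transitivity (\sum_j sw (hcoact M x) (fun x0 x1 =>
     sw (hcoact N (f x0)) (fun y0 y1 =>
       (a (y1 * bas j) : k) *: (coord (vbasis fullv) j (S x1) *: y0)))).
    apply: eq_bigr => j _; rewrite {2}/dual_act (sw_lin _ _ fl1).
    rewrite (sw_lin _ _ (@dual_act_linr _ _)); apply: sw_ext => x0 x1.
    rewrite (linZ fl1) (linZ (@dual_act_linr _ _)) /dual_act sw_scale; apply: sw_ext => y0 y1.
    rewrite /dual_antipode linfunE; solve_lin; rewrite dual_basE linfunE; solve_lin.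
    by rewrite !scalerA mulrC.
  rewrite /sw exchange_big; apply: eq_bigr => i _; rewrite exchange_big.
  apply: eq_bigr => i' _ /=.
  rewrite [S _ in RHS](pure_coordE (W := H)) mulr_sumr linear_sum scaler_suml.
  apply: eq_bigr => j _; rewrite -scalerAr (linZ (@lin_linear _ _ _ a)) scalerA; congr (_ *: _).
  exact: mulrC.
- by move=> b; exact: dl.
- move=> b; apply: (lin_comp (f := dual_act b) (g := fun b' => f (dual_act (dual_antipode b') x))).
    exact: dual_act_linr.
  apply: (lin_comp fl1 (g := fun b' => dual_act (dual_antipode b') x)).
  apply: (lin_comp (f := fun b' => dual_act b' x) (g := @dual_antipode _ H)); first exact: dl.
  move=> c u v; apply/lfunP => h; rewrite /dual_antipode add_lfunE scale_lfunE.
  rewrite !linfunE; solve_lin.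
  by rewrite /= scale_lfunE.
Qed.

Lemma conj_act_lin a : lin (conj_act a f).
Proof.
have -> : conj_act a f = fun x => sw (hcoact M x) (fun x0 x1 => sw (hcoact N (f x0)) (fun y0 y1 =>
    (a (y1 * S x1) : k) *: y0)) by apply/funext => x; exact: conj_actE.
by solve_lin.
Qed.

Lemma conj_act_linl x : lin (fun a : dual => conj_act a f x).
Proof.
move=> c a b; rewrite !conj_actE sw_scale /sw -big_split; apply: eq_bigr => i _ /=.
rewrite scaler_sumr -big_split; apply: eq_bigr => j _ /=.
by rewrite add_lfunE scale_lfunE scalerDl scalerA.
Qed.

(** Acting by c in A inserts c_1 S(c_2) between y_1 and S(x_1), as the antipode reverses products;
    the antipode axiom collapses it and leaves c acting on the result. *)
Lemma conj_act_rlinear a : rlinear (conj_act a f).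
Proof.
split=> [|x c]; first exact: conj_act_lin.
rewrite !conj_actE hcoact_ract_sw; solve_lin.
rewrite (sw_lin _ _ (f := fun y : N => ract y c)); solve_lin.
apply: sw_ext => x0 x1.
transitivity (sw (coact A c) (fun c0 c1 => sw (coact A c0) (fun d0 d1 =>
   sw (hcoact N (f x0)) (fun y0 y1 => (a (y1 * d1 * S c1 * S x1) : k) *: ract y0 d0)))).
  apply: sw_ext => c0 c1; rewrite fl.2 hcoact_ract_sw; solve_lin.
  rewrite sw_exchange; apply: sw_ext => d0 d1; apply: sw_ext => y0 y1.
  by rewrite antipodeM !mulrA.
rewrite (coact_sw c (T := fun u v w => sw (hcoact N (f x0)) (fun y0 y1 =>
  (a (y1 * v * S w * S x1) : k) *: ract y0 u))); solve_lin.
transitivity (sw (coact A c) (fun c0 c1 => eps c1 *: sw (hcoact N (f x0)) (fun y0 y1 =>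
  (a (y1 * S x1) : k) *: ract y0 c0))).
  apply: sw_ext => c0 c1.
  rewrite -[y in eps c1 *: y](_ : sw (hcoact N (f x0)) (fun y0 y1 =>
    (a (y1 * 1 * S x1) : k) *: ract y0 c0) = _); last by apply: sw_ext => y0 y1; rewrite mulr1.
  rewrite -(antipoder_sw c1 (f := fun h => sw (hcoact N (f x0)) (fun y0 y1 =>
    (a (y1 * h * S x1) : k) *: ract y0 c0))); solve_lin.
  by apply: sw_ext => v w; apply: sw_ext => y0 y1; rewrite !mulrA.
rewrite (coact_counit_sw c (f := fun c => sw (hcoact N (f x0)) (fun y0 y1 =>
  (a (y1 * S x1) : k) *: ract y0 c))); solve_lin.
rewrite (sw_lin _ _ (f := fun y : N => ract y c)); solve_lin.
by apply: sw_ext => y0 y1; rewrite (linZ (f := fun y : N => ract y c)); solve_lin.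
Qed.

(* sum a_(1) f S(a_(2)) a_(3) = a f *)
Lemma conj_act_dual_act a x :
  sw (dual_comul a) (fun a1 a2 => conj_act a1 f (dual_act a2 x)) = dual_act a (f x).
Proof.
rewrite dual_comul_sw.
- transitivity (\sum_j sw (hcoact M x) (fun y0 y1 => sw (hcoact M y0) (fun x0 x1 =>
     sw (hcoact N (f x0)) (fun z0 z1 =>
       (a (z1 * S x1 * bas j) : k) *: (coord (vbasis fullv) j y1 *: z0))))).
    apply: eq_bigr => j _; rewrite {1}/dual_act (sw_lin _ _ (@conj_act_lin _)).
    apply: sw_ext => y0 y1; rewrite (linZ (@conj_act_lin _)) conj_actE sw_scale.
    apply: sw_ext => x0 x1; rewrite sw_scale; apply: sw_ext => z0 z1.
    by rewrite dual_basE linfunE ?scalerA 1?mulrC; solve_lin.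
  transitivity (sw (hcoact M x) (fun y0 y1 => sw (hcoact M y0) (fun x0 x1 =>
     sw (hcoact N (f x0)) (fun z0 z1 => (a (z1 * S x1 * y1) : k) *: z0)))).
    rewrite /sw exchange_big; apply: eq_bigr => i _; rewrite exchange_big.
    apply: eq_bigr => i' _; rewrite exchange_big; apply: eq_bigr => l _ /=.
    rewrite [bas i in RHS](pure_coordE (W := H)) mulr_sumr linear_sum scaler_suml.
    apply: eq_bigr => j _; rewrite -scalerAr (linZ (@lin_linear _ _ _ a)) scalerA; congr (_ *: _).
    exact: mulrC.
  rewrite (hcoact_sw x (T := fun u v w => sw (hcoact N (f u)) (fun z0 z1 =>
    (a (z1 * S v * w) : k) *: z0))); solve_lin.
  rewrite -(hcoact_counit_sw x (f := fun x => dual_act a (f x))); last first.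
    by apply: lin_comp => //; exact: dual_act_linr.
  apply: sw_ext => x0 x1.
  have -> : dual_act a (f x0) = sw (hcoact N (f x0)) (fun z0 z1 => (a (z1 * 1) : k) *: z0).
    by apply: sw_ext => z0 z1; rewrite mulr1.
  rewrite -(antipodel_sw x1 (f := fun h => sw (hcoact N (f x0)) (fun z0 z1 =>
    (a (z1 * h) : k) *: z0))); solve_lin.
  by apply: sw_ext => v w; apply: sw_ext => z0 z1; rewrite mulrA.
- by move=> b; exact: conj_act_linl.
- move=> b; apply: (lin_comp (f := conj_act b f) (g := fun b' => dual_act b' x)).
    exact: conj_act_lin.
  exact: dual_act_linl.
Qed.

End Conjugation.

End HopfModule.

(** * Galois descent: B-linear maps out of Hopf modules *)

Section GaloisDescent.
Variables (k : fieldType) (H : hopf_algebra k) (A : comodule_algebra H).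
Hypothesis H_cosemisimple : cosemisimple H.
Hypothesis A_galois : is_galois A.
Implicit Type U : lmodType k.
Local Notation S := (antipode H).
Local Notation eps h := (counit H h : k).
Local Notation D := (comul H).
Local Notation dual := 'Hom(H, k^o).
Variables (M : hopf_module A) (N : rmodule A).
Local Notation rho := (hcoact M).
Local Notation I := 'I_(\dim (fullv : {vspace dual})).

Lemma antipode_surj g : exists h, S h = g.
Proof.
have [t t1 tI] := cosemisimple_integral H_cosemisimple.
exact: antipode_surjective t1 tI g.
Qed.

(* a ⊗ a' |-> sum a_0 a' ⊗ a_1 *)
Definition formal_can' (s : seq (A * A)) : tens A H :=
  \sum_(p <- s) sw (coact A p.1) (fun a0 a1 => pure (a0 * p.2) a1).

(* a ⊗ h |-> sum a_0 ⊗ a_1 S(h) carries can to can', and 1 ⊗ h to 1 ⊗ S(h). *)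
Lemma formal_can'_surjective h : exists s, formal_can' s = pure 1 h.
Proof.
have [g <-] := antipode_surj h.
have [s sE] := formal_can_surjective (pure 1 g) A_galois.
pose F (u : A) (h : H) := sw (coact A u) (fun u0 u1 => pure u0 (u1 * S h)).
have F1 v : lin (F ^~ v) by rewrite /F; solve_lin.
have F2 v : lin (F v) by rewrite /F; solve_lin.
exists s; have := congr1 (fun z => sw z F) sE.
rewrite sw_pureE // {2}/F coact1 sw_pureE; solve_lin; rewrite mul1r => <-.
rewrite /formal_can (lin_sum _ _ _ (f := fun z => sw z F)); solve_lin.
apply: eq_bigr => p _; rewrite sw_sw //.
transitivity (sw (coact A p.2) (fun b0 b1 => sw (coact A b0) (fun x y =>
  sw (coact A p.1) (fun a0 a1 => pure (a0 * x) (a1 * y * S b1))))); last first.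
  apply: sw_ext => b0 b1; rewrite sw_pureE // /F coactM_sw; solve_lin.
  by rewrite sw_exchange.
rewrite (coact_sw p.2 (T := fun x y z => sw (coact A p.1) (fun a0 a1 => pure (a0 * x) (a1 * y * S z))));
  solve_lin.
rewrite -[in LHS](coact_counit_sw p.2 (f := fun b => sw (coact A p.1) (fun a0 a1 => pure (a0 * b) a1)));
  solve_lin.
apply: sw_ext => b0 b1; rewrite sw_exchange sw_scale; apply: sw_ext => a0 a1.
rewrite -{1}[a1]mulr1 -(antipoder_sw b1 (f := fun h => pure (a0 * b0) (a1 * h))); solve_lin.
by apply: sw_ext => x y; rewrite mulrA.
Qed.

(** The image of sum f_a # e_a under f # a |-> (m |-> f(a m)). *)
Definition smash_map (f : I -> M -> N) (m : M) : N := \sum_a f a (dual_act (bas a : dual) m).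

(* If sum f_a(m_0) a(m_1) = 0 for all m, then replacing m by m x, multiplying by *)
(* y and using sum x_0 y ⊗ x_1 = 1 ⊗ h gives sum f_a(m_0) a(m_1 h) = 0 for all h; *)
(* with S(m_2) h in place of h this becomes sum f_a(m) a(h) = 0. *)
Lemma smash_map_inj (f : I -> M -> N) :
  (forall a, rlinear (f a)) -> (forall m, smash_map f m = 0) -> forall a m, f a m = 0.
Proof.
move=> fl f0.
(* K encodes the whole family: A-linear in m, linear in h, and the hypothesis reads sum K(m_0, m_1)
   = 0. The goal becomes K = 0. *)
pose K m h := \sum_a ((bas a : dual) h : k) *: f a m.
have flin a : lin (f a) by exact: (fl a).1.
have K1 h : lin (K ^~ h) by rewrite /K; solve_lin.
have K2 m : lin (K m) by rewrite /K; solve_lin.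
have KA m h a : K (ract m a) h = ract (K m h) a.
  rewrite /K (lin_sum _ _ _ (f := fun x : N => ract x a)); solve_lin.
  by apply: eq_bigr => i _; rewrite (fl i).2 ractZ.
have K0 m : sw (rho m) K = 0.
  rewrite -(f0 m) /smash_map /sw /K exchange_big; apply: eq_bigr => a _.
  rewrite /dual_act (sw_lin _ _ (flin a)); apply: eq_bigr => i _.
  by rewrite (linZ (flin a)).
pose T m (u : A) (h : H) := sw (rho m) (fun m0 m1 => ract (K m0 (m1 * h)) u).
have T1 m h : lin (fun u => T m u h) by rewrite /T; solve_lin.
have T2 m u : lin (T m u) by rewrite /T; solve_lin.
have T0 m h : sw (rho m) (fun m0 m1 => K m0 (m1 * h)) = 0.
  have [s sE] := formal_can'_surjective h.
  transitivity (sw (pure 1 h) (T m)).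
    by rewrite sw_pureE // /T; apply: sw_ext => x y; rewrite ract1.
  rewrite -sE /formal_can' (lin_sum _ _ _ (f := fun z => sw z (T m))); solve_lin.
  apply: big1 => p _; rewrite sw_sw //.
  transitivity (ract (sw (rho (ract m p.1)) K) p.2); last by rewrite K0 ract0.
  rewrite hcoact_ract_sw // (sw_lin _ _ (f := fun x : N => ract x p.2)); solve_lin.
  transitivity (sw (coact A p.1) (fun a0 a1 => T m (a0 * p.2) a1)).
    by apply: sw_ext => a0 a1; rewrite sw_pureE.
  rewrite /T sw_exchange; apply: sw_ext => m0 m1.
  rewrite (sw_lin _ _ (f := fun x : N => ract x p.2)); solve_lin.
  by apply: sw_ext => a0 a1; rewrite KA ractM.
have Kz m h : K m h = 0.
  rewrite -(hcoact_counit_sw m (f := K ^~ h)) //.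
  transitivity (sw (rho m) (fun m0 m1 => sw (D m1) (fun x y => K m0 (x * S y * h)))).
    apply: sw_ext => m0 m1; rewrite (antipoder_sw m1 (f := fun x => K m0 (x * h))); solve_lin.
    by rewrite mul1r.
  rewrite -(hcoact_sw m (T := fun x y z => K x (y * S z * h))); solve_lin.
  rewrite /sw big1 // => i _.
  transitivity (sw (rho (rho m i)) (fun m0 m1 => K m0 (m1 * (S (bas i) * h)))).
    by apply: eq_bigr => j _; rewrite mulrA.
  exact: T0.
(* Vanishing of K on the basis of H says that sum f_a(m) ⊗ e_a is zero in N ⊗ H^*, and its
   coordinates are the f_a(m). *)
move=> a m; pose z : tens N dual := [ffun a => f a m].
suff z0 : z = 0 by have := congr1 (fun z : tens N dual => z a) z0; rewrite !ffunE.
have E i : pure (z i) (bas i : dual) =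
    \sum_j (pure (((bas i : dual) (bas j) : k) *: z i) (dual_bas j) : tens N dual).
  rewrite [X in pure _ X]dual_expansion (lin_sum _ _ _ (f := pure (z i))); solve_lin.
  by apply: eq_bigr => j _; rewrite pureZr pureZl.
rewrite [z]tens_sw /sw (eq_bigr _ (fun i _ => E i)) exchange_big big1 //= => j _.
rewrite -(lin_sum _ _ _ (f := fun v => pure v (dual_bas j))); solve_lin.
transitivity (pure (K m (bas j)) (dual_bas j)).
  by congr pure; apply: eq_bigr => i _; rewrite ffunE.
by rewrite Kz (lin0 (f := fun v => pure v _)); solve_lin.
Qed.

(** A surjective endomorphism of a finite dimensional space is injective. The last identity follows
    by applying S, which turns S'(h_2) h_1 into S(h_1) h_2. *)
Lemma antipode_inverse : exists S' : H -> H,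
  [/\ lin S', forall h, S (S' h) = h & forall h, sw (D h) (fun h1 h2 => S' h2 * h1) = eps h *: 1].
Proof.
pose S' h := projT1 (cid (antipode_surj h)).
have S'K h : S (S' h) = h by rewrite /S'; case: cid.
have Sl : lin (S : H -> H) by solve_lin.
have Si : injective S.
  have /lker0P inj : lker (linfun S) == 0%VS.
    have : limg (linfun S) = fullv.
      apply/eqP; rewrite eqEsubv subvf; apply/subvP => h _; rewrite -(S'K h).
      by rewrite -(lfunE S) memv_img ?memvf.
    move=> im; have := limg_ker_dim (linfun S) fullv; rewrite im capfv => /eqP.
    by rewrite -[X in _ == X]add0n eqn_add2r dimv_eq0.
  by move=> x y xy; apply: inj; rewrite !lfunE.
have S1 : S 1 = 1.
  have := antipodel (1 : H); rewrite comul1 sw_pureE; solve_lin.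
  by rewrite mulr1 counit1 scale1r.
exists S'; split=> // [c x y|h]; apply: Si; first by rewrite S'K Sl !S'K.
rewrite (sw_lin _ _ Sl) (linZ Sl) S1 -antipodel; apply: sw_ext => x y.
by rewrite antipodeM S'K.
Qed.

Section Surjectivity.
Variable F : M -> N.
Hypothesis Fl : lin F.
Hypothesis FB : forall m (b : coinv A), F (ract m (val b)) = ract (F m) (val b).

Let G m (s : seq (A * A)) := \sum_(p <- s) ract (F (ract m p.1)) p.2.

(** The expression F(m l) r is balanced over B because F is B-linear, so it descends to A ⊗_B A. *)
Lemma bal_rel_sum m s s' : bal_rel (@coinvariant k H A) s s' -> G m s = G m s'.
Proof.
rewrite /G; elim=> {s s'}.
- by [].
- by move=> s t _ ->.
- by move=> s t u _ -> _ ->.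
- by move=> s s' t t' _ IHs _ IHt; rewrite !big_cat /= IHs IHt.
- by move=> s t; rewrite !big_cat /= addrC.
- move=> y; rewrite big_seq1 big_nil /=.
  by rewrite (lin0 (f := fun x => ract (F (ract m x)) y)); solve_lin.
- move=> x x' y; rewrite !big_cons !big_nil !addr0 /=.
  by rewrite (linD (f := fun x => ract (F (ract m x)) y)); solve_lin.
- move=> x y y'; rewrite !big_cons !big_nil !addr0 /=.
  by rewrite (linD (f := fun y => ract (F (ract m x)) y)); solve_lin.
- move=> x b y bS; rewrite !big_seq1 /= -!ractM.
  by rewrite (FB (ract m x) (Coinv bS)).
Qed.

Let ch (z : tens A H) := projT1 (cid (formal_can_surjective z A_galois)).
Let chE z : formal_can (ch z) = z. Proof. by rewrite /ch; case: cid. Qed.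

(* m ⊗ z |-> F(m l) r, for z = can(l ⊗ r) *)
Let g m z := G m (ch z).

(** Injectivity of can: the value does not depend on the chosen preimage of z. *)
Let gE m z s : formal_can s = z -> g m z = G m s.
Proof. by move=> sz; apply: bal_rel_sum; apply: formal_can_injective => //; rewrite chE. Qed.

Let g_linl z : lin (g ^~ z).
Proof.
move=> c x y; rewrite /g /G scaler_sumr -big_split; apply: eq_bigr => p _ /=.
by rewrite (_ : lin (fun m => ract (F (ract m p.1)) p.2)); solve_lin.
Qed.

Let g_linr m : lin (g m).
Proof.
move=> c x y; rewrite (@gE m _ ([seq (c *: p.1, p.2) | p <- ch x] ++ ch y)).
  rewrite /G big_cat big_map /= scaler_sumr; congr (_ + _).
  apply: eq_bigr => p _; rewrite (linZ (f := fun u => ract (F (ract m u)) p.2)) //; solve_lin.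
rewrite /formal_can big_cat big_map /= -!/(formal_can _) chE; congr (_ + _).
rewrite -[in RHS](chE x) scaler_sumr; apply: eq_bigr => p _.
by rewrite sw_scale; apply: sw_ext => u v; rewrite -scalerAl pureZl.
Qed.

(** Because can(a l ⊗ r) = a can(l ⊗ r), a preimage of 1 ⊗ h multiplied by a on the left is a
    preimage of a ⊗ h. *)
Let g_ract m a h : g (ract m a) (pure 1 h) = g m (pure a h).
Proof.
rewrite (@gE m _ [seq (a * p.1, p.2) | p <- ch (pure 1 h)]).
  by rewrite /g /G big_map; apply: eq_bigr => p _ /=; rewrite ractM.
rewrite /formal_can big_map /=.
transitivity (sw (formal_can (ch (pure 1 h))) (fun u h => pure (a * u) h)).
  rewrite /formal_can (lin_sum _ _ _ (f := fun z => sw z (fun u h => pure (a * u) h)));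
    solve_lin.
  apply: eq_bigr => p _; rewrite sw_sw; solve_lin; apply: sw_ext => x y.
  by rewrite sw_pureE; solve_lin; rewrite mulrA.
by rewrite chE sw_pureE; solve_lin; rewrite mulr1.
Qed.

(** Because can(l ⊗ r a) is can(l ⊗ r) times the coaction of a. *)
Let g_ractr m a h :
  ract (g m (pure 1 h)) a = sw (coact A a) (fun a0 a1 => g m (pure a0 (h * a1))).
Proof.
have E : ract (g m (pure 1 h)) a = G m [seq (p.1, p.2 * a) | p <- ch (pure 1 h)].
  rewrite /g /G big_map (lin_sum _ _ _ (f := fun x : N => ract x a)); solve_lin.
  by apply: eq_bigr => p _ /=; rewrite ractM.
rewrite E -(sw_lin _ _ (@g_linr m)); apply/esym/gE.
rewrite /formal_can big_map /=.
pose T (u : A) (h : H) := sw (coact A a) (fun a0 a1 => pure (u * a0) (h * a1)).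
transitivity (sw (formal_can (ch (pure 1 h))) T).
  rewrite /formal_can (lin_sum _ _ _ (f := fun z => sw z T)); rewrite /T; solve_lin.
  apply: eq_bigr => p _; rewrite sw_sw; solve_lin; rewrite coactM_sw; solve_lin.
  apply: sw_ext => x y; rewrite sw_pureE; solve_lin.
  by apply: sw_ext => u v; rewrite mulrA.
rewrite chE sw_pureE; rewrite /T; solve_lin.
by apply: sw_ext => x y; rewrite mul1r.
Qed.

(* f_h(m) = sum F(m_0 l) r with can(l ⊗ r) = 1 ⊗ h m_1 is A-linear in m, and *)
(* F(m) = sum f_{S^-1(m_1)}(m_0) because sum S^-1(m_2) m_1 = eps(m). *)
Lemma smash_map_surj : exists2 f : I -> M -> N,
  (forall a, rlinear (f a)) & forall m, F m = smash_map f m.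
Proof.
have [S' [S'l S'K S'E]] := antipode_inverse.
pose phi h m := sw (rho m) (fun m0 m1 => g m0 (pure 1 (h * m1))).
have phil' h : lin (phi h) by rewrite /phi; solve_lin.
have phiA h : rlinear (phi h).
  split=> [|m a]; first exact: phil'.
  rewrite /phi hcoact_ract_sw; solve_lin.
  rewrite (sw_lin _ _ (f := fun x : N => ract x a)); solve_lin.
  apply: sw_ext => x y; rewrite g_ractr; apply: sw_ext => u v.
  by rewrite g_ract mulrA.
have phil m : lin (phi ^~ m) by rewrite /phi; solve_lin.
have FE m : F m = sw (rho m) (fun m0 m1 => phi (S' m1) m0).
  have Fg x : F x = g x (pure 1 1).
    rewrite (@gE x _ [:: (1, 1)]) ?/G ?big_seq1 /= ?ract1 //.
    by rewrite /formal_can big_seq1 /= coact1 sw_pureE; solve_lin; rewrite mul1r.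
  rewrite -(hcoact_counit_sw m Fl).
  transitivity (sw (rho m) (fun m0 m1 => sw (D m1) (fun x y => g m0 (pure 1 (S' y * x))))).
    apply: sw_ext => x y; rewrite Fg -(linZ (g_linr x)) -pureZr -S'E.
    by rewrite (sw_lin _ _ (f := fun h => g x (pure 1 h))); solve_lin.
  by rewrite -(hcoact_sw m (T := fun x y z => g x (pure 1 (S' z * y)))); solve_lin.
clearbody phi.
(* The functionals beta_j are the coordinates of S^-1, so F(m) = sum phi_(b_j)(beta_j m); expanding
   beta_j in the basis of H^* gives the components f_a. *)
pose beta j : dual := linfun (fun h => coord (vbasis fullv) j (S' h) : k^o).
have betaE j h : beta j h = coord (vbasis fullv) j (S' h) by rewrite /beta linfunE; solve_lin.
exists (fun a m => \sum_j coord (vbasis fullv) a (beta j) *: phi (bas j) m).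
  move=> a; split=> [c x y|m b].
    rewrite (_ : lin (fun m => \sum_j coord (vbasis fullv) a (beta j) *: phi (bas j) m)) //.
    apply: lin_bigsum => j; apply: lin_scale2; exact: (phiA _).1.
  rewrite (lin_sum _ _ _ (f := fun x : N => ract x b)); solve_lin.
  by apply: eq_bigr => j _; rewrite (phiA _).2 ractZ.
move=> m; rewrite /smash_map exchange_big /= FE.
transitivity (\sum_j phi (bas j) (dual_act (beta j) m)); last first.
  apply: eq_bigr => j _; have pl : lin (phi (bas j)) := (phiA _).1.
  rewrite [X in dual_act X m](pure_coordE (W := 'Hom(H, k^o))).
  rewrite (lin_sum _ _ _ (f := fun a : dual => phi (bas j) (dual_act a m))).
    apply: eq_bigr => a _; rewrite (linZ (@dual_act_linl _ _ _ _ _)).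
    by rewrite (linZ pl).
  by apply: lin_comp => //; exact: dual_act_linl.
transitivity (\sum_j sw (rho m) (fun m0 m1 => (beta j m1 : k) *: phi (bas j) m0)); last first.
  apply: eq_bigr => j _; have pl : lin (phi (bas j)) := (phiA _).1.
  by rewrite /dual_act (sw_lin _ _ pl); apply: sw_ext => x y; rewrite (linZ pl).
rewrite /sw exchange_big; apply: eq_bigr => i _.
rewrite [S' _](pure_coordE (W := H)) (lin_sum _ _ _ (phil _)).
by apply: eq_bigr => j _; rewrite (linZ (phil _)) betaE.
Qed.

End Surjectivity.
End GaloisDescent.

(** * Comparison of the Ext algebras *)

Section RestrictionComplex.
Variables (k : fieldType) (H : hopf_algebra k) (A : comodule_algebra H).
Local Notation B := (coinv A : algType k).

Lemma restr_rlinear (M N : rmodule A) (f : M -> N) :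
  rlinear f -> @rlinear k B (restr M) (restr N) f.
Proof. by case=> f1 f2; split=> // m b; exact: f2. Qed.

Definition restr_obj (X : int -> rmodule A) (i : int) : rmodule B := restr (X i).

Definition restr_fam (X Y : int -> rmodule A) (f : fam X Y) :
  fam (restr_obj X) (restr_obj Y) := f.

Lemma restr_homogeneous (X Y : int -> rmodule A) n (f : fam X Y) :
  homogeneous n f -> homogeneous n (restr_fam f).
Proof. by case=> f1 f2; split=> // i j; exact: restr_rlinear. Qed.

Definition restr_complex (X : complex A) : complex B :=
  @Complex k B (restr_obj X) (restr_fam (cdiff X))
    (restr_homogeneous (cdiff_homogeneous X)) (@cdiffK k A X).

Lemma restr_kprojective (P : complex A) : cosemisimple H -> is_galois A ->
  (forall i, 0 < i -> forall x : P i, x = 0) -> (forall i, rprojective (P i)) ->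
  kprojective (restr_complex P).
Proof.
move=> Hc Ag P0 Pp; apply: bounded_projective_kprojective => // i.
exact: restr_rprojective.
Qed.

Section Stalk.
Variable M : rmodule A.

(* The restriction of the stalk complex and the stalk complex of the restriction *)
(* have the same underlying spaces, but only after a case analysis on the degree. *)
Definition stalk_restr (i : int) : stalk_obj M i -> stalk_obj (restr M) i :=
  match i with Posz 0 => fun x => x | Posz _.+1 => fun x => x | Negz _ => fun x => x end.

Lemma stalk_restr_bij i : bijective (@stalk_restr i).
Proof. by case: i => [[|i]|i] /=; exists id. Qed.

Lemma stalk_restr_rlinear i : @rlinear k B (restr (stalk_obj M i)) _ (@stalk_restr i).
Proof. by case: i => [[|i]|i]; split. Qed.

Lemma stalk_restr_inj i (x y : stalk_obj M i) : stalk_restr x = stalk_restr y -> x = y.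
Proof. exact: (bij_inj (@stalk_restr_bij i)). Qed.

Definition restr_aug (P : complex A) (e : fam P (stalk M)) :
    fam (restr_complex P) (stalk (restr M)) :=
  fun i j x => stalk_restr (e i j x).

Lemma restr_aug_cocycle (P : complex A) (e : fam P (stalk M)) :
  cocycle 0 e -> cocycle 0 (restr_aug e).
Proof.
case=> [[e1 e2] ec]; split; [split=> [i j|i j ij x]|move=> i j x].
- exact: (rlinear_comp (stalk_restr_rlinear j) (restr_rlinear (e1 i j))).
- by rewrite /restr_aug e2 // (rlin0 (stalk_restr_rlinear j)).
- have := ec i j x; rewrite expr0 !scale1r /restr_aug /= => <-.
  by rewrite /zero_fam (rlin0 (stalk_restr_rlinear _)).
Qed.

Lemma restr_aug_quasi_iso (P : complex A) (e : fam P (stalk M)) :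
  quasi_iso e -> quasi_iso (restr_aug e).
Proof.
case=> e1 e2; split=> i.
  move=> x dx [y ey]; apply: (e1 i x dx); exists 0.
  apply: stalk_restr_inj; rewrite [LHS]ey.
  by rewrite /= /zero_fam (rlin0 (stalk_restr_rlinear _)).
move=> y dy; have [s _ sK] := stalk_restr_bij i.
have [//|x dx [y' xE]] := e2 i (s y).
exists x => //; exists 0.
rewrite /restr_aug -{1}(sK y) -(rlinB (stalk_restr_rlinear i)).
rewrite [X in stalk_restr X]xE.
by rewrite /= /zero_fam (rlin0 (stalk_restr_rlinear _)).
Qed.

End Stalk.
End RestrictionComplex.

(** * Hom_B(P, P) as a smash product, with its differential *)

Section SmashFam.
Variables (k : fieldType) (H : hopf_algebra k) (A : comodule_algebra H).
Hypothesis H_cosemisimple : cosemisimple H.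
Hypothesis A_galois : is_galois A.
Variable P : hopf_complex A.
Local Notation dual := 'Hom(H, k^o).
Local Notation I := 'I_(\dim (fullv : {vspace dual})).
Local Notation PB := (restr_complex P).

(* The map f # a |-> (x |-> f (a x)) from Hom_A(P, P) # H^* to Hom_B(P, P). *)
Definition smash_fam (f : I -> fam P P) : fam PB PB := fun i j x =>
  @smash_map k H A (hobj P i) (P j) (fun a => @f a i j) x.

Arguments smash_fam f i j x : clear implicits.

Lemma hdiff_lin i j : lin (cdiff P i j).
Proof. exact: (cdiff_rlinear P i j).1. Qed.

Lemma smash_map_rlinear i j (f : I -> hobj P i -> P j) : (forall a, rlinear (f a)) ->
  @rlinear k (coinv A) (restr (P i)) (restr (P j)) (smash_map f).
Proof.
move=> fl; split=> [c x y|x b].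
  rewrite /smash_map scaler_sumr -big_split; apply: eq_bigr => a _ /=.
  by rewrite dual_act_linr (fl a).1.
transitivity (@ract k A (P j) (smash_map f x) (val b)); last by [].
rewrite /smash_map (lin_sum _ _ _ (f := fun x : P j => ract x (val b))); last first.
  exact: lin_ract1 (@lin_id _ _).
apply: eq_bigr => a _.
by rewrite -(fl a).2 -dual_act_coinv.
Qed.

Lemma smash_fam_homogeneous n (f : I -> fam P P) :
  (forall a, homogeneous n (f a)) -> homogeneous n (smash_fam f).
Proof.
move=> fh; split=> [i j|i j ij x].
  by apply: smash_map_rlinear => a; exact: (fh a).1.
by apply: big1 => a _; rewrite (fh a).2.
Qed.

Lemma smash_fam_diffl (f : I -> fam P P) i j l x :
  cdiff P j l (smash_fam f i j x) =
  @smash_map _ _ _ (hobj P i) (P l) (fun a x => cdiff P j l (f a i j x)) x.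
Proof. by rewrite /smash_fam /smash_map (lin_sum _ _ _ (@hdiff_lin _ _)). Qed.

(** The differential is colinear, hence H^*-linear, and moves past each e_a. *)
Lemma smash_fam_diffr (f : I -> fam P P) i j l x :
  smash_fam f j l (cdiff P i j x) =
  @smash_map _ _ _ (hobj P i) (P l) (fun a x => f a j l (cdiff P i j x)) x.
Proof.
apply: eq_bigr => a _; congr (f a j l _).
exact: (dual_act_colinear (bas a) x (@hdiff_colinear _ _ _ P i j) (@hdiff_lin _ _)).
Qed.

Lemma smash_mapD i j (f g : I -> hobj P i -> P j) x :
  smash_map f x + smash_map g x = smash_map (fun a x => f a x + g a x) x.
Proof. by rewrite /smash_map big_split. Qed.

Lemma smash_mapZ i j c (f : I -> hobj P i -> P j) x :
  c *: smash_map f x = smash_map (fun a x => c *: f a x) x.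
Proof. by rewrite /smash_map scaler_sumr. Qed.

Lemma smash_map_eq i j (f g : I -> hobj P i -> P j) :
  (forall a, rlinear (f a)) -> (forall a, rlinear (g a)) ->
  (forall x, smash_map f x = smash_map g x) -> forall a x, f a x = g a x.
Proof.
move=> fl gl fg a x; apply/eqP; rewrite -subr_eq0; apply/eqP.
pose h a x := f a x - g a x.
have hl b : rlinear (h b) by exact: rlinear_sub.
apply: (smash_map_inj H_cosemisimple A_galois hl _ a x) => y.
by rewrite /smash_map sumrB -/(smash_map f y) fg subrr.
Qed.

Lemma smash_fam_cocycle n (f : I -> fam P P) :
  (forall a, cocycle n (f a)) -> cocycle n (smash_fam f).
Proof.
move=> fc; split; first by apply: smash_fam_homogeneous => a; exact: (fc a).1.
move=> i j x; rewrite [LHS]smash_fam_diffl.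
rewrite -[RHS]/(_ *: smash_fam f (i + 1) (j + 1) (cdiff P i (i + 1) x)) smash_fam_diffr.
by rewrite smash_mapZ; apply: eq_bigr => a _; rewrite (fc a).2.
Qed.

Lemma smash_fam_homotopic n (f g : I -> fam P P) :
  (forall a, homotopic n (f a) (g a)) -> homotopic n (smash_fam f) (smash_fam g).
Proof.
move=> fg; pose h a := s2val (cid2 (fg a)).
have hh a : homogeneous (n - 1) (h a) by rewrite /h; case: cid2.
have hE a := s2valP' (cid2 (fg a)).
exists (smash_fam h); first exact: smash_fam_homogeneous.
move=> i j x; rewrite [cdiff _ _ _ _]smash_fam_diffl.
rewrite -[X in _ *: X]/(smash_fam h (i + 1) j (cdiff P i (i + 1) x)) smash_fam_diffr.
rewrite smash_mapZ smash_mapD -sumrB; apply: eq_bigr => a _; exact: hE.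
Qed.

(** Descent is applied to each pair of degrees; where F vanishes, injectivity forces the components
    to vanish too. *)
Lemma smash_fam_surj n (F : fam PB PB) : homogeneous n F ->
  exists2 f : I -> fam P P, (forall a, homogeneous n (f a)) &
    forall i j x, F i j x = smash_fam f i j x.
Proof.
move=> [F1 F2].
pose f (a : I) : fam P P := fun i j =>
  s2val (cid2 (smash_map_surj H_cosemisimple A_galois (F1 i j).1 (F1 i j).2)) a.
have fl a i j : rlinear (f a i j) by rewrite /f; case: cid2 => /= f' + _; exact.
have fE i j x : F i j x = smash_fam f i j x.
  exact: (s2valP' (cid2 (smash_map_surj H_cosemisimple A_galois (F1 i j).1 (F1 i j).2))).
exists f => // a; split=> // i j ij x.
apply: (smash_map_inj H_cosemisimple A_galois (fun a => fl a i j)) => y.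
by rewrite -[LHS]fE F2.
Qed.

Lemma smash_fam_surj_cocycle n (F : fam PB PB) : cocycle n F ->
  exists2 f : I -> fam P P, (forall a, cocycle n (f a)) &
    forall i j x, F i j x = smash_fam f i j x.
Proof.
case=> Fh Fc; have [f fh fE] := smash_fam_surj Fh; exists f => // a; split=> // i j x.
apply: (smash_map_eq (f := fun a x => cdiff P j (j + 1) (f a i j x))
  (g := fun a x => sg k n *: f a (i + 1) (j + 1) (cdiff P i (i + 1) x))).
- by move=> b; exact: (rlinear_comp (cdiff_rlinear P j (j + 1)) ((fh b).1 i j)).
- move=> b; apply: rlinear_scale.
  exact: (rlinear_comp ((fh b).1 (i + 1) (j + 1)) (cdiff_rlinear P i (i + 1))).
- move=> y; rewrite -smash_fam_diffl -smash_mapZ -smash_fam_diffr -!fE; exact: Fc.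
Qed.

(** A B-linear homotopy has A-linear components, and uniqueness of components splits the homotopy
    equation. *)
Lemma smash_fam_homotopic_inj n (f g : I -> fam P P) :
  (forall a, homogeneous n (f a)) -> (forall a, homogeneous n (g a)) ->
  homotopic n (smash_fam f) (smash_fam g) -> forall a, homotopic n (f a) (g a).
Proof.
move=> fh gh [u /smash_fam_surj[h hh hE] uE] a; exists (h a) => // i j x.
apply: (smash_map_eq (f := fun a x => f a i j x - g a i j x)
  (g := fun a x => cdiff P (j - 1) j (h a i (j - 1) x) +
    sg k n *: h a (i + 1) j (cdiff P i (i + 1) x))).
- by move=> b; apply: rlinear_sub; [exact: (fh b).1|exact: (gh b).1].
- move=> b; apply: rlinear_add.
    exact: (rlinear_comp (cdiff_rlinear P (j - 1) j) ((hh b).1 i (j - 1))).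
  apply: rlinear_scale.
  exact: (rlinear_comp ((hh b).1 (i + 1) j) (cdiff_rlinear P i (i + 1))).
- move=> y; rewrite -[RHS]smash_mapD -smash_fam_diffl -smash_mapZ -smash_fam_diffr -!hE.
  rewrite -[RHS]uE /smash_map sumrB; congr (_ - _).
Qed.

End SmashFam.
Arguments smash_fam {k H A P} f i j x.

(** * The action of the dual on Hom_A(P, P) and multiplicativity *)

Section FamAct.
Variables (k : fieldType) (H : hopf_algebra k) (A : comodule_algebra H).
Variable P : hopf_complex A.
Local Notation dual := 'Hom(H, k^o).
Arguments fam_act {k H A P} a f i j x : rename.

Lemma fam_actE (a : dual) (f : fam P P) i j x :
  fam_act a f i j x = @conj_act k H A (hobj P i) (hobj P j) a (f i j) x.
Proof. by []. Qed.

Lemma fam_act_homogeneous n a (f : fam P P) : homogeneous n f -> homogeneous n (fam_act a f).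
Proof.
case=> f1 f2; split=> [i j|i j ij x]; first
  exact (@conj_act_rlinear k H A (hobj P i) (hobj P j) (f i j) (f1 i j) a).
rewrite /fam_act /sw big1 // => l _.
by rewrite f2 // (lin0 (@dual_act_linr _ _ _ _ _)).
Qed.

Lemma fam_act_diffl a (f : fam P P) i j l x :
  cdiff P j l (fam_act a f i j x) =
  @conj_act k H A (hobj P i) (hobj P l) a (fun x => cdiff P j l (f i j x)) x.
Proof.
rewrite /fam_act (sw_lin _ _ (@hdiff_lin _ _ _ P j l)); apply: sw_ext => a1 a2.
exact/esym/(dual_act_colinear _ _ (@hdiff_colinear _ _ _ P j l) (@hdiff_lin _ _ _ P j l)).
Qed.

Lemma fam_act_diffr a (f : fam P P) i j l x :
  fam_act a f j l (cdiff P i j x) =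
  @conj_act k H A (hobj P i) (hobj P l) a (fun x => f j l (cdiff P i j x)) x.
Proof.
apply: sw_ext => a1 a2.
by rewrite (dual_act_colinear (M := hobj P i) (N := hobj P j) _ _
  (@hdiff_colinear _ _ _ P i j) (@hdiff_lin _ _ _ P i j)).
Qed.

Lemma conj_actD (M N : hopf_module A) a (f g : M -> N) x :
  conj_act a f x + conj_act a g x = conj_act a (fun x => f x + g x) x.
Proof.
rewrite /conj_act /sw -big_split; apply: eq_bigr => i _ /=.
by rewrite (linD (@dual_act_linr _ _ _ _ _)).
Qed.

Lemma conj_actZ (M N : hopf_module A) a c (f : M -> N) x :
  c *: conj_act a f x = conj_act a (fun x => c *: f x) x.
Proof.
rewrite /conj_act sw_scale; apply: sw_ext => a1 a2.
by rewrite (linZ (@dual_act_linr _ _ _ _ _)).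
Qed.

Lemma conj_act_ext (M N : hopf_module A) a (f g : M -> N) x :
  (forall x, f x = g x) -> conj_act a f x = conj_act a g x.
Proof. by move=> fg; apply: sw_ext => a1 a2; rewrite fg. Qed.

Lemma fam_act_cocycle n a (f : fam P P) : cocycle n f -> cocycle n (fam_act a f).
Proof.
case=> fh fc; split; first exact: fam_act_homogeneous.
move=> i j x; rewrite fam_act_diffl fam_act_diffr conj_actZ.
by apply: conj_act_ext => y; exact: fc.
Qed.

Lemma fam_act_homotopic n a (f g : fam P P) :
  homotopic n f g -> homotopic n (fam_act a f) (fam_act a g).
Proof.
case=> h hh hE; exists (fam_act a h); first exact: fam_act_homogeneous.
move=> i j x; rewrite fam_act_diffl fam_act_diffr conj_actZ conj_actD -!scaleN1r.
rewrite !fam_actE conj_actZ conj_actD; apply: conj_act_ext => y.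
by rewrite scaleN1r; exact: hE.
Qed.

Local Notation I := 'I_(\dim (fullv : {vspace dual})).

(** The formula of [smash_mul] for chain maps, with [fam_act] as the action. *)
Definition smash_prod (n : int) (f g : I -> fam P P) : I -> fam P P := fun c i l x =>
  \sum_a \sum_b \sum_j coord (vbasis fullv) c (dual_mul (bas j) (bas b)) *:
    comp_fam n (f a) (fam_act (dual_comul (bas a : dual) j) (g b)) i l x.

(** In f_a e_a g_b e_b, [conj_act_dual_act] moves e_a past g_b, giving sum f_a (e_a(1) . g_b) e_a(2)
    e_b; the product e_a(2) e_b is then expanded in the basis. *)
Lemma comp_smash_fam n (f g : I -> fam P P) i l x :
  (forall a i j, rlinear (f a i j)) -> (forall a i j, rlinear (g a i j)) ->
  comp_fam n (smash_fam f) (smash_fam g) i l x = smash_fam (smash_prod n f g) i l x.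
Proof.
move=> fl gl; have fL a i' j : lin (f a i' j) := (fl a i' j).1.
pose y b := @dual_act _ _ _ (hobj P i) (bas b : dual) x.
transitivity (\sum_a \sum_b f a (i + n) l
   (@dual_act _ _ _ (hobj P (i + n)) (bas a : dual) (g b i (i + n) (y b)))).
  apply: eq_bigr => a _; rewrite /smash_fam /smash_map.
  rewrite (lin_sum _ _ _ (@dual_act_linr _ _ _ (hobj P (i + n)) (bas a))).
  by rewrite (lin_sum _ _ _ (fL a _ _)).
rewrite {1}/smash_fam /smash_map /smash_prod.
rewrite [RHS]exchange_big /=; apply: eq_bigr => a _.
rewrite [RHS]exchange_big /=; apply: eq_bigr => b _.
rewrite [RHS]exchange_big /=.
pose L j z := f a (i + n) l (@conj_act k H A (hobj P i) (hobj P (i + n))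
  (dual_comul (bas a : dual) j) (g b i (i + n)) z).
have Ll j : lin (L j) := lin_comp (fL a _ _) (@conj_act_lin k H A _ _ _ (gl b i (i + n)) _).
transitivity (\sum_j L j (@dual_act _ _ _ (hobj P i) (bas j : dual) (y b))).
  rewrite -(conj_act_dual_act (gl b i (i + n))) /sw.
  by rewrite (lin_sum _ _ _ (fL a _ _)).
apply: eq_bigr => j _; rewrite -dual_act_mul.
rewrite [X in dual_act X _](pure_coordE (W := 'Hom(H, k^o))).
rewrite (lin_sum _ _ _ (f := fun u : dual => L j (@dual_act _ _ _ (hobj P i) u x))).
  apply: eq_bigr => c _; rewrite (linZ (@dual_act_linl _ _ _ _ _)).
  by rewrite (linZ (Ll j)).
exact: (lin_comp (Ll j) (@dual_act_linl _ _ _ _ _)).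
Qed.

End FamAct.

(** * The isomorphism on cohomology classes *)

Section Main.
Variables (k : fieldType) (H : hopf_algebra k) (A : comodule_algebra H).
Hypothesis H_cosemisimple : cosemisimple H.
Hypothesis A_galois : is_galois A.
Variables (M : hopf_module A) (P : hopf_complex A) (e : fam P (stalk M)).
Hypothesis eR : hopf_resolution e.
Local Notation dual := 'Hom(H, k^o).
Local Notation I := 'I_(\dim (fullv : {vspace dual})).
Local Notation PB := (restr_complex P).
Local Notation eB := (restr_aug e).

Let eP : cocycle 0 e. Proof. by case: eR. Qed.
Let eQ : quasi_iso e. Proof. by case: eR. Qed.
Let Pk : kprojective P.
Proof. by case: eR => _ _ _ P0 Pp; exact: bounded_projective_kprojective. Qed.
Let eBP : cocycle 0 eB. Proof. exact: restr_aug_cocycle eP. Qed.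
Let eBQ : quasi_iso eB. Proof. exact: restr_aug_quasi_iso eQ. Qed.
Let PBk : kprojective PB.
Proof. by case: eR => _ _ _ P0 Pp; exact: restr_kprojective. Qed.

(** The action preserves cocycles and homotopies, so the class described by [ext_act] exists and is
    unique. *)
Lemma classifies_ext_act n (a : dual) (c : Ext M n) (f : fam P P) :
  classifies e c f -> classifies e (ext_act e a c) (fam_act a f).
Proof.
move=> cf; have [fP rf] := cf.
have [d df] := classifies_class eP eQ (fam_act_cocycle a fP).
suff -> : ext_act e a c = d by [].
apply: the_classP; first by exists f; split=> //; case: df.
move=> d' [g [gP rg dg]].
have afg := (classifies_eq Pk eP eQ (conj gP rg) cf).1 erefl.
apply/(classifies_eq Pk eP eQ (conj (fam_act_cocycle a gP) dg) df).
exact: fam_act_homotopic.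
Qed.

Lemma classifies_sum n (r : seq I) (c : I -> Ext M n) (f : I -> fam P P) :
  (forall a, classifies e (c a) (f a)) ->
  classifies e (\big[@gadd _ (Ext M) n/gzero (Ext M) n]_(a <- r) c a)
    (fun i j x => \sum_(a <- r) f a i j x).
Proof.
move=> cf; elim: r => [|a r IH].
  rewrite big_nil; have := classifies_dzero Pk eP eQ n.
  by congr (classifies e _ _); apply: fam_ext => i j x; rewrite big_nil.
rewrite big_cons; have := classifies_dadd Pk eP eQ (cf a) IH.
by congr (classifies e _ _); apply: fam_ext => i j x; rewrite big_cons.
Qed.

(* x = sum x_a # e_a, for representatives f_a of the x_a, corresponds to the *)
(* class of sum f_a e_a. *)
Definition smash_class n (c : Ext (restr M) n) (x : smash (ext_act e) n) : Prop :=
  exists f : I -> fam P P, (forall a, classifies e (x a) (f a)) /\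
    classifies eB c (smash_fam f).

(** This and the next three lemmas make [smash_class] the graph of a bijection. *)
Lemma smash_class_total n c : exists x, @smash_class n c x.
Proof.
have [F cF] := classifies_ex PBk eBP eBQ c.
have [f fP fE] := smash_fam_surj_cocycle H_cosemisimple A_galois cF.1.
exists (fun a => projT1 (cid (classifies_class eP eQ (fP a)))), f; split.
  by move=> a; case: cid.
apply: (classifies_homotopic PBk eBP eBQ cF); first exact: smash_fam_cocycle.
exact: homotopic_ext.
Qed.

Lemma smash_class_surj n x : exists c, @smash_class n c x.
Proof.
pose f a := projT1 (cid (classifies_ex Pk eP eQ (x a))).
have fE a : classifies e (x a) (f a) by rewrite /f; case: cid.
have [|c cf] := @classifies_class _ _ _ _ _ eBP eBQ n (smash_fam f).
  by apply: smash_fam_cocycle => a; exact: (fE a).1.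
by exists c, f.
Qed.

Lemma smash_class_fun n c x x' : @smash_class n c x -> smash_class c x' -> x = x'.
Proof.
move=> [f [xf cf]] [f' [xf' cf']]; apply/functional_extensionality_dep => a.
apply/(classifies_eq Pk eP eQ (xf a) (xf' a)).
have ff' := (classifies_eq PBk eBP eBQ cf cf').1 erefl.
apply: (smash_fam_homotopic_inj H_cosemisimple A_galois _ _ ff') => b.
  exact: (xf b).1.1.
exact: (xf' b).1.1.
Qed.

Lemma smash_class_inj n c c' x : @smash_class n c x -> smash_class c' x -> c = c'.
Proof.
move=> [f [xf cf]] [f' [xf' cf']].
apply/(classifies_eq PBk eBP eBQ cf cf'); apply: smash_fam_homotopic => a.
exact: (classifies_eq Pk eP eQ (xf a) (xf' a)).1.
Qed.

Lemma smash_class_add n c c' x x' : @smash_class n c x -> smash_class c' x' ->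
  smash_class (gadd c c') (gadd x x').
Proof.
move=> [f [xf cf]] [f' [xf' cf']]; exists (fun a => add_fam (f a) (f' a)).
split=> [a|]; first exact: classifies_dadd (xf a) (xf' a).
have C := classifies_dadd PBk eBP eBQ cf cf'.
apply: (classifies_homotopic PBk eBP eBQ C).
  by apply: smash_fam_cocycle => a; apply: cocycle_add; [exact: (xf a).1|exact: (xf' a).1].
by apply: homotopic_ext => i j y; exact: smash_mapD.
Qed.

Lemma smash_class_scale n a c x : @smash_class n c x ->
  smash_class (gscale a c) (gscale a x).
Proof.
move=> [f [xf cf]]; exists (fun b => scale_fam a (f b)).
split=> [b|]; first exact: classifies_dscale (xf b).
have C := classifies_dscale PBk eBP eBQ a cf.
apply: (classifies_homotopic PBk eBP eBQ C).
  by apply: smash_fam_cocycle => b; apply: cocycle_scale; exact: (xf b).1.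
by apply: homotopic_ext => i j y; exact: smash_mapZ.
Qed.

Lemma smash_class_one : smash_class (gone (Ext (restr M))) (gone (smash (ext_act e))).
Proof.
have D := classifies_did Pk eP eQ.
exists (fun a => scale_fam (coord (vbasis fullv) a (dual_one H)) (id_fam P)).
split=> [a|]; first exact: classifies_dscale D.
apply: (classifies_homotopic PBk eBP eBQ (classifies_did PBk eBP eBQ)).
  by apply: smash_fam_cocycle => a; apply: cocycle_scale; exact: id_fam_cocycle.
apply: homotopic_ext => i j x.
have il : lin (id_fam P i j) := ((id_fam_homogeneous P).1 i j).1.
transitivity (id_fam P i j x); first by [].
rewrite -{1}(@dual_act_one _ _ _ (hobj P i) x).
(* The counit acts as the identity; its coordinates in the basis of H^* are the coefficients of the
   unit of the smash product. *)
rewrite [in LHS](pure_coordE (W := 'Hom(H, k^o)) (dual_one H)).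
rewrite (lin_sum _ _ _ (@dual_act_linl _ _ _ (hobj P i) x)) (lin_sum _ _ _ il).
apply: eq_bigr => a _; rewrite (linZ (@dual_act_linl _ _ _ (hobj P i) x)) (linZ il).
by [].
Qed.

Lemma smash_class_mul m n c c' x x' : @smash_class m c x -> @smash_class n c' x' ->
  smash_class (gmul c c') (gmul x x').
Proof.
move=> [f [xf cf]] [f' [xf' cf']]; exists (smash_prod n f f').
have pc a : classifies e (gmul x x' a) (smash_prod n f f' a).
  apply: classifies_sum => a'; apply: classifies_sum => b; apply: classifies_sum => j.
  apply: classifies_dscale => //; apply: classifies_dcomp => //.
  exact: classifies_ext_act.
split=> //.
have C := classifies_dcomp PBk eBP eBQ cf cf'.
apply: (classifies_homotopic PBk eBP eBQ C).
  by apply: smash_fam_cocycle => a; exact: (pc a).1.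
apply: homotopic_ext => i j y; apply: comp_smash_fam => a i' j'.
  exact: (xf a).1.1.1.
exact: (xf' a).1.1.1.
Qed.

End Main.

Theorem corollary2p3 (k : fieldType) (H : hopf_algebra k)
    (H_semisimple : semisimple H) (H_cosemisimple : cosemisimple H)
    (A : comodule_algebra H) (A_galois : is_galois A)
    (M : hopf_module A)
    (P : hopf_complex A) (e : fam P (stalk M))
    (eP : hopf_resolution e) :
  graded_algebra_iso (Ext (restr M)) (smash (ext_act e)).
Proof.
have total n c := cid (smash_class_total H_cosemisimple A_galois eP (n := n) c).
(* The map is chosen from the graph; by uniqueness ([phiE]) each law of a homomorphism reduces to
   closure of [smash_class] under the operation. *)
pose phi n c := projT1 (total n c).
have phiP n c : smash_class c (phi n c) by rewrite /phi; case: (total n c).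
have phiE n c x : smash_class c x -> phi n c = x.
  exact: (smash_class_fun H_cosemisimple A_galois eP (phiP n c)).
exists phi; split.
- move=> n; pose psi (x : smash (ext_act e) n) := projT1 (cid (smash_class_surj eP x)).
  have psiP x : smash_class (psi x) x by rewrite /psi; case: cid.
  exists psi => [c|x]; last exact: phiE.
  exact: (smash_class_inj H_cosemisimple A_galois eP (psiP _)).
- by move=> n x y; apply: phiE; apply: smash_class_add.
- by move=> n a x; apply: phiE; apply: smash_class_scale.
- by apply: phiE; apply: smash_class_one.
- by move=> m n x y; apply: phiE; apply: smash_class_mul.
Qed.
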